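(* Assume that $\alpha>-1$ is a real number. Then, for any $N\in\mathbb{N}$, any $f\in C_\infty(W_{\ge}^N)$ and any $t\ge 0$, $$T_{\alpha,t}^{N+1}\,\Lambda_{\alpha,N}^{N+1} f=\Lambda_{\alpha,N}^{N+1}\,T_{\alpha,t}^{N} f .$$
   Context: Weyl chambers: $W_{\ge}^N=\{\mathbf{x}=(x_1,\dots,x_N)\in[0,\infty)^N : x_1\le\dots\le x_N\}$ and $\mathring{W}_{\ge}^N=\{\mathbf{x}\in W_{\ge}^N: 0<x_1<\dots<x_N\}$. $C_\infty(W_{\ge}^N)$ is the set of continuous real functions on $W_{\ge}^N$ vanishing at infinity. Vandermonde: $\Delta_N(\mathbf{y})=\prod_{1\le i<j\le N}(y_j-y_i)$. Pochhammer symbol: $(x)_n=x(x+1)\cdots(x+n-1)$. A Markov kernel $\Lambda$ from $E$ to $E'$ acts on functions by $(\Lambda f)(x)=\int_{E'}\Lambda(x,dy)f(y)$. Laguerre semigroup: for $\alpha>-1$, let $p_{\alpha,t}(x,y)$ be the transition density (with respect to Lebesgue measure) of the diffusion on $[0,\infty)$ with generator $L_\alpha=x\frac{d^2}{dx^2}+(-x+1+\alpha)\frac{d}{dx}$, where $\infty$ is a natural boundary and the origin is an entrance boundary if $\alpha\ge 0$ and a regular boundary with reflecting boundary condition if $-1<\alpha<0$ (equivalently, $p_{\alpha,t}$ is the transition function of the solution of $dX_t=\sqrt{2X_t}\,dB_t+(-X_t+\alpha+1)\,dt$). For $t>0$, $\mathbf{x}\in\mathring{W}_{\ge}^N$, $\mathbf{y}\in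 W_{\ge}^N$ put $$\mathbf{p}_{\alpha,t}^N(\mathbf{x},\mathbf{y})=e^{-\lambda^N t}\frac{\Delta_N(\mathbf{y})}{\Delta_N(\mathbf{x})}\det_{i,j=1}^N[p_{\alpha,t}(x_i,y_j)],\qquad \lambda^N=-\tfrac{N(N-1)}{2}.$$ $\{T_{\alpha,t}^N\}_{t\ge0}$ is the Markov semigroup on $W_{\ge}^N$ with transition density $\mathbf{p}_{\alpha,t}^N$ ($T_{\alpha,0}^N$ is the identity); it is known to be Feller–Dynkin on $W_{\ge}^N$, its values at starting points in $W_{\ge}^N\setminus\mathring{W}_{\ge}^N$ being determined by continuity. Kernel: for $\mathbf{x}\in\mathring{W}_{\ge}^{N+1}$, $\Lambda_{\alpha,N}^{N+1}(\mathbf{x},\cdot)$ is the measure on $W_{\ge}^N$ given by $$\Lambda_{\alpha,N}^{N+1}(\mathbf{x},d\mathbf{y})=N!\,(\alpha+1)_N\frac{\Delta_N(\mathbf{y})}{\Delta_{N+1}(\mathbf{x})}\prod_{k=1}^N\bigg(\mathbf{1}_{[x_{k-1},x_{k+1}]}(y_k)\int_{x_k\vee y_k}^{x_{k+1}\wedge y_{k+1}}\frac{y_k^\alpha}{z^{\alpha+1}}\,dz\bigg)d\mathbf{y},$$ with the conventions $x_0=0$ and $y_{N+1}=\infty$. For $\mathbf{x}\in W_{\ge}^{N+1}\setminus\mathring{W}_{\ge}^{N+1}$, $\Lambda_{\alpha,N}^{N+1}(\mathbf{x},\cdot)$ is defined as the weak limit of $\Lambda_{\alpha,N}^{N+1}(\mathbf{x}^n,\cdot)$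 along any sequence $\mathbf{x}^n\in\mathring{W}_{\ge}^{N+1}$ with $\mathbf{x}^n\to\mathbf{x}$ (the limit exists and does not depend on the sequence). *)

(* Defs.v *)
From HB Require Import structures.
From mathcomp Require Import all_boot all_order all_algebra.
From mathcomp Require Import all_classical all_reals all_analysis.
Set Implicit Arguments.
Unset Strict Implicit.
Unset Printing Implicit Defensive.
Import Order.TTheory GRing.Theory Num.Theory.
Import numFieldNormedType.Exports.
Local Open Scope classical_set_scope.
Local Open Scope ring_scope.

(* The Borel sigma-algebra of R^n, generated by the coordinate maps. *)
Definition measure_row_display : measure_display -> measure_display.
Proof. exact. Qed.

Section measurable_row.
Context {R : realType}.
Variable n : nat.

Let coor (i : 'I_n) (x : 'rV[R]_n) : R := x ord0 i.

Let row_set0 : g_sigma_preimage coor set0.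
Proof. exact: sigma_algebra0. Qed.

Let row_setC A : g_sigma_preimage coor A -> g_sigma_preimage coor (~` A).
Proof. exact: sigma_algebraC. Qed.

Let row_bigcup (F : _^nat) : (forall i, g_sigma_preimage coor (F i)) ->
  g_sigma_preimage coor (\bigcup_i (F i)).
Proof. exact: sigma_algebra_bigcup. Qed.

HB.instance Definition _ :=
  @isMeasurable.Build (measure_row_display default_measure_display)
    'rV[R]_n (g_sigma_preimage coor) row_set0 row_setC row_bigcup.

Lemma measurable_row_coord (i : 'I_n) :
  measurable_fun [set: 'rV[R]_n] (fun x => x ord0 i).
Proof.
move=> _ Y mY; rewrite setTI; apply: sub_sigma_algebra => /=.
rewrite -bigcup_seq/=; exists i => /=; first by rewrite mem_index_enum.
by exists Y => //; rewrite setTI.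
Qed.

Lemma measurable_fun_row d (T : measurableType d) (f : T -> 'rV[R]_n) :
  (forall i, measurable_fun [set: T] (fun t => f t ord0 i)) ->
  measurable_fun [set: T] f.
Proof.
move=> mf _ Y; rewrite setTI => mY.
suff : g_sigma_preimage coor `<=` [set A | measurable (f @^-1` A)] by exact.
apply: smallest_sub; first split => /=.
- by rewrite preimage_set0; exact: measurable0.
- by move=> A mA; rewrite setTD preimage_setC; exact: measurableC.
- by move=> F mF; rewrite preimage_bigcup; exact: bigcupT_measurable.
move=> A; rewrite -bigcup_seq/= => -[i _ [B mB <-]] /=.
by have := mf i measurableT B mB; rewrite !setTI.
Qed.

End measurable_row.

Section lebesgue_row.
Context {R : realType}.

Definition row_cons n (p : R * 'rV[R]_n) : 'rV[R]_n.+1 := row_mx p.1%:M p.2.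

Lemma row_cons0 n (p : R * 'rV[R]_n) : row_cons p ord0 ord0 = p.1.
Proof.
have -> : row_cons p ord0 ord0 = row_mx p.1%:M p.2 ord0 (lshift n (ord0 : 'I_1)).
  by congr (row_mx _ _ _ _); exact: val_inj.
by rewrite row_mxEl mxE.
Qed.

Lemma row_consS n (p : R * 'rV[R]_n) (i : 'I_n) :
  row_cons p ord0 (lift ord0 i) = p.2 ord0 i.
Proof.
have -> : row_cons p ord0 (lift ord0 i) = row_mx p.1%:M p.2 ord0 (rshift 1 i).
  by congr (row_mx _ _ _ _); exact: val_inj.
by rewrite row_mxEr.
Qed.

Lemma measurable_row_cons n : measurable_fun setT (@row_cons n).
Proof.
apply: measurable_fun_row => i; case: (unliftP ord0 i) => [j|] ->.
  under eq_fun do rewrite row_consS.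
  exact: (measurableT_comp (measurable_row_coord j)).
by under eq_fun do rewrite row_cons0; exact: measurable_fst.
Qed.

Let row_uncons n (x : 'rV[R]_n.+1) : R * 'rV[R]_n :=
  (x ord0 ord0, \row_(j < n) x ord0 (lift ord0 j)).

Let row_consK n : cancel (@row_cons n) (@row_uncons n).
Proof.
move=> [a v]; rewrite /row_uncons row_cons0; congr pair.
by apply/rowP => j; rewrite mxE row_consS.
Qed.

Let measurable_row_uncons n : measurable_fun setT (@row_uncons n).
Proof.
apply: measurable_fun_pair; first exact: measurable_row_coord.
apply: measurable_fun_row => j; under eq_fun do rewrite mxE.
exact: measurable_row_coord.
Qed.

Section lebesgue_row_cons.
Variables (n : nat) (mu : {sigma_finite_measure set 'rV[R]_n -> \bar R}).

Definition lebesgue_row_cons : set 'rV[R]_n.+1 -> \bar R :=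
  pushforward (lebesgue_measure \x mu)%E (@row_cons n).

HB.instance Definition _ := Measure.copy lebesgue_row_cons
  (measure_function_pushforward__canonical__measure_function_Measure
     (lebesgue_measure \x mu)%E (@measurable_row_cons n)).

Let sigma_finite_lebesgue_row_cons : sigma_finite setT lebesgue_row_cons.
Proof.
have /sigma_finiteP[F [TF ndF Foo]] := sigma_finiteT (@lebesgue_measure R).
have /sigma_finiteP[G [TG ndG Goo]] := sigma_finiteT mu.
exists (fun k => @row_uncons n @^-1` (F k `*` G k)).
  rewrite -preimage_bigcup (_ : \bigcup_k _ = setT) ?preimage_setT//.
  rewrite -setXTT TF TG predeqE => -[x y]; split => [[k _ []]|[]] /=.
    by split; exists k.
  move=> [k _ Fkx] [l _ Gly]; exists (maxn k l) => //; split.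
    by move: x Fkx; exact/subsetPset/ndF/leq_maxl.
  by move: y Gly; exact/subsetPset/ndG/leq_maxr.
move=> k; have [mF Fkoo] := Foo k; have [mG Gkoo] := Goo k; split.
  rewrite -[X in measurable X]setTI; apply: measurable_row_uncons => //.
  exact: measurableX.
rewrite /lebesgue_row_cons /pushforward -comp_preimage.
rewrite (_ : _ \o _ = id) ?preimage_id; last first.
  by apply/funext => p; exact: row_consK.
by rewrite product_measure1E// lte_mul_pinfty// ge0_fin_numE.
Qed.

HB.instance Definition _ := Measure_isSigmaFinite.Build _ _ _ lebesgue_row_cons
  sigma_finite_lebesgue_row_cons.

End lebesgue_row_cons.

(* Lebesgue measure on R^n; on R^0 it is the unit mass. *)
Fixpoint lebesgue_row n : {sigma_finite_measure set 'rV[R]_n -> \bar R} :=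
  if n is m.+1 then lebesgue_row_cons (lebesgue_row m) else \d_(0 : 'rV[R]_0).

Lemma lebesgue_row_box n (A : 'I_n -> set R) :
  (forall i, measurable (A i)) ->
  lebesgue_row n [set x | forall i, A i (x ord0 i)] =
  (\prod_(i < n) lebesgue_measure (A i))%E.
Proof.
elim: n A => [|n IH] A mA.
  rewrite big_ord0 /= diracE mem_set//; by case.
rewrite big_ord_recl -IH; last by move=> i; exact: mA.
pose B : set 'rV[R]_n := [set x | forall i, A (lift ord0 i) (x ord0 i)].
transitivity ((lebesgue_measure \x lebesgue_row n)%E (A ord0 `*` B)).
  rewrite /= /lebesgue_row_cons /pushforward; congr product_measure1.
  apply/seteqP; split => [p /= Ap|p /= [A0 AS] i].
    split => [|i /=]; first by have := Ap ord0; rewrite row_cons0.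
    by have := Ap (lift ord0 i); rewrite row_consS.
  case: (unliftP ord0 i) => [j|] ->; last by rewrite row_cons0.
  by rewrite row_consS; exact: AS.
have mB : measurable B.
  rewrite (_ : B = \bigcap_(i in [set: 'I_n])
    ((fun x : 'rV[R]_n => x ord0 i) @^-1` A (lift ord0 i))); last first.
    by apply/seteqP; split => x /= Ax i => [_|]; exact: Ax.
  apply: fin_bigcap_measurable => // i _.
  by rewrite -[X in measurable X]setTI; exact: measurable_row_coord.
by rewrite product_measure1E//; exact: mA.
Qed.

End lebesgue_row.

Section feller_semigroups.
Context {R : realType} {V : topologicalType}.
Implicit Types (E : set V) (f g : V -> R) (T : R -> (V -> R) -> V -> R).

(* A function on a state space E `<=` V is represented by a total function on V
   whose values outside E are irrelevant. *)
Definition C_infty E f :=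
  {within E, continuous f} /\
  forall e : R, 0 < e ->
    exists2 C : set V, compact C & forall x, E x -> ~ C x -> `|f x| < e.

Record feller_dynkin E T : Prop := FellerDynkin {
  feller_C_infty : forall t f, 0 <= t -> C_infty E f -> C_infty E (T t f) ;
  feller_contraction : forall t f, 0 <= t -> C_infty E f ->
    (forall x, E x -> 0 <= f x <= 1) -> forall x, E x -> 0 <= T t f x <= 1 ;
  feller_id : forall f, C_infty E f -> forall x, E x -> T 0 f x = f x ;
  feller_semigroup : forall s t f, 0 <= s -> 0 <= t -> C_infty E f ->
    forall x, E x -> T (s + t) f x = T s (T t f) x ;
  feller_continuous : forall f, C_infty E f ->
    {uniform E, T t f @[t --> 0^'+] --> f} }.

(* f is in the domain of the infinitesimal generator of T, which maps it to g *)
Definition feller_generator E T f g :=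
  [/\ C_infty E f, C_infty E g &
      {uniform E, (fun x => (T t f x - f x) / t) @[t --> 0^'+] --> g}].

End feller_semigroups.

Definition kernel_op {R : realType} d (V : Type) (V' : measurableType d)
    (E' : set V') (K : V -> probability V' R) (f : V' -> R) (x : V) : R :=
  \int[K x]_(y in E') f y.

Section laguerre_diffusion.
Context {R : realType}.
Variable alpha : R.

Local Notation E := (`[0, +oo[%classic : set R).

Definition laguerre_op (f : R -> R) (x : R) : R :=
  x * f^`(2)%classic x + (- x + 1 + alpha) * f^`()%classic x.

(* Feller's description of the generator of the diffusion as an operator on
   C_infty(E). In terms of the scale density s'(x) = x^(-alpha-1) e^x, the last
   condition reads f'(x)/s'(x) --> 0 as x --> 0+. For -1 < alpha < 0 it is the
   reflecting boundary condition at the regular boundary 0; for 0 <= alpha it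
   holds automatically, 0 being an entrance boundary. The natural boundary +oo
   requires no condition. *)
Definition laguerre_generator (f g : R -> R) :=
  [/\ C_infty E f, C_infty E g,
      forall x, 0 < x -> derivable f x 1 /\ derivable f^`()%classic x 1,
      forall x, 0 < x -> g x = laguerre_op f x &
      x `^ (alpha + 1) * expR (- x) * f^`()%classic x @[x --> 0^'+] --> 0].

Record laguerre_diffusion (Q : R -> R -> probability R R) : Prop := {
  laguerre_conservative : forall t x, 0 <= t -> E x -> Q t x E = 1%E ;
  laguerre_feller : feller_dynkin E (fun t => kernel_op E (Q t)) ;
  laguerre_generatorE : forall f g,
    feller_generator E (fun t => kernel_op E (Q t)) f g <->
    laguerre_generator f g }.

Definition laguerre_transition_density (p : R -> R -> R -> R) :=
  exists2 Q, laguerre_diffusion Q &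
    forall t x, 0 < t -> E x ->
    [/\ measurable_fun E (p t x),
        forall y, E y -> 0 <= p t x y &
        forall A, measurable A ->
          Q t x A =
            (\int[lebesgue_measure]_(y in A `&` E) (p t x y)%:E)%E].

End laguerre_diffusion.

Section weyl.
Context {R : realType}.
Implicit Types N : nat.

Definition weyl N : set 'rV[R]_N :=
  [set x | (forall i, 0 <= x ord0 i) /\
           (forall i j : 'I_N, (i < j)%N -> x ord0 i <= x ord0 j)].

Arguments weyl : clear implicits.

Definition weyl_interior N : set 'rV[R]_N :=
  [set x | (forall i, 0 < x ord0 i) /\
           (forall i j : 'I_N, (i < j)%N -> x ord0 i < x ord0 j)].

Arguments weyl_interior : clear implicits.

Definition vdm N (x : 'rV[R]_N) : R :=
  \prod_(i < N) \prod_(j < N | (i < j)%N) (x ord0 j - x ord0 i).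

Definition pochhammer (x : R) (n : nat) : R := \prod_(i < n) (x + i%:R).

Definition laguerre_lambda N : R := - ((N * N.-1)%:R / 2).

Definition laguerre_weyl_density (p : R -> R -> R -> R) N (t : R)
    (x y : 'rV[R]_N) : R :=
  expR (- laguerre_lambda N * t) * (vdm y / vdm x) *
  \det (\matrix_(i < N, j < N) p t (x ord0 i) (y ord0 j)).

(* The Feller-Dynkin property determines the kernels P t x at the points x of
   the chamber outside its interior, by continuity. *)
Record laguerre_weyl_semigroup (p : R -> R -> R -> R) N
    (P : R -> 'rV[R]_N -> probability 'rV[R]_N R) : Prop := {
  laguerre_weyl_conservative : forall t x, 0 <= t -> weyl N x ->
    P t x (weyl N) = 1%E ;
  laguerre_weyl_densityE : forall t x A, 0 < t -> weyl_interior N x ->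
    measurable A ->
    P t x A = (\int[lebesgue_row N]_(y in A `&` weyl N)
                 (laguerre_weyl_density p t x y)%:E)%E ;
  laguerre_weyl_feller :
    feller_dynkin (weyl N) (fun t => kernel_op (weyl N) (P t)) }.

(* The coordinates x_1, ..., x_N with 1-based indices, and x_0 = 0. *)
Definition coord1 N (x : 'rV[R]_N) (k : nat) : R :=
  if k is k'.+1 then oapp (x ord0) 0 (insub k') else 0.

(* The case k = N accounts for the convention y_(N+1) = +oo. *)
Definition link_upper N (x : 'rV[R]_N.+1) (y : 'rV[R]_N) (k : nat) : R :=
  if k == N then coord1 x k.+1
  else Num.min (coord1 x k.+1) (coord1 y k.+1).

Definition link_density (alpha : R) N (x : 'rV[R]_N.+1) (y : 'rV[R]_N) : R :=
  N`!%:R * pochhammer (alpha + 1) N * (vdm y / vdm x) *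
  \prod_(1 <= k < N.+1)
    (\1_(`[coord1 x k.-1, coord1 x k.+1]%classic) (coord1 y k) *
     \int[lebesgue_measure]_(z in
         `[Num.max (coord1 x k) (coord1 y k), link_upper x y k])
       (coord1 y k `^ alpha / z `^ (alpha + 1))).

Definition weak_cvg N (mu : nat -> probability 'rV[R]_N R)
    (nu : probability 'rV[R]_N R) :=
  forall g : 'rV[R]_N -> R, {within weyl N, continuous g} ->
    (exists M : R, forall y, weyl N y -> `|g y| <= M) ->
    \int[mu n]_(y in weyl N) g y @[n --> \oo] --> \int[nu]_(y in weyl N) g y.

Record laguerre_link (alpha : R) N
    (K : 'rV[R]_N.+1 -> probability 'rV[R]_N R) : Prop := {
  laguerre_link_conservative : forall x, weyl N.+1 x -> K x (weyl N) = 1%E ;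
  laguerre_link_densityE : forall x A, weyl_interior N.+1 x -> measurable A ->
    K x A = (\int[lebesgue_row N]_(y in A `&` weyl N)
               (link_density alpha x y)%:E)%E ;
  laguerre_link_weak_limit : forall x (u : nat -> 'rV[R]_N.+1),
    weyl N.+1 x -> ~ weyl_interior N.+1 x ->
    (forall n, weyl_interior N.+1 (u n)) -> u n @[n --> \oo] --> x ->
    weak_cvg (fun n => K (u n)) (K x) }.

End weyl.

Arguments weyl {R} N.
Arguments weyl_interior {R} N.

(* Main.v *)
Require Import Defs.
From mathcomp Require Import all_boot all_order all_algebra fingroup perm.
From mathcomp Require Import all_classical all_reals all_analysis.
From mathcomp Require Import measurable_realfun ring lra.
Set Implicit Arguments.
Unset Strict Implicit.
Unset Printing Implicit Defensive.
Import Order.TTheory GRing.Theory Num.Theory.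
Import numFieldNormedType.Exports.
Local Open Scope classical_set_scope.
Local Open Scope ring_scope.

(** Let $Ag(z)=z^{-\alpha-1}\int_0^zy^\alpha g(y)\,dy$ and
    $\Phi g(x)=\int_0^xAg$. In dimension one the Laguerre semigroup $Q_t$
    satisfies $e^t(Q_t\Phi g(b)-Q_t\Phi g(a))=\int_a^bAQ_tg$
    ([laguerre_intertwining]). It suffices to know this for exponentials
    $e_s(y)=e^{-sy}$, from which indicators of intervals are obtained as bounded
    limits of polynomials in exponentials. By uniqueness for the Cauchy problem
    ([feller_orbit_unique]) $Q_te_s$ is an explicit multiple of another
    exponential ([laguerre_decay]). With $B=y\partial^2+(\alpha+1)\partial$ one
    has $ABe_s=e_s'$ and $BQ_te_s=e^{-t}Q_tBe_s$, which is the relation for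
    $Be_s$; it passes to $e_s$ through a differential equation in $s$
    ([defect_decay]).

    In dimension $N$ the link is also a determinant: with
    $\psi_{a,b}(y)=\int_a^by^\alpha z^{-\alpha-1}1_{y\le z}\,dz$, interlacing
    leaves a single permutation in $\det[\psi_{x_i,x_{i+1}}(y_j)]$, and the
    product that remains is the one in the density of the link
    ([link_density_det]). So the semigroup and the link both have, up to a
    constant, densities $\Delta(y)\det[a_j(y_i)]$, and Andréief's identity turns
    their integrals of $\det[b_j(y_i)]/\Delta(y)$ into determinants of
    one-dimensional integrals ([andreief], [determinantal_integral]).

    Let the $b_j$ be indicators of successive disjoint intervals. As
    $\int\psi_{x_i,x_{i+1}}b_j=\Phi b_j(x_{i+1})-\Phi b_j(x_i)$, the link maps
    $\det[b_j(y_i)]/\Delta_N(y)$ to a multiple of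
    $\det[1,\Phi b_j(x_i)]/\Delta_{N+1}(x)$ ([det_increments]), and applying the
    semigroup replaces $\Phi b_j$ by $Q_t\Phi b_j$. In the other order the
    semigroup replaces $b_j$ by $Q_tb_j$ and the link produces the increments
    $\int_{x_i}^{x_{i+1}}AQ_tb_j$. By the one-dimensional relation the two
    results agree: the factor $e^t$ from each of the $N$ columns accounts for
    $\lambda^N-\lambda^{N+1}=N$ ([box_intertwined]).

    On the open chamber a bounded continuous function is a bounded pointwise
    limit of combinations of these quotients ([continuous_intertwined]), which
    proves the theorem for $t>0$ and interior starting points
    ([intertwining_interior]). At the other starting points both sides are
    limits from the interior: the link maps bounded continuous functions to
    continuous functions on the closed chamber ([link_continuous]), and so does
    the semigroup, because it is Feller and conservative
    ([feller_bounded_cvg]). *)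

(** * Bounded functions, dominated convergence and densities *)

Section rintegral_complements.
Context d (T : measurableType d) (R : realType).
Variable mu : {measure set T -> \bar R}.
Implicit Types (D : set T) (f g : T -> R).

Lemma finite_bounded_integrable D f (M : R) : measurable D ->
  (mu D < +oo)%E -> measurable_fun D f -> (forall x, D x -> `|f x| <= M) ->
  mu.-integrable D (EFin \o f).
Proof.
move=> mD muD mf fM; apply: measurable_bounded_integrable => //.
exists M; split; first exact: num_real.
by move=> N MN x /= Dx; rewrite (le_trans (fM x Dx))// ltW.
Qed.

Lemma integrableZl_real D f (c : R) : measurable D ->
  mu.-integrable D (EFin \o f) -> mu.-integrable D (EFin \o (fun x => c * f x)).
Proof. by move=> mD /(integrableZl mD c). Qed.

Lemma integrable_normr D f : measurable D ->
  mu.-integrable D (EFin \o f) -> mu.-integrable D (EFin \o (fun x => `|f x|)).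
Proof. by move=> mD /integrable_abse. Qed.

Lemma finite_cst_integrable D (M : R) : measurable D -> (mu D < +oo)%E ->
  mu.-integrable D (EFin \o (fun=> M)).
Proof.
by move=> mD muD; apply: (finite_bounded_integrable mD muD) => // x _; exact: lexx.
Qed.

Lemma dominated_integrable_real D f g : measurable D -> measurable_fun D f ->
  mu.-integrable D (EFin \o g) -> (forall x, D x -> `|f x| <= g x) ->
  mu.-integrable D (EFin \o f).
Proof.
move=> mD mf ig fg; apply: le_integrable ig => //.
  exact/measurable_EFinP.
by move=> x Dx /=; rewrite lee_fin (le_trans (fg x Dx))// ler_norm.
Qed.

Lemma integrable_mulr_bounded D f g (M : R) : measurable D ->
  mu.-integrable D (EFin \o f) -> measurable_fun D g ->
  (forall x, D x -> `|g x| <= M) ->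
  mu.-integrable D (EFin \o (fun x => g x * f x)).
Proof.
move=> mD If mg gM.
have mf : measurable_fun D f by apply/measurable_EFinP; exact: measurable_int If.
apply: (@dominated_integrable_real _ _ (fun x => M * `|f x|)) => //.
- exact: measurable_funM.
- by apply: integrableZl_real => //; exact: integrable_normr.
- by move=> x Dx; rewrite normrM ler_wpM2r// gM.
Qed.

Lemma dominated_convergence_real D (f_ : nat -> T -> R) f g :
  measurable D -> (forall n, measurable_fun D (f_ n)) ->
  (forall x, D x -> f_ n x @[n --> \oo] --> f x) ->
  mu.-integrable D (EFin \o g) ->
  (forall n x, D x -> `|f_ n x| <= g x) ->
  [/\ measurable_fun D f, mu.-integrable D (EFin \o f) &
      \int[mu]_(x in D) f_ n x @[n --> \oo] --> \int[mu]_(x in D) f x].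
Proof.
move=> mD mf_ cf ig fg.
have mf : measurable_fun D f.
  exact: (measurable_fun_cvg mf_).
have fgl x : D x -> `|f x| <= g x.
  move=> Dx; have /cvg_norm cfx := cf x Dx.
  rewrite -(cvg_lim (@Rhausdorff R) cfx); apply: limr_le.
    by apply/cvg_ex; eexists; exact: cfx.
  by apply: nearW => n; exact: fg.
have If := dominated_integrable_real mD mf ig fgl.
split => //.
have [| | | |_ _] := @dominated_convergence _ T R mu D mD
  (fun n => EFin \o f_ n) (EFin \o f) (EFin \o g) _ _ _ ig.
- by move=> n; exact/measurable_EFinP.
- exact/measurable_EFinP.
- apply: aeW => x Dx /=; apply: cvg_EFin; last exact: cf.
  exact: nearW.
- by apply: aeW => x n Dx /=; rewrite lee_fin fg.
by move=> h; apply: fine_cvg; rewrite fineK//; exact: integrable_fin_num.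
Qed.

Lemma Rintegral_sum D (I : Type) (s : seq I) (P : pred I) (h : I -> T -> R) :
  measurable D -> (forall i, mu.-integrable D (EFin \o h i)) ->
  mu.-integrable D (EFin \o (fun x => \sum_(i <- s | P i) h i x)) /\
  \int[mu]_(x in D) (\sum_(i <- s | P i) h i x) =
  \sum_(i <- s | P i) \int[mu]_(x in D) h i x.
Proof.
move=> mD ih.
have E x : (\sum_(i <- s | P i) h i x)%:E = (\sum_(i <- s | P i) (h i x)%:E)%E.
  by rewrite sumEFin.
split.
  rewrite (_ : _ \o _ = (fun x => \sum_(i <- s | P i) (EFin \o h i) x)%E).
    by apply: integrable_sum.
  by apply/funext => x /=; rewrite E.
rewrite /Rintegral; under eq_integral do rewrite E.
rewrite (@integral_sum _ T R mu D mD I (fun i => EFin \o h i) ih s P).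
by rewrite -sum_fine// => i _; apply: integrable_fin_num => //; exact: ih.
Qed.

End rintegral_complements.

(** A function with values in $[0,K]$ differs by at most one from the number of
    positive integers below it: the unit layers of its graph. *)
Lemma layer_approximation (R : realType) (K : nat) (y : R) : 0 <= y -> y <= K%:R ->
  `|y - \sum_(k < K) (k.+1%:R <= y)%R%:R| <= 1.
Proof.
move=> y0; elim: K => [|K IH] yK.
  have -> : y = 0 by apply/eqP; rewrite eq_le y0 yK.
  by rewrite big_ord0 subr0 normr0 ler01.
rewrite big_ord_recr/=; have [yK'|yK'] := leP y K%:R.
  rewrite (_ : K.+1%:R <= y = false) ?addr0; first exact: IH.
  by apply/negbTE; rewrite -ltNge (le_lt_trans yK')// ltr_nat.
have -> : \sum_(i < K) (i.+1%:R <= y)%R%:R = K%:R :> R.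
  rewrite (eq_bigr (fun=> 1)); first by rewrite sumr_const card_ord.
  by move=> i _; rewrite (le_trans _ (ltW yK'))// ler_nat.
move: yK; rewrite -natr1 => yK.
case: (leP (K%:R + 1) y) => /= h; rewrite ?addr0 ler_norml;
  by apply/andP; split; lra.
Qed.

Section density.
Context d (T : measurableType d) (R : realType).
Variables (mu : {measure set T -> \bar R}) (m : probability T R).
Variables (W : set T) (rho : T -> R).
Hypothesis mW : measurable W.
Hypothesis mrho : measurable_fun W rho.
Hypothesis mE : forall A, measurable A ->
  m A = (\int[mu]_(x in A `&` W) (rho x)%:E)%E.

(** The integrals of the positive and negative parts are, up to sign, the
    probabilities of the sets where the density is nonnegative and negative. *)
Lemma density_integrable : mu.-integrable W (EFin \o rho).
Proof.
pose A := W `&` [set x | 0 <= rho x].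
pose B := W `&` [set x | rho x < 0].
have mA : measurable A.
  rewrite /A (_ : [set x | _] = rho @^-1` `[0, +oo[%classic).
    exact: mrho.
  by apply/seteqP; split => x /=; rewrite in_itv/= andbT.
have mB : measurable B.
  rewrite /B (_ : [set x | _] = rho @^-1` `]-oo, 0[%classic).
    exact: mrho.
  by apply/seteqP; split => x /=; rewrite in_itv/=.
have AW : A `&` W = A by rewrite setIC setIA setIid.
have BW : B `&` W = B by rewrite setIC setIA setIid.
apply/integrableP; split; first exact/measurable_EFinP.
have WE : W = A `|` B.
  apply/seteqP; split => x /=; last by case=> -[].
  by move=> Wx; have [h|h] := leP 0 (rho x); [left|right].
have AB : [disjoint A & B].
  apply/disj_set2P; apply/seteqP; split => x //= [[_ h] [_]] /=.
  by rewrite ltNge h.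
have mabs : measurable_fun (A `|` B) (abse \o (EFin \o rho)).
  rewrite -WE; apply: measurableT_comp; first exact: abse_measurable.
  exact/measurable_EFinP.
rewrite WE ge0_integral_setU//=.
have -> : (\int[mu]_(x in A) `|(rho x)%:E| = m A)%E.
  rewrite mE// AW; apply: eq_integral => x; rewrite inE => -[_ h].
  by rewrite gee0_abs.
have -> : (\int[mu]_(x in B) `|(rho x)%:E| = - m B)%E.
  rewrite mE// BW.
  transitivity (- - (\int[mu]_(x in B) `|(rho x)%:E|))%E; first by rewrite oppeK.
  congr (- _)%E; rewrite -integral_ge0N//.
  by apply: eq_integral => x; rewrite inE => -[_ h]; rewrite lte0_abs// oppeK.
apply: (@le_lt_trans _ _ (1 + 0)%E); last by rewrite adde0 ltry.
by apply: leeD; [exact: probability_le1|rewrite oppe_le0].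
Qed.

Let Rintegral_indic_density A : measurable A ->
  \int[m]_(x in W) \1_A x = \int[mu]_(x in W) (\1_A x * rho x).
Proof.
move=> mA; rewrite /Rintegral integral_indic//.
transitivity (fine (\int[mu]_(x in (A `&` W) `&` W) (rho x)%:E)%E).
  by congr fine; apply: mE; exact: measurableI.
rewrite -setIA setIid; congr fine.
rewrite setIC integral_mkcondr; apply: eq_integral => x _.
by rewrite patchE/= indicE; case: (x \in A); rewrite ?mul1r ?mul0r.
Qed.

Let Rintegral_density_ge0 (g : T -> R) (M : nat) : measurable_fun W g ->
  (forall x, W x -> 0 <= g x <= M%:R) ->
  \int[m]_(x in W) g x = \int[mu]_(x in W) (g x * rho x).
Proof.
move=> mg g0M.
pose A n k := W `&` g @^-1` `[k.+1%:R / n.+1%:R, +oo[%classic.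
have mA n k : measurable (A n k) by exact: mg.
pose g_ n x : R := \sum_(k < M * n.+1) n.+1%:R^-1 * \1_(A n k) x.
have indA n k x : W x -> \1_(A n k) x = (k.+1%:R <= n.+1%:R * g x)%R%:R :> R.
  move=> Wx; rewrite indicE; congr (nat_of_bool _)%:R.
  apply/idP/idP; rewrite inE /A/= in_itv/= andbT ler_pdivrMr// mulrC.
    by case.
  by [].
have g_E n x : W x ->
    g_ n x = n.+1%:R^-1 * \sum_(k < M * n.+1) (k.+1%:R <= n.+1%:R * g x)%R%:R.
  by move=> Wx; rewrite mulr_sumr; apply: eq_bigr => k _; rewrite indA.
have g_g n x : W x -> `|g x - g_ n x| <= n.+1%:R^-1.
  move=> Wx; rewrite g_E//.
  rewrite -[X in X - _](mulKf (_ : n.+1%:R != 0 :> R)) ?pnatr_eq0//.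
  rewrite -mulrBr normrM gtr0_norm ?invr_gt0 ?ltr0n//.
  rewrite ler_piMr// ?invr_ge0//.
  have /andP[g0 gM] := g0M x Wx.
  apply: layer_approximation; first by rewrite mulr_ge0.
  by rewrite natrM mulrC ler_wpM2r.
have g_cvg x : W x -> g_ n x @[n --> \oo] --> g x.
  move=> Wx; apply/cvgrPdist_le => e e0; near=> n.
  rewrite (le_trans (g_g n x Wx))//.
  rewrite -[leRHS]invrK lef_pV2 ?posrE ?invr_gt0 ?ltr0n//.
  rewrite (@le_trans _ _ n%:R) ?ler_nat//.
  by near: n; exact: nbhs_infty_ger.
have g_M n x : W x -> `|g_ n x| <= M.+1%:R.
  move=> Wx; have := g_g n x Wx; have /andP[g0 gM] := g0M x Wx => h.
  rewrite -[g_ n x](subKr (g x)) (le_trans (ler_normB _ _))//.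
  rewrite -natr1 lerD//; first by rewrite ger0_norm.
  by rewrite (le_trans h)// invf_le1 ?ltr0n// ler1n.
have m1 (A0 : set T) : (m A0 <= 1)%E -> (m A0 < +oo)%E.
  by move=> /le_lt_trans; apply; exact: ltry.
have mWoo : (m W < +oo)%E by exact/m1/probability_le1.
have mind n k : measurable_fun W (\1_(A n k) : T -> R).
  exact: measurable_indic.
have mg_ n : measurable_fun W (g_ n).
  by apply: measurable_sum => k; exact: measurable_funM.
have irho := density_integrable.
have [_ _ lim1] := dominated_convergence_real mW mg_ g_cvg
  (finite_cst_integrable M.+1%:R mW mWoo) g_M.
have [|||_ _ lim2] := @dominated_convergence_real _ _ _ mu W
  (fun n x => g_ n x * rho x) (fun x => g x * rho x)
  (fun x => M.+1%:R * `|rho x|) mW (fun n => measurable_funM (mg_ n) mrho).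
- by move=> x Wx; apply: cvgMl; exact: g_cvg.
- by apply: integrableZl_real => //; exact: integrable_normr.
- by move=> n x Wx; rewrite normrM ler_wpM2r// g_M.
suff E : (fun n => \int[m]_(x in W) g_ n x) =
         (fun n => \int[mu]_(x in W) (g_ n x * rho x)).
  by move: lim1; rewrite E => lim1; exact: (cvg_unique _ lim1 lim2).
apply/funext => n.
have i1 (k : 'I_(M * n.+1)) : m.-integrable W (EFin \o (fun x => n.+1%:R^-1 * \1_(A n k) x)).
  apply: (@finite_bounded_integrable _ _ _ _ _ _ 1) => //.
    exact: measurable_funM.
  move=> x _; rewrite normrM gtr0_norm ?invr_gt0 ?ltr0n//.
  rewrite indicE; case: (_ \in _); rewrite ?normr0 ?mulr0// normr1 mulr1.
  by rewrite invf_le1 ?ltr0n// ler1n.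
have i0 k : m.-integrable W (EFin \o (\1_(A n k) : T -> R)).
  apply: (@finite_bounded_integrable _ _ _ _ _ _ 1) => //.
  by move=> x _; rewrite indicE; case: (_ \in _); rewrite ?normr0 ?normr1.
have i2 k : mu.-integrable W (EFin \o (fun x => \1_(A n k) x * rho x)).
  apply: (@integrable_mulr_bounded _ _ _ _ _ _ _ 1) => //.
  by move=> x _; rewrite indicE; case: (_ \in _); rewrite ?normr0 ?normr1.
have i3 (k : 'I_(M * n.+1)) : mu.-integrable W
    (EFin \o (fun x => n.+1%:R^-1 * (\1_(A n k) x * rho x))).
  exact: integrableZl_real.
rewrite (Rintegral_sum _ _ mW i1).2.
under [RHS]eq_Rintegral => x _.
  rewrite mulr_suml; under eq_bigr do rewrite -mulrA.
  over.
rewrite (Rintegral_sum _ _ mW i3).2; apply: eq_bigr => k _.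
by rewrite !RintegralZl// Rintegral_indic_density.
Unshelve. all: by end_near. Qed.

Lemma Rintegral_density (g : T -> R) (M : R) : measurable_fun W g ->
  (forall x, W x -> `|g x| <= M) ->
  \int[m]_(x in W) g x = \int[mu]_(x in W) (g x * rho x).
Proof.
move=> mg gM; pose n := (Num.trunc M).+1.
have gn x : W x -> `|g x| <= n%:R.
  move=> Wx; rewrite (le_trans (gM x Wx))// ltW// /n.
  by have := truncnS_gt M.
have mWoo : (m W < +oo)%E.
  by rewrite (le_lt_trans (probability_le1 _ _))// ltry.
have bnd1 x : W x -> 0 <= g x + n%:R <= (n + n)%:R.
  by move=> Wx; have := gn x Wx; rewrite ler_norml natrD => /andP[]; lra.
have mgn : measurable_fun W (fun x => g x + n%:R) by exact: measurable_funD.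
have E1 := Rintegral_density_ge0 mgn bnd1.
have E2 : \int[m]_(x in W) n%:R = \int[mu]_(x in W) (n%:R * rho x).
  by apply: (@Rintegral_density_ge0 (fun=> n%:R) n) => // x _; rewrite ler0n lexx.
have im : m.-integrable W (EFin \o g).
  exact: (finite_bounded_integrable mW mWoo mg gn).
have ic := finite_cst_integrable n%:R mW mWoo.
have irho := density_integrable.
have i2 := integrable_mulr_bounded mW irho mg gn.
have i3 : mu.-integrable W (EFin \o (fun x => n%:R * rho x)).
  by apply: (@integrable_mulr_bounded _ _ _ _ _ _ (fun=> n%:R) n%:R) => // x _;
    rewrite normr_nat.
have : \int[m]_(x in W) (g x + n%:R) = \int[mu]_(x in W) (g x * rho x + n%:R * rho x).
  by rewrite E1; apply: eq_Rintegral => x _; rewrite mulrDl.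
by rewrite !RintegralD// E2; exact: addIr.
Qed.

End density.

(** * Feller semigroups and the uniqueness of orbits *)

Section kernel_bounds.
Context d (T : measurableType d) (R : realType) (m : probability T R).
Variables (E : set T).
Hypothesis mE : measurable E.
Implicit Types f g : T -> R.

Let mEoo : (m E < +oo)%E.
Proof. by rewrite (le_lt_trans (probability_le1 _ _))// ltry. Qed.

Lemma bounded_integrable f (M : R) : measurable_fun E f ->
  (forall x, E x -> `|f x| <= M) -> m.-integrable E (EFin \o f).
Proof. exact: finite_bounded_integrable. Qed.

Lemma prob_Rintegral_cst (c : R) : m E = 1%E -> \int[m]_(x in E) c = c.
Proof.
move=> mE1; transitivity (c * fine (m E)); first exact: Rintegral_cst.
by rewrite mE1 mulr1.
Qed.

Lemma prob_Rintegral_le f (c : R) : measurable_fun E f -> 0 <= c ->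
  (forall x, E x -> `|f x| <= c) -> `|\int[m]_(x in E) f x| <= c.
Proof.
move=> mf c0 fc; have If := bounded_integrable mf fc.
rewrite (le_trans (le_normr_Rintegral _ If))//.
have := @le_Rintegral _ T R m E (fun x => `|f x|) (fun=> c) mE.
move=> /(_ (integrable_normr mE If) (finite_cst_integrable _ mE mEoo) fc).
move=> /le_trans; apply; rewrite Rintegral_cst//.
rewrite ler_piMr// -lee_fin fineK ?ge0_fin_numE//.
exact: probability_le1.
Qed.

Lemma prob_Rintegral_dist f g (Mf Mg c : R) :
  measurable_fun E f -> (forall x, E x -> `|f x| <= Mf) ->
  measurable_fun E g -> (forall x, E x -> `|g x| <= Mg) -> 0 <= c ->
  (forall x, E x -> `|f x - g x| <= c) ->
  `|\int[m]_(x in E) f x - \int[m]_(x in E) g x| <= c.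
Proof.
move=> mf fM mg gM c0 fg.
rewrite -RintegralB//.
- by apply: prob_Rintegral_le => //; exact: measurable_funB.
- exact: bounded_integrable fM.
- exact: bounded_integrable gM.
Qed.

End kernel_bounds.

Lemma C_infty_bounded (R : realType) (V : topologicalType) (E : set V)
    (f : V -> R) : closed E -> C_infty E f ->
  exists2 M : R, 0 <= M & forall x, E x -> `|f x| <= M.
Proof.
move=> cE [cf /(_ 1 ltr01)[C cC Cf]].
have cCE : compact (C `&` E) by exact: compact_closedI.
have cfC : {within C `&` E, continuous f}.
  by apply: continuous_subspaceW cf; exact: subIsetr.
have /compact_bounded[M [_ HM]] := continuous_compact cfC cCE.
exists (`|M| + 1) => [|x Ex]; first by rewrite addr_ge0.
have [Cx|Cx] := pselect (C x).
  apply: (HM (`|M| + 1)); last by exists x.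
  by rewrite (le_lt_trans (ler_norm M))// ltrDl.
by rewrite (le_trans (ltW (Cf _ Ex Cx)))// lerDr.
Qed.

(** A real function whose increments are $o(|r'-r|)$ on $[0,t]$ is constant
    there: precomposed with the projection on $[0,t]$ it has derivative zero
    everywhere. *)
Lemma flat_is_constant (R : realType) (t : R) (J : R -> R) : 0 <= t ->
  (forall r : R, 0 <= r <= t -> forall e : R, 0 < e -> exists2 d : R, 0 < d &
    forall r' : R, 0 <= r' <= t -> `|r' - r| < d ->
      `|J r' - J r| <= e * `|r' - r|) ->
  J 0 = J t.
Proof.
move=> t0 HJ; pose c (r : R) : R := Num.max 0 (Num.min r t).
have c0t r : 0 <= c r <= t.
  by rewrite /c le_max lexx/= ge_max t0/= ge_min lexx orbT.
have c_lip r s : `|c r - c s| <= `|r - s|.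
  have := ler_norm (r - s); have := ler_norm (s - r); rewrite (distrC s).
  rewrite /c !maxEle !minEle.
  by case: (leP r t) => ?; case: (leP s t) => ?; rewrite ?t0;
    case: (leP 0 r) => ?; case: (leP 0 s) => ? h1 h2; rewrite ler_norml;
    apply/andP; split; lra.
have c00 : c 0 = 0 by rewrite /c maxEle minEle t0 lexx.
have ctt : c t = t by rewrite /c maxEle minEle lexx t0.
suff Jc : forall r : R, is_derive r (1 : R) (J \o c) 0.
  by have := is_derive_0_is_cst 0 t Jc; rewrite /= c00 ctt.
move=> r.
suff H : h^-1 *: ((J \o c) (h + r) - (J \o c) r) @[h --> 0^'] --> (0 : R).
  apply: DeriveDef.
    by apply/cvg_ex; exists 0; under eq_fun do rewrite [_ *: 1]mulr1.
  rewrite /derive; under eq_fun do rewrite [_ *: 1]mulr1.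
  by apply/cvg_lim.
apply/cvgrPdist_le => e e0.
have [d d0 Hd] := HJ (c r) (c0t r) e e0.
near=> h.
have h0 : h != 0 by near: h; exact: nbhs_dnbhs_neq.
rewrite sub0r normrN normrZ normrV ?unitfE// ler_pdivrMl ?normr_gt0// mulrC.
have hd : `|c (h + r) - c r| <= `|h|.
  by rewrite (le_trans (c_lip _ _))// addrK.
apply: le_trans (_ : e * `|c (h + r) - c r| <= _); last by rewrite ler_wpM2l// ltW.
apply: Hd; first exact: c0t.
rewrite (le_lt_trans hd)//; near: h.
by apply: dnbhs0_lt.
Unshelve. all: by end_near. Qed.

Section feller_orbits.
Context (R : realType).
Variables (E : set R) (Q : R -> R -> probability R R).
Hypothesis cE : closed E.
Hypothesis hF : feller_dynkin E (fun t => kernel_op E (Q t)).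
Local Notation T t := (kernel_op E (Q t)).
Implicit Types (f g : R -> R) (t h x y z e d r : R).

Let mE : measurable E. Proof. exact: closed_measurable. Qed.

Lemma C_infty_measurable f : C_infty E f -> measurable_fun E f.
Proof. by move=> -[cf _]; exact: subspace_continuous_measurable_fun. Qed.

Lemma C_infty_integrable f t x : C_infty E f -> (Q t x).-integrable E (EFin \o f).
Proof.
move=> Cf; have [M _ fM] := C_infty_bounded cE Cf.
exact: (bounded_integrable _ mE (C_infty_measurable Cf) fM).
Qed.

Lemma kernel_op_dist f g t x (c : R) : C_infty E f -> C_infty E g -> 0 <= c ->
  (forall y, E y -> `|f y - g y| <= c) -> `|T t f x - T t g x| <= c.
Proof.
move=> Cf Cg c0 fg; have [M _ fM] := C_infty_bounded cE Cf.
have [M' _ gM'] := C_infty_bounded cE Cg.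
exact: (prob_Rintegral_dist _ mE (C_infty_measurable Cf) fM
  (C_infty_measurable Cg) gM').
Qed.

Let uniform_eps (F : R -> R -> R) g : {uniform E, F h @[h --> 0^'+] --> g} ->
  forall e, 0 < e -> exists2 d : R, 0 < d &
    forall h, 0 < h < d -> forall x, E x -> `|F h x - g x| <= e.
Proof.
move=> /= Fg e e0.
have : nbhs (g : {uniform` E -> R}) [set k | forall y, E y -> `|k y - g y| <= e].
  apply/uniform_nbhs; exists [set xy | ball xy.1 e xy.2]; split.
    exact: (entourage_ball _ (PosNum e0)).
  move=> k /= Hk y Ey; have := Hk y Ey; rewrite /ball/= distrC; exact: ltW.
move=> /Fg [d /= d0 Hd]; exists d => // h /andP[h0 hd] x Ex.
apply: (Hd h) => //=.
by rewrite sub0r normrN gtr0_norm.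
Qed.

Lemma feller_continuous_eps f : C_infty E f -> forall e, 0 < e ->
  exists2 d : R, 0 < d & forall h, 0 < h < d -> forall x, E x -> `|T h f x - f x| <= e.
Proof. by move=> Cf; exact: (uniform_eps (feller_continuous hF Cf)). Qed.

Lemma feller_generator_eps f g : feller_generator E (fun t => T t) f g ->
  forall e, 0 < e -> exists2 d : R, 0 < d &
    forall h, 0 < h < d -> forall x, E x -> `|T h f x - f x - h * g x| <= e * h.
Proof.
move=> [_ _ /uniform_eps H] e /H[d d0 Hd]; exists d => // h h0d x Ex.
have /andP[h0 _] := h0d.
have -> : T h f x - f x - h * g x = ((T h f x - f x) / h - g x) * h.
  by field; rewrite gt_eqF.
by rewrite normrM (gtr0_norm h0) ler_wpM2r ?(ltW h0)//; exact: Hd.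
Qed.

Lemma kernel_op_lin f g (a b : R) t x : C_infty E f -> C_infty E g ->
  T t (fun y => a * f y + b * g y) x = a * T t f x + b * T t g x.
Proof.
move=> Cf Cg; rewrite /kernel_op RintegralD//.
- by rewrite !RintegralZl//; exact: C_infty_integrable.
- by apply: integrableZl_real => //; exact: C_infty_integrable.
- by apply: integrableZl_real => //; exact: C_infty_integrable.
Qed.

Lemma kernel_op_remainder f g u t x (a c : R) :
  C_infty E f -> C_infty E g -> C_infty E u -> 0 <= c ->
  (forall y, E y -> `|f y - u y - a * g y| <= c) ->
  `|T t f x - T t u x - a * T t g x| <= c.
Proof.
move=> Cf Cg Cu c0 H.
have [Mf _ fM] := C_infty_bounded cE Cf.
have [Mg _ gM] := C_infty_bounded cE Cg.
have [Mu _ uM] := C_infty_bounded cE Cu.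
rewrite -addrA -opprD.
rewrite -[T t u x]mul1r -kernel_op_lin//.
apply: (prob_Rintegral_dist _ mE (C_infty_measurable Cf) fM
  (Mg := `|1| * Mu + `|a| * Mg)) => //.
- by apply: measurable_funD; apply: measurable_funM => //; exact: C_infty_measurable.
- by move=> y Ey; rewrite (le_trans (ler_normD _ _))// !normrM lerD// ler_wpM2l//;
    [exact: uM|exact: gM].
- by move=> y Ey; rewrite mul1r opprD addrA; exact: H.
Qed.

(** Uniqueness for the Cauchy problem $u'=Lu$: along a solution
    $J(r)=T_{t-r}u_r$ has increments $T_{t-r-h}(u_{r+h}-T_hu_r)=o(h)$, hence is
    constant on $[0,t]$. *)
Lemma feller_orbit_unique (u g : R -> R -> R) t : 0 <= t ->
  (forall r, 0 <= r <= t -> feller_generator E (fun s => T s) (u r) (g r)) ->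
  (forall r, 0 <= r <= t -> forall e, 0 < e -> exists2 d : R, 0 < d &
    forall h, `|h| < d -> 0 <= r + h <= t ->
      forall x, E x -> `|u (r + h) x - u r x - h * g r x| <= e * `|h|) ->
  forall x, E x -> T t (u 0) x = u t x.
Proof.
move=> t0 Gu du x Ex.
have Cu r : 0 <= r <= t -> C_infty E (u r) by move=> /Gu[].
have Cg r : 0 <= r <= t -> C_infty E (g r) by move=> /Gu[].
have tt : 0 <= t <= t by rewrite t0 lexx.
rewrite -(feller_id hF (Cu t tt) Ex) -[in RHS](subrr t) -[in LHS](subr0 t).
pose J r := T (t - r) (u r) x.
apply: (@flat_is_constant _ t J) => // r r0t e e0.
pose e1 := e / 3.
have e10 : 0 < e1 by rewrite divr_gt0.
have [d1 d10 H1] := du r r0t e1 e10.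
have [d2 d20 H2] := feller_generator_eps (Gu r r0t) e10.
have [d3 d30 H3] := feller_continuous_eps (Cg r r0t) e10.
exists (Num.min d1 (Num.min d2 d3)); first by rewrite !lt_min d10 d20.
move=> r' r'0t; rewrite !lt_min => /and3P[hd1 hd2 hd3].
have /andP[r0 rt] := r0t; have /andP[r'0 r't] := r'0t.
have [->|] := eqVneq r' r; first by rewrite !subrr normr0 mulr0.
rewrite neq_lt => /orP[rr'|rr'].
- (* the point r' lies to the left of r *)
  pose h := r - r'.
  have h0 : 0 < h by rewrite subr_gt0.
  have hN : `|r' - r| = h by rewrite distrC gtr0_norm.
  rewrite hN in hd1 hd2 hd3 *.
  rewrite /J (_ : t - r' = (t - r) + h); last by rewrite /h; ring.
  rewrite (feller_semigroup hF (_ : 0 <= t - r) (ltW h0) (Cu r' r'0t) Ex) ?subr_ge0//.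
  have CTh : C_infty E (T h (u r')) by apply: (feller_C_infty hF (ltW h0)); exact: Cu.
  apply: kernel_op_dist => //; first exact: Cu.
    by rewrite mulr_ge0// ltW.
  move=> y Ey.
  have A1 : `|T h (u r) y - u r y - h * g r y| <= e1 * h by apply: H2; rewrite ?h0.
  have A2 : `|T h (g r) y - g r y| <= e1 by apply: H3; rewrite ?h0.
  have A3 : `|T h (u r') y - T h (u r) y - (- h) * T h (g r) y| <= e1 * h.
    apply: kernel_op_remainder => //; try exact: Cu; try exact: Cg.
      by rewrite mulr_ge0// ltW.
    move=> z Ez; rewrite (_ : r' = r + - h); last by rewrite /h; ring.
    have := H1 (- h); rewrite normrN gtr0_norm// => /(_ hd1) H1h.
    by apply: H1h => //; rewrite (_ : r + - h = r') // /h; ring.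
  have A4 : `|h * (T h (g r) y - g r y)| <= e1 * h.
    by rewrite normrM gtr0_norm// mulrC ler_wpM2r// ltW.
  rewrite (_ : T h (u r') y - u r y =
    (T h (u r') y - T h (u r) y - (- h) * T h (g r) y) +
    ((T h (u r) y - u r y - h * g r y) - h * (T h (g r) y - g r y))); last by ring.
  rewrite (_ : e * h = e1 * h + (e1 * h + e1 * h)); last by rewrite /e1; field.
  rewrite (le_trans (ler_normD _ _))// lerD//.
  by rewrite (le_trans (ler_normB _ _))// lerD.
- pose h := r' - r.
  have h0 : 0 < h by rewrite subr_gt0.
  have hN : `|r' - r| = h by rewrite gtr0_norm.
  rewrite hN in hd1 hd2 hd3 *.
  rewrite /J (_ : t - r = (t - r') + h); last by rewrite /h; ring.
  rewrite (feller_semigroup hF (_ : 0 <= t - r') (ltW h0) (Cu r r0t) Ex) ?subr_ge0//.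
  have CTh : C_infty E (T h (u r)) by apply: (feller_C_infty hF (ltW h0)); exact: Cu.
  apply: kernel_op_dist => //; first exact: Cu.
    by rewrite mulr_ge0// ltW.
  move=> y Ey.
  have A1 : `|T h (u r) y - u r y - h * g r y| <= e1 * h by apply: H2; rewrite ?h0.
  have A2 : `|u r' y - u r y - h * g r y| <= e1 * h.
    rewrite (_ : r' = r + h); last by rewrite /h; ring.
    have := H1 h; rewrite gtr0_norm// => /(_ hd1) H1h.
    by apply: H1h => //; rewrite (_ : r + h = r') // /h; ring.
  rewrite (_ : u r' y - T h (u r) y =
    (u r' y - u r y - h * g r y) - (T h (u r) y - u r y - h * g r y)); last by ring.
  rewrite (le_trans (ler_normB _ _))// (le_trans (lerD A2 A1))//.
  by rewrite -mulrDl ler_wpM2r ?(ltW h0)// /e1; lra.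
Qed.

(** Apply $T_t$ to the difference quotients $(T_hf-f)/h$ and use
    $T_tT_hf=T_hT_tf$. *)
Lemma feller_generator_comm f g u v t x : 0 <= t -> E x ->
  feller_generator E (fun s => T s) f g ->
  feller_generator E (fun s => T s) u v ->
  (forall y, E y -> T t f y = u y) -> T t g x = v x.
Proof.
move=> t0 Ex Gf Gu Tfu.
have [Cf Cg _] := Gf; have [Cu Cv _] := Gu.
apply/eqP; rewrite -subr_eq0 -normr_le0; apply/ler_addgt0Pl => e e0; rewrite addr0.
pose e1 := e / 2; have e10 : 0 < e1 by rewrite divr_gt0.
have [d1 d10 H1] := feller_generator_eps Gf e10.
have [d2 d20 H2] := feller_generator_eps Gu e10.
pose h := Num.min d1 d2 / 2.
have m0 : 0 < Num.min d1 d2 by rewrite lt_min d10.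
have h0 : 0 < h by rewrite divr_gt0.
have hm : h < Num.min d1 d2 by rewrite /h; lra.
have /andP[hd1 hd2] : (h < d1) && (h < d2) by rewrite -lt_min.
have A1 : `|T t (T h f) x - T t f x - h * T t g x| <= e1 * h.
  apply: kernel_op_remainder => //.
  - by apply: (feller_C_infty hF (ltW h0)).
  - by rewrite mulr_ge0// ltW.
  - by move=> y Ey; apply: H1; rewrite ?h0.
have A2 : `|T h u x - u x - h * v x| <= e1 * h by apply: H2; rewrite ?h0.
have E1 : T t (T h f) x = T h u x.
  rewrite -(feller_semigroup hF t0 (ltW h0) Cf Ex) addrC.
  rewrite (feller_semigroup hF (ltW h0) t0 Cf Ex) /kernel_op.
  by apply: eq_Rintegral => y; rewrite inE => Ey; exact: Tfu.
rewrite E1 Tfu// in A1.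
rewrite -(ler_pM2r h0) -[h in leLHS]gtr0_norm// -normrM.
rewrite (_ : _ * h = (T h u x - u x - h * v x) - (T h u x - u x - h * T t g x));
  last by ring.
rewrite (le_trans (ler_normB _ _))// (le_trans (lerD A2 A1))//.
by rewrite -mulrDl ler_wpM2r ?(ltW h0)// /e1; lra.
Qed.

End feller_orbits.

(** * The Laguerre semigroup on exponentials *)

Section exponentials.
Context (R : realType).
Implicit Types (s x y c h e d r : R).
Local Notation E := (`[0, +oo[%classic : set R).

Definition decay s y : R := expR (- (s * y)).

Lemma decay_gt0 s y : 0 < decay s y. Proof. exact: expR_gt0. Qed.

Lemma decay_ge0 s y : 0 <= decay s y. Proof. exact/ltW/decay_gt0. Qed.

Lemma decay_le1 s y : 0 <= s -> 0 <= y -> decay s y <= 1.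
Proof. by move=> s0 y0; rewrite -expR0 ler_expR oppr_le0 mulr_ge0. Qed.

Lemma decayD s r y : decay (s + r) y = decay s y * decay r y.
Proof. by rewrite /decay mulrDl opprD expRD. Qed.

Lemma decay0 s : decay s 0 = 1. Proof. by rewrite /decay mulr0 oppr0 expR0. Qed.

Lemma is_derive_decay s y : is_derive y 1 (decay s) (- s * decay s y).
Proof.
have -> : decay s = expR \o (fun x => - s * x).
  by apply/funext => x; rewrite /decay /= mulNr.
by apply: is_derive_eq; rewrite /GRing.scale/= mulr1 mulrC.
Qed.

Lemma continuous_decay s : continuous (decay s).
Proof.
move=> y; apply/differentiable_continuous/derivable1_diffP.
by have [] := is_derive_decay s y.
Qed.

(** From $sy/2\le e^{sy/2}$. *)
Lemma mul_decay_le s y : 0 < s -> 0 <= y -> y * decay s y <= 2 / s * decay (s / 2) y.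
Proof.
move=> s0 y0; rewrite [in leLHS](_ : s = s / 2 + s / 2); last by field.
rewrite decayD mulrA ler_wpM2r ?decay_ge0// /decay expRN.
rewrite ler_pdivrMr ?expR_gt0//.
have := expR_ge1Dx (s / 2 * y) => h.
rewrite -ler_pdivrMl ?divr_gt0// invf_div.
by apply: le_trans h; rewrite lerDr ler01.
Qed.

Lemma mul_decay_bound s y : 0 < s -> 0 <= y -> y * decay s y <= 2 / s.
Proof.
move=> s0 y0; rewrite (le_trans (mul_decay_le s0 y0))//.
by rewrite ler_piMr ?decay_le1// divr_ge0// (ltW s0).
Qed.

Lemma sqr_decay_bound s y : 0 < s -> 0 <= y -> y ^+ 2 * decay s y <= 8 / s ^+ 2.
Proof.
move=> s0 y0; have s20 : 0 < s / 2 by rewrite divr_gt0.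
rewrite expr2 -mulrA (le_trans (ler_wpM2l y0 (mul_decay_le s0 y0)))//.
rewrite mulrCA (le_trans (ler_wpM2l _ (mul_decay_bound s20 y0))) ?divr_ge0 ?(ltW s0)//.
by rewrite le_eqVlt; apply/orP; left; apply/eqP; field; rewrite gt_eqF.
Qed.

Lemma expR_second_order x : `|expR x - 1 - x| <= x ^+ 2 * expR `|x|.
Proof.
have h1 := expR_ge1Dx x; have h2 := expR_ge1Dx (- x).
have e0 := expR_gt0 x.
have h3 : expR x - 1 <= x * expR x.
  have := ler_wpM2r (ltW e0) h2; rewrite -expRD addNr expR0; lra.
rewrite ger0_norm; last by lra.
have [x0|x0] := leP 0 x.
  rewrite ger0_norm//; have h4 : expR x - 1 - x <= x * (expR x - 1) by lra.
  rewrite (le_trans h4)// expr2 -mulrA ler_wpM2l//.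
rewrite ltr0_norm//.
have h4 : expR x - 1 - x <= x * (expR x - 1) by lra.
have h5 : x * (expR x - 1) <= x ^+ 2 by rewrite expr2 ler_nM2l//; lra.
rewrite (le_trans h4)// (le_trans h5)// ler_peMr ?sqr_ge0//.
lra.
Qed.

(** Half of the exponential absorbs the factor $y^2$ of the remainder, which
    makes the expansion uniform in $y\ge0$. *)
Lemma decay_taylor s h y : 0 < s -> `|h| <= s / 2 -> 0 <= y ->
  `|decay (s + h) y - decay s y + h * (y * decay s y)| <= 32 / s ^+ 2 * h ^+ 2.
Proof.
move=> s0 hs y0; have s20 : 0 < s / 2 by rewrite divr_gt0.
have -> : decay (s + h) y - decay s y + h * (y * decay s y) =
    (expR (- (h * y)) - 1 - (- (h * y))) * decay s y.
  by rewrite decayD {2}/decay; ring.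
rewrite normrM [X in _ * X]gtr0_norm ?decay_gt0//.
rewrite (le_trans (ler_wpM2r (ltW (decay_gt0 _ _)) (expR_second_order _)))//.
rewrite normrN normrM (ger0_norm y0) sqrrN exprMn.
have h1 : expR (`|h| * y) * decay s y <= decay (s / 2) y.
  by rewrite /decay -expRD ler_expR; nra.
have h2 : 0 <= h ^+ 2 * y ^+ 2 by rewrite mulr_ge0 ?sqr_ge0.
apply: (le_trans (_ : _ <= h ^+ 2 * y ^+ 2 * decay (s / 2) y)).
  by rewrite -[leLHS]mulrA ler_wpM2l.
rewrite -mulrA [leRHS]mulrC ler_wpM2l ?sqr_ge0//.
rewrite (le_trans (sqr_decay_bound s20 y0))//.
by rewrite le_eqVlt; apply/orP; left; apply/eqP; field; rewrite gt_eqF.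
Qed.

Lemma C_infty_decay_bound (f : R -> R) s c : continuous f -> 0 < s ->
  (forall y, 0 <= y -> `|f y| <= c * decay s y) -> C_infty E f.
Proof.
move=> cf s0 fc; split; first exact: continuous_subspaceT.
move=> e e0; have c0 : 0 <= c.
  by have := fc 0 (lexx 0); rewrite decay0 mulr1; apply: le_trans.
pose M := (c / e) / s.
have M0 : 0 <= M by rewrite !divr_ge0 ?(ltW e0) ?(ltW s0).
exists `[0, M]%classic; first exact: segment_compact.
move=> y; rewrite /= !in_itv/= andbT => y0 /negP; rewrite y0/= -ltNge => My.
rewrite (le_lt_trans (fc y y0))// /decay expRN.
rewrite ltr_pdivrMr ?expR_gt0// mulrC -ltr_pdivrMr//.
have h := expR_ge1Dx (s * y); apply: lt_le_trans h.
have : c / e < s * y by move: My; rewrite /M ltr_pdivrMr// [y * s]mulrC.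
lra.
Qed.

Lemma C_infty_affine_decay s (a b : R) : 0 < s ->
  C_infty E (fun y => (a * y + b) * decay s y).
Proof.
move=> s0; have s20 : 0 < s / 2 by rewrite divr_gt0.
apply: (@C_infty_decay_bound _ (s / 2) (`|a| * (2 / s) + `|b|)) => //.
  move=> y; apply: cvgM; last exact: continuous_decay.
  by apply: cvgD; [apply: cvgM; [exact: cvg_cst|exact: cvg_id]|exact: cvg_cst].
move=> y y0; rewrite mulrDl (le_trans (ler_normD _ _))// mulrDl lerD//.
  rewrite -mulrA normrM -mulrA ler_wpM2l// normrM ger0_norm//.
  by rewrite gtr0_norm ?decay_gt0// mul_decay_le.
rewrite normrM ler_wpM2l// gtr0_norm ?decay_gt0// /decay ler_expR lerN2.
by rewrite ler_wpM2r// ler_pdivrMr// ler_peMr ?(ltW s0)// ler1n.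
Qed.

Lemma C_infty_decay s : 0 < s -> C_infty E (decay s).
Proof.
move=> s0; rewrite (_ : decay s = fun y => (0 * y + 1) * decay s y).
  exact: C_infty_affine_decay.
by apply/funext => y; rewrite mul0r add0r mul1r.
Qed.

Section generator.
Variable alpha : R.
Hypothesis alpha_gt : -1 < alpha.

Lemma laguerre_generator_decay s (a : R) : 0 < s ->
  laguerre_generator alpha (fun y => a * decay s y)
    (fun y => a * (((s ^+ 2 + s) * y - s * (1 + alpha)) * decay s y)).
Proof.
move=> s0.
have d1 (b : R) y : is_derive y 1 (fun y => b * decay s y) (b * - s * decay s y).
  by have := is_deriveZ b (is_derive_decay s y); rewrite /GRing.scale/= mulrA.
have D1 (b : R) : (fun y => b * decay s y)^`()%classic = (fun y => b * - s * decay s y).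
  by apply/funext => y; rewrite derive1E; apply: derive_val.
split.
- rewrite (_ : (fun y => a * decay s y) = (fun y => (0 * y + a) * decay s y)).
    exact: C_infty_affine_decay.
  by apply/funext => y; rewrite mul0r add0r.
- rewrite (_ : (fun y => _) =
    (fun y => (a * (s ^+ 2 + s) * y + - (a * s * (1 + alpha))) * decay s y)).
    exact: C_infty_affine_decay.
  by apply/funext => y; ring.
- move=> y _; split; first by have [] := d1 a y.
  by rewrite D1; have [] := d1 (a * - s) y.
- move=> y _; rewrite /laguerre_op /derive1n/= !D1; ring.
- rewrite D1.
  have h1 : y `^ (alpha + 1) @[y --> 0^'+] --> (0 : R).
    by apply: powR_cvg0; rewrite -ltrBlDr sub0r.
  have ce : expR (- y) * (a * - s * decay s y) @[y --> 0^'+] -->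
      expR (- 0) * (a * - s * decay s 0).
    apply: (@cvg_at_right_filter _ _ (fun y => expR (- y) * (a * - s * decay s y))).
    apply: cvgM.
      apply: continuous_comp; [exact: opp_continuous|exact: continuous_expR].
    by apply: cvgM; [exact: cvg_cst|exact: continuous_decay].
  have /(_ _)/= := cvgM h1 ce; rewrite mul0r => h.
  rewrite (_ : (fun x => _) = ((fun y => y `^ (alpha + 1)) \*
    (fun y => expR (- y) * (a * - s * decay s y)))%R); first exact: h.
  by apply/funext => y; exact/esym/mulrA.
Qed.

End generator.
End exponentials.

Section laguerre_exponentials.
Context (R : realType).
Implicit Types (s x y c h e d r t : R).
Local Notation E := (`[0, +oo[%classic : set R).

Let is_derive_cvgr (f : R -> R) r f' : is_derive r 1 f f' ->
  (f (r + h) - f r) / h @[h --> 0^'] --> f'.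
Proof.
move=> df; have := @derive_val _ _ _ _ _ _ _ df.
have cvf := @ex_derive _ _ _ _ _ _ _ df; rewrite /derive => limf.
rewrite (_ : (fun h => (f (r + h) - f r) / h) =
  (fun h => h^-1 *: ((f \o shift r) (h *: 1) - f r))).
  by rewrite -limf; exact: cvf.
by apply/funext => h /=; rewrite [h *: 1]mulr1 [h + r]addrC [RHS]mulrC.
Qed.

Let cvg_increment (f : R -> R) r f' : is_derive r 1 f f' ->
  f (r + h) @[h --> 0^'] --> f r.
Proof.
move=> df; have cf : {for r, continuous f}.
  by apply/differentiable_continuous/derivable1_diffP; have [] := df.
suff : f (r + h) @[h --> 0] --> f r.
  by apply: cvg_trans; apply: cvg_app; exact: nbhs_dnbhs.
have : (r + h) @[h --> 0] --> r + 0.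
  by apply: cvgD; [exact: cvg_cst|exact: cvg_id].
by rewrite addr0 => h; exact: (continuous_cvg _ cf h).
Qed.

(** The curve $r\mapsto a(r)e^{-\rho(r)y}$ is differentiable for the uniform
    norm on $[0,\infty)$, not just pointwise in $y$. *)
Lemma decay_curve_derivative (a rho : R -> R) r (a' rho' : R) :
  is_derive r 1 a a' -> is_derive r 1 rho rho' -> 0 < rho r ->
  forall e, 0 < e -> exists2 d : R, 0 < d & forall h, `|h| < d ->
    forall y, 0 <= y ->
    `|a (r + h) * decay (rho (r + h)) y - a r * decay (rho r) y
      - h * ((a' - a r * rho' * y) * decay (rho r) y)| <= e * `|h|.
Proof.
move=> da drho rho0 e e0.
pose k h := rho (r + h) - rho r.
pose C := 32 / rho r ^+ 2.
have Ca := cvg_increment da.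
have Cq := is_derive_cvgr da.
have Ck : k h @[h --> 0^'] --> 0.
  have : k h @[h --> 0^'] --> rho r - rho r.
    by apply: cvgB; [exact: (cvg_increment drho)|exact: cvg_cst].
  by rewrite subrr.
have Ckq := is_derive_cvgr drho.
pose G h := `|a (r + h)| * C * `|k h / h| * `|k h| + `|(a (r + h) - a r) / h - a'|
  + `|a (r + h) * (k h / h) - a r * rho'| * (2 / rho r).
have CG : G h @[h --> 0^'] --> 0.
  suff : G h @[h --> 0^'] --> `|a r| * C * `|rho'| * `|0 : R| + `|a' - a'| +
      `|a r * rho' - a r * rho'| * (2 / rho r).
    by rewrite !subrr !normr0 mulr0 mul0r !addr0.
  rewrite /G; apply: cvgD; first apply: cvgD.
  - apply: cvgM; last exact: cvg_norm.
    apply: cvgM; last exact: cvg_norm.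
    by apply: cvgM; [exact: cvg_norm|exact: cvg_cst].
  - by apply: cvg_norm; apply: cvgB; [exact: Cq|exact: cvg_cst].
  - apply: cvgM; last exact: cvg_cst.
    apply: cvg_norm; apply: cvgB; last exact: cvg_cst.
    by apply: cvgM.
have /cvgrPdist_le/(_ e e0) := CG.
have rho20 : 0 < rho r / 2 by rewrite divr_gt0.
have /cvgrPdist_le/(_ _ rho20) := Ck.
move=> H1 H2; have [d /= d0 Hd] : \forall h \near 0^',
    `|0 - k h| <= rho r / 2 /\ `|0 - G h| <= e.
  by near=> h; split; near: h.
exists d => // h hd y y0.
have [->|h0] := eqVneq h 0.
  by rewrite addr0 subrr mul0r subr0 normr0 mulr0.
have [] := Hd h _ h0; first by rewrite /= sub0r normrN.
rewrite !sub0r !normrN => kh Gh.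
have hpos : 0 < `|h| by rewrite normr_gt0.
have rhoE : rho (r + h) = rho r + k h by rewrite /k; ring.
have T := decay_taylor rho0 kh y0.
rewrite -/C in T.
have -> : a (r + h) * decay (rho (r + h)) y - a r * decay (rho r) y
      - h * ((a' - a r * rho' * y) * decay (rho r) y) =
  a (r + h) * (decay (rho r + k h) y - decay (rho r) y + k h * (y * decay (rho r) y))
  + (a (r + h) - a r - h * a') * decay (rho r) y
  - (a (r + h) * k h - h * (a r * rho')) * (y * decay (rho r) y).
  by rewrite rhoE; ring.
apply: (@le_trans _ _ (G h * `|h|)); last first.
  rewrite ler_wpM2r//; apply: le_trans Gh; exact: ler_norm.
have -> : G h * `|h| = `|a (r + h)| * (C * k h ^+ 2) + `|a (r + h) - a r - h * a'|
    + `|a (r + h) * k h - h * (a r * rho')| * (2 / rho r).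
  have -> : a (r + h) - a r - h * a' = ((a (r + h) - a r) / h - a') * h.
    by field.
  have -> : a (r + h) * k h - h * (a r * rho') =
     (a (r + h) * (k h / h) - a r * rho') * h by field.
  have -> : C * k h ^+ 2 = C * (`|k h / h| * `|k h| * `|h|).
    rewrite -!normrM; congr (C * _); rewrite (_ : _ * h = k h ^+ 2); last by field.
    by rewrite ger0_norm// sqr_ge0.
  by rewrite /G !(normrM _ h); ring.
rewrite (le_trans (ler_normB _ _))// lerD//; last first.
  rewrite normrM ler_wpM2l// ger0_norm; last by rewrite mulr_ge0// decay_ge0.
  exact: mul_decay_bound.
rewrite (le_trans (ler_normD _ _))// lerD//.
  by rewrite normrM ler_wpM2l.
rewrite normrM ler_piMr// ger0_norm ?decay_ge0// decay_le1// ltW.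
Unshelve. all: by end_near. Qed.

Variables (alpha : R) (Q : R -> R -> probability R R).
Hypothesis alpha_gt : -1 < alpha.
Hypothesis hQ : laguerre_diffusion alpha Q.

Definition flow_rate s t := s * expR (- t) / (1 + s * (1 - expR (- t))).

Definition flow_mass s t := (1 + s * (1 - expR (- t))) `^ (- (alpha + 1)).

Let denom_gt0 s t : 0 < s -> 0 <= t -> 0 < 1 + s * (1 - expR (- t)).
Proof.
move=> s0 t0; rewrite ltr_pwDl// mulr_ge0 ?(ltW s0)// subr_ge0.
by rewrite -expR0 ler_expR oppr_le0.
Qed.

Lemma flow_rate_gt0 s t : 0 < s -> 0 <= t -> 0 < flow_rate s t.
Proof. by move=> s0 t0; rewrite divr_gt0 ?denom_gt0// mulr_gt0// expR_gt0. Qed.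

Let closedE : closed E. Proof. exact: interval_closed. Qed.

Let is_derive_denom s t :
  is_derive t 1 (fun t => 1 + s * (1 - expR (- t))) (s * expR (- t)).
Proof.
apply: is_derive_eq; rewrite /GRing.scale/= !(mulr0, add0r, addr0, mul0r).
by ring.
Qed.

Let is_derive_rate s t : 0 < s -> 0 <= t ->
  is_derive t 1 (flow_rate s) (- (flow_rate s t ^+ 2 + flow_rate s t)).
Proof.
move=> s0 t0; have D0 := denom_gt0 s0 t0.
have dn : is_derive t 1 (fun t => s * expR (- t)) (- (s * expR (- t))).
  apply: is_derive_eq; by rewrite /GRing.scale/=; ring.
have dV := @is_deriveV _ (fun t => 1 + s * (1 - expR (- t))) _ _ _
  (lt0r_neq0 D0) (is_derive_denom s t).
apply: (is_derive_eq (is_deriveM dn dV)); rewrite /GRing.scale/= /flow_rate.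
by field; rewrite lt0r_neq0.
Qed.

Let is_derive_mass s t : 0 < s -> 0 <= t ->
  is_derive t 1 (flow_mass s) (- (alpha + 1) * flow_rate s t * flow_mass s t).
Proof.
move=> s0 t0; have D0 := denom_gt0 s0 t0.
have dp := @is_derive1_comp _ (@powR R ^~ (- (alpha + 1)))
  (fun t => 1 + s * (1 - expR (- t))) _ _ _ (is_derive1_powR (- (alpha + 1)) D0) (is_derive_denom s t).
apply: (is_derive_eq dp) => /=; rewrite /flow_mass /flow_rate powRB; last first.
  by rewrite (lt0r_neq0 D0) implybT.
by rewrite powRr1 ?(ltW D0)//; field; rewrite lt0r_neq0.
Qed.

(** The exponentials form an invariant family: $L$ acts on $ae^{-\rho y}$ by
    moving $a$ and $\rho$ along the flow $\rho'=-\rho^2-\rho$,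
    $a'=-(\alpha+1)\rho a$, whose solution is explicit. *)
Lemma laguerre_decay s t x : 0 < s -> 0 <= t -> 0 <= x ->
  kernel_op E (Q t) (decay s) x = flow_mass s t * decay (flow_rate s t) x.
Proof.
move=> s0 t0 x0.
pose u r y := flow_mass s r * decay (flow_rate s r) y.
have E0 : decay s = u 0.
  apply/funext => y; rewrite /u /flow_mass /flow_rate oppr0 expR0 subrr.
  by rewrite mulr0 addr0 mulr1 divr1 powR1 mul1r.
rewrite E0.
pose g r y := flow_mass s r * (((flow_rate s r ^+ 2 + flow_rate s r) * y
   - flow_rate s r * (1 + alpha)) * decay (flow_rate s r) y).
apply: (@feller_orbit_unique _ _ _ closedE (laguerre_feller hQ) u g) => //.
- move=> r /andP[r0 _]; apply/(laguerre_generatorE hQ).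
  by apply: laguerre_generator_decay => //; exact: flow_rate_gt0.
- move=> r /andP[r0 _] e e0.
  have [d d0 Hd] := decay_curve_derivative (is_derive_mass s0 r0)
    (is_derive_rate s0 r0) (flow_rate_gt0 s0 r0) e0.
  exists d => // h hd _ y; rewrite /= in_itv/= andbT => y0.
  have := Hd h hd y y0; congr (`|_ - h * _| <= _).
  by rewrite /g; ring.
- by rewrite /= in_itv/= andbT.
Qed.

(** The image of $e^{-sy}$ under $B=y\partial^2+(\alpha+1)\partial$. *)
Definition bessel_decay s y := (s ^+ 2 * y - (1 + alpha) * s) * decay s y.

Lemma C_infty_bessel_decay s : 0 < s -> C_infty E (bessel_decay s).
Proof. exact: C_infty_affine_decay. Qed.

(** On exponentials $B=\frac{s}{s+1}(L-\alpha-1)$, so that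
    $Q_tBe_s$ follows from $Q_tLe_s=LQ_te_s$. *)
Lemma laguerre_bessel_decay s t x : 0 < s -> 0 <= t -> 0 <= x ->
  kernel_op E (Q t) (bessel_decay s) x =
  expR t * flow_mass s t * bessel_decay (flow_rate s t) x.
Proof.
move=> s0 t0 x0; have Ex : E x by rewrite /= in_itv/= andbT.
have r0 := flow_rate_gt0 s0 t0.
pose l r y := ((r ^+ 2 + r) * y - r * (1 + alpha)) * decay r y.
have Gs := laguerre_generator_decay alpha_gt 1 s0.
have Gr := laguerre_generator_decay alpha_gt (flow_mass s t) r0.
have := feller_generator_comm closedE (laguerre_feller hQ) t0 Ex
  ((laguerre_generatorE hQ _ _).2 Gs) ((laguerre_generatorE hQ _ _).2 Gr).
have -> : (fun y => 1 * decay s y) = decay s by apply/funext => y; rewrite mul1r.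
have -> : (fun y => 1 * (((s ^+ 2 + s) * y - s * (1 + alpha)) * decay s y)) = l s.
  by apply/funext => y; rewrite mul1r.
have Hd y : E y -> kernel_op E (Q t) (decay s) y = flow_mass s t * decay (flow_rate s t) y.
  by rewrite /= in_itv/= andbT; exact: laguerre_decay.
move=> /(_ Hd) Tl.
have -> : bessel_decay s = (fun y => s / (s + 1) * l s y +
    (- (s / (s + 1) * (1 + alpha))) * decay s y).
  by apply/funext => y; rewrite /bessel_decay /l; field; rewrite lt0r_neq0// addr_gt0.
have Cl : C_infty E (l s).
  have [_ + _ _ _] := Gs; congr (C_infty _ _).
  by apply/funext => y; rewrite mul1r.
rewrite (kernel_op_lin _ closedE _ _ _ _ Cl (C_infty_decay s0)) Tl Hd//.
have D0 := denom_gt0 s0 t0.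
have ee : expR t = (expR (- t))^-1 by rewrite expRN invrK.
have e0 : 0 < expR (- t) by apply: expR_gt0.
rewrite ee /bessel_decay /flow_rate; field.
by rewrite !lt0r_neq0// addr_gt0.
Qed.

End laguerre_exponentials.

(** * The averaging kernel *)

Section improper_FTC.
Context (R : realType).
Local Notation mu := (@lebesgue_measure R).
Implicit Types (x y z c : R) (g G : R -> R).

Let inv_pos z n : 0 < z -> 0 < z / n.+2%:R < z.
Proof.
by move=> z0; rewrite divr_gt0//= ltr_pdivrMr// ltr_pMr// ltr1n.
Qed.

Let itvoc_cover z : 0 < z ->
  `]0, z]%classic = \bigcup_n `[z / n.+2%:R, z]%classic.
Proof.
move=> z0; apply/seteqP; split => [y|y [n _]]; rewrite /= !in_itv/= => /andP[y0 yz].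
  exists (Num.trunc (z / y)) => //=; rewrite in_itv/= yz andbT.
  rewrite ler_pdivrMr// mulrC -ler_pdivrMr//.
  by rewrite ltW// (lt_trans (truncnS_gt _))// ltr_nat.
rewrite yz andbT (lt_le_trans _ y0)//; by have /andP[] := inv_pos n z0.
Qed.

Let cvg_inv_pos z : z / n.+2%:R @[n --> \oo] --> (0 : R).
Proof.
have h : n.+2%:R^-1 @[n --> \oo] --> (0 : R).
  by have := @cvg_harmonic R; rewrite -cvg_shiftS.
rewrite -(mulr0 z); apply: cvgM => //; exact: cvg_cst.
Qed.

Let FTC_away g G z n : 0 < z ->
  (forall y, 0 < y -> {for y, continuous g}) ->
  (forall y, 0 < y -> is_derive y 1 G (g y)) ->
  (\int[mu]_(y in `[(z / n.+2%:R)%R, z]) (g y)%:E = (G z - G (z / n.+2%:R))%R%:E)%E.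
Proof.
move=> z0 cg dG; have /andP[n0 nz] := inv_pos n z0.
have cG y : 0 < y -> {for y, continuous G}.
  by move=> y0; apply/differentiable_continuous/derivable1_diffP;
    have [] := dG y y0.
rewrite (@continuous_FTC2 _ g G) ?EFinB//.
- apply: continuous_in_subspaceT => y; rewrite inE/= in_itv/= => /andP[ny _].
  by apply: cg; exact: lt_le_trans ny.
- split.
  + move=> y; rewrite in_itv/= => /andP[ny _].
    by have [] := dG y (lt_trans n0 ny).
  + by apply: cvg_at_right_filter; exact: cG.
  + by apply: cvg_at_left_filter; exact: cG.
- move=> y; rewrite in_itv/= => /andP[ny _].
  by rewrite derive1E; apply: (@derive_val _ _ _ _ _ _ _ (dG y (lt_trans n0 ny))).
Qed.

Let cvg_endpoint G z : 0 < z -> G y @[y --> 0^'+] --> G 0 ->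
  G z - G (z / n.+2%:R) @[n --> \oo] --> G z - G 0.
Proof.
move=> z0 G0; apply: cvgB; first exact: cvg_cst.
have /cvg_at_rightP := G0; apply; split; last exact: cvg_inv_pos.
by move=> n; have /andP[] := inv_pos n z0.
Qed.

Let mitv z : measurable (`]0, z] : set R). Proof. exact: measurable_itv. Qed.

Let cont_measurable g z : (forall y, 0 < y -> {for y, continuous g}) ->
  measurable_fun `]0, z] g.
Proof.
move=> cg; apply: subspace_continuous_measurable_fun => //.
apply: continuous_in_subspaceT => y; rewrite inE/= in_itv/= => /andP[y0 _].
exact: cg.
Qed.

(** The derivative may blow up at the origin, so $(0,z]$ is exhausted by the
    intervals $[z/(n+2),z]$. *)
Lemma improper_FTC_ge0 g G z : 0 < z ->
  (forall y, 0 < y -> {for y, continuous g}) ->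
  (forall y, 0 < y -> 0 <= g y) ->
  (forall y, 0 < y -> is_derive y 1 G (g y)) ->
  G y @[y --> 0^'+] --> G 0 ->
  (\int[mu]_(y in `]0%R, z]) (g y)%:E = (G z - G 0)%R%:E)%E.
Proof.
move=> z0 cg g0 dG G0; rewrite itvoc_cover//.
have h : (\int[mu]_(y in `[(z / n.+2%:R)%R, z]) (g y)%:E @[n --> \oo] -->
  \int[mu]_(y in \bigcup_n `[(z / n.+2%:R)%R, z]%classic) (g y)%:E)%E.
  apply: (@ge0_nondecreasing_set_cvg_integral _ (measurableTypeR R) R
    (fun n => `[(z / n.+2%:R)%R, z]%classic) (fun y => (g y)%:E) mu).
  - apply/nondecreasing_seqP => n; apply/subsetPset => y.
    rewrite /= !in_itv/= => /andP[ny ->]; rewrite andbT (le_trans _ ny)//.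
    by rewrite ler_pM2l// lef_pV2 ?posrE// ler_nat.
  - by move=> n; exact: measurable_itv.
  - move=> n; apply/measurable_EFinP; apply: measurable_funS (cont_measurable (z := z) cg) => //.
    by rewrite itvoc_cover// => y Ay; exists n.
  - move=> n y; rewrite /= in_itv/= => /andP[y0 _].
    rewrite lee_fin g0//; apply: lt_le_trans y0.
    by have /andP[] := inv_pos n z0.
have h2 : (\int[mu]_(y in `[(z / n.+2%:R)%R, z]) (g y)%:E @[n --> \oo] -->
  (G z - G 0)%R%:E)%E.
  under eq_fun do rewrite (FTC_away _ z0 cg dG).
  by apply: cvg_EFin; [exact: nearW|exact: cvg_endpoint].
exact: (cvg_unique _ h h2).
Qed.

Lemma improper_FTC_dominated g G h z : 0 < z ->
  (forall y, 0 < y -> {for y, continuous g}) ->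
  (forall y, 0 < y -> is_derive y 1 G (g y)) ->
  G y @[y --> 0^'+] --> G 0 ->
  mu.-integrable `]0, z] (EFin \o h) ->
  (forall y, 0 < y <= z -> `|g y| <= h y) ->
  \int[mu]_(y in `]0, z]) g y = G z - G 0.
Proof.
move=> z0 cg dG G0 ih gh.
pose A n := `[(z / n.+2%:R)%R, z]%classic : set R.
have mg := cont_measurable cg.
have A_sub n y : A n y -> 0 < y <= z.
  rewrite /A/= in_itv/= => /andP[ny ->]; rewrite andbT (lt_le_trans _ ny)//.
  by have /andP[] := inv_pos n z0.
have [|||_ _ lim1] := @dominated_convergence_real _ _ _ mu `]0, z]%classic
  (fun n y => \1_(A n) y * g y) g h (mitv z) _ _ ih.
- move=> n; apply: measurable_funM; last exact: mg.
  by apply: measurable_indic; exact: measurable_itv.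
- move=> y; rewrite {1}itvoc_cover// => -[n _ Any].
  apply: cvg_near_cst; near=> m.
  rewrite indicE mem_set ?mul1r//.
  move: Any; rewrite /A/= !in_itv/= => /andP[ny ->]; rewrite andbT.
  rewrite (le_trans _ ny)// ler_pM2l// lef_pV2 ?posrE// ler_nat !ltnS.
  by near: m; exact: nbhs_infty_ge.
- move=> n y; rewrite /= in_itv/= => yz.
  rewrite normrM indicE; case: (_ \in _); rewrite ?normr1 ?mul1r ?gh//.
  by rewrite normr0 mul0r (le_trans _ (gh y yz)).
suff E n : \int[mu]_(y in `]0, z]) (\1_(A n) y * g y) = G z - G (z / n.+2%:R).
  move: lim1; under eq_fun do rewrite E; move=> lim1.
  exact: (cvg_unique _ lim1 (cvg_endpoint z0 G0)).
rewrite -[RHS]/(fine (G z - G (z / n.+2%:R))%:E) -(FTC_away n z0 cg dG).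
rewrite /Rintegral; congr fine.
have -> : `[(z / n.+2%:R)%R, z]%classic = `]0, z]%classic `&` A n.
  rewrite setIidr// => y /A_sub; by rewrite /= in_itv.
rewrite integral_mkcondr; apply: eq_integral => y _.
by rewrite patchE indicE; case: (y \in A n); rewrite ?mul1r ?mul0r.
Unshelve. all: by end_near. Qed.

End improper_FTC.

Lemma integrable_fubini_G d1 d2 (T1 : measurableType d1) (T2 : measurableType d2)
    (R : realType) (m1 : {sigma_finite_measure set T1 -> \bar R})
    (m2 : {sigma_finite_measure set T2 -> \bar R}) (f : T1 * T2 -> \bar R) :
  (m1 \x m2)%E.-integrable setT f -> m2.-integrable setT (fubini_G m1 f).
Proof.
move=> If; have mf := measurable_int _ If.
apply/integrableP; split; first exact: (measurable_fubini_G If).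
apply: le_lt_trans ((integrable21ltyP m1 m2 mf).1 If).
apply: ge0_le_integral => //.
- apply: measurableT_comp => //; exact: (measurable_fubini_G If).
- apply: (@measurable_fun_fubini_tonelli_G _ _ _ _ _ m1 (abse \o f)) => //.
    exact: measurableT_comp.
  by move=> p /=; exact: abse_ge0.
- by move=> y _; apply: le_abse_integral => //; exact: measurableT_comp.
Qed.

Section averaging.
Context (R : realType).
Local Notation mu := (@lebesgue_measure R).
Local Notation E := (`[0, +oo[%classic : set R).
Implicit Types (s x y z a b M : R) (g : R -> R).
Variable alpha : R.
Hypothesis alpha_gt : -1 < alpha.

Let a1_gt0 : 0 < alpha + 1. Proof. by rewrite -ltrBlDr sub0r. Qed.

(** Up to the factor $\alpha+1$, the law of $z\beta$ with $\beta$ a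
    $\mathrm{Beta}(\alpha+1,1)$ variable. *)
Definition avg_kernel z y : R :=
  if 0 < y <= z then y `^ alpha / z `^ (alpha + 1) else 0.
Local Notation K := avg_kernel.

Definition avg g z : R := \int[mu]_y (K z y * g y).

(** The density of the averages over $z\in(a,b]$: by Tonelli's theorem the
    integral of $Ag$ over $(a,b]$ is $\int\psi_{a,b}g$. *)
Definition psi a b y : R := \int[mu]_(z in `]a, b]) K z y.

Definition avg_int a b g : R := \int[mu]_(z in `]a, b]) avg g z.

Lemma avg_kernel_ge0 z y : 0 <= K z y.
Proof. by rewrite /avg_kernel; case: ifP => // _; rewrite divr_ge0// powR_ge0. Qed.

Lemma avg_kernel_le z y : 0 < y -> K z y <= y^-1.
Proof.
move=> y0; rewrite /avg_kernel; case: ifPn => [/andP[_ yz]|_]; last first.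
  by rewrite invr_ge0 ltW.
have z0 : 0 < z by exact: lt_le_trans yz.
rewrite ler_pdivrMr ?powR_gt0// ler_pdivlMl//.
rewrite -{1}(powRr1 (ltW y0)) -powRD; last by rewrite (gt_eqF y0) implybT.
by rewrite addrC ge0_ler_powR ?nnegrE// ltW.
Qed.

Lemma avg_kernel_out z y : y <= 0 -> K z y = 0.
Proof. by move=> y0; rewrite /avg_kernel ltNge y0. Qed.

Lemma avg_kernel_out2 z y : z <= 0 -> K z y = 0.
Proof.
move=> z0; rewrite /avg_kernel; case: ifP => // /andP[y0 yz].
by have := lt_le_trans y0 (le_trans yz z0); rewrite ltxx.
Qed.

Lemma measurable_avg_kernel :
  measurable_fun [set: R * R] (fun p : R * R => K p.1 p.2).
Proof.
apply: measurable_fun_ifT => //.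
  by apply: measurable_and; [exact: measurable_fun_ltr|exact: measurable_fun_ler].
under eq_fun do rewrite -powRN.
by apply: measurable_funM; exact: (measurableT_comp (measurable_powR _)).
Qed.

Lemma measurable_avg_kernel1 z : measurable_fun [set: R] (K z).
Proof. exact: (measurableT_comp measurable_avg_kernel (measurable_pair1 z)). Qed.

Lemma measurable_avg_kernel2 y : measurable_fun [set: R] (K ^~ y).
Proof. exact: (measurableT_comp measurable_avg_kernel (measurable_pair2 y)). Qed.

Let powR_at0 (c : R) : 0 < c -> 0 `^ c = 0 :> R.
Proof. by move=> c0; rewrite powR0// gt_eqF. Qed.

Lemma power_integral z : 0 < z ->
  (\int[mu]_(y in `]0%R, z]) (y `^ alpha)%:E =
   (z `^ (alpha + 1) / (alpha + 1))%R%:E)%E.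
Proof.
move=> z0.
pose G y : R := y `^ (alpha + 1) / (alpha + 1).
have dG y : 0 < y -> is_derive y 1 G (y `^ alpha).
  move=> y0; have -> : G = (fun y => (alpha + 1)^-1 * y `^ (alpha + 1)).
    by apply/funext => w; rewrite /G mulrC.
  have := is_deriveZ (alpha + 1)^-1 (is_derive1_powR (alpha + 1) y0).
  by rewrite /GRing.scale/= mulrA mulVf ?gt_eqF// mul1r addrK.
have cg y : 0 < y -> {for y, continuous (@powR R ^~ alpha)}.
  move=> y0; apply/differentiable_continuous/derivable1_diffP.
  by have [] := is_derive1_powR alpha y0.
have G0 : G 0 = 0 by rewrite /G powR_at0// mul0r.
have cG : G y @[y --> 0^'+] --> G 0.
  rewrite G0; have : G y @[y --> 0^'+] --> 0 * (alpha + 1)^-1.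
    by apply: cvgM; [exact: powR_cvg0|exact: cvg_cst].
  by rewrite mul0r.
by rewrite (improper_FTC_ge0 z0 cg (fun y _ => powR_ge0 y alpha) dG cG) G0 subr0.
Qed.

Lemma power_integrable z : 0 < z ->
  mu.-integrable `]0, z] (EFin \o (fun y => y `^ alpha)).
Proof.
move=> z0; apply/integrableP; split.
  apply/measurable_EFinP; apply: measurable_funS (measurable_powR _) => //.
under eq_integral do rewrite gee0_abs ?lee_fin ?powR_ge0//.
by rewrite power_integral// ltry.
Qed.

Let avg_patch g z y : K z y * g y =
  ((fun y => (z `^ (alpha + 1))^-1 * (y `^ alpha * g y)) \_ `]0, z]) y.
Proof.
rewrite patchE /avg_kernel mem_setE in_itv/=.
by case: ifP => _; rewrite ?mul0r//; ring.
Qed.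

Lemma avg_kernel_integral z : 0 < z ->
  (\int[mu]_y (K z y)%:E = ((alpha + 1)^-1)%:E)%E.
Proof.
move=> z0; transitivity (\int[mu]_(y in `]0%R, z])
    (((z `^ (alpha + 1))^-1)%:E * (y `^ alpha)%:E))%E.
  rewrite [RHS]integral_mkcond; apply: eq_integral => y _.
  by rewrite -[K z y]mulr1 (avg_patch (fun=> 1)) !patchE mulr1; case: ifP.
rewrite ge0_integralZl_EFin//; last first.
- by rewrite invr_ge0 powR_ge0.
- apply/measurable_EFinP; apply: measurable_funS (measurable_powR _) => //.
- by move=> y _; rewrite lee_fin powR_ge0.
rewrite power_integral// -EFinM; congr EFin; field.
by rewrite !gt_eqF// powR_gt0.
Qed.

Lemma avg_kernel_integrable z : mu.-integrable setT (EFin \o K z).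
Proof.
have mK := measurable_avg_kernel1 z.
apply/integrableP; split; first exact/measurable_EFinP.
under eq_integral do rewrite gee0_abs ?lee_fin ?avg_kernel_ge0//.
have [z0|z0] := ltP 0 z; first by rewrite avg_kernel_integral// ltry.
under eq_integral do rewrite /= avg_kernel_out2//.
by rewrite integral0.
Qed.

Lemma avg_kernel_integrable_prod a b : 0 <= a ->
  (mu \x mu)%E.-integrable setT
    (EFin \o (fun p : R * R => \1_(`]a, b]) p.1 * K p.1 p.2)).
Proof.
move=> a0; pose I z : R := \1_(`]a, b]) z.
have mI : measurable_fun setT I by apply: measurable_indic; exact: measurable_itv.
apply/integrable12ltyP.
  apply/measurable_EFinP; apply: measurable_funM measurable_avg_kernel.
  exact: (measurableT_comp mI measurable_fst).
rewrite (_ : (fun z => _) = (fun z => ((alpha + 1)^-1)%:E * (I z)%:E)%E); last first.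
  apply/funext => z /=; have [zab|zab] := boolP (z \in `]a, b]%classic); last first.
    rewrite /I indicE (negbTE zab) mule0.
    by under eq_integral do rewrite mul0r normr0; rewrite integral0.
  rewrite /I indicE zab mule1 -(avg_kernel_integral (_ : 0 < z)); last first.
    by move: zab; rewrite inE/= in_itv/= => /andP[+ _]; exact: le_lt_trans.
  by apply: eq_integral => y _; rewrite mul1r ger0_norm ?avg_kernel_ge0.
rewrite ge0_integralZl_EFin//; last first.
- by rewrite invr_ge0 ltW.
- exact/measurable_EFinP.
- by move=> z _; rewrite lee_fin.
rewrite integral_indic// setIT.
by rewrite /= lebesgue_measure_itv/=; case: ifP => _; rewrite ?mule0 -?EFinD -?EFinM ltry.
Qed.

Let avg_hat g z : (fun y => K z y * g y) = (fun y => K z y * (g \_ E) y).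
Proof.
apply/funext => y; rewrite patchE; case: ifPn => //.
rewrite notin_setE /= in_itv/= andbT => /negP; rewrite -ltNge => /ltW y0.
by rewrite avg_kernel_out// !mul0r.
Qed.

Section bounded.
Variables (g : R -> R) (M : R).
Hypothesis mg : measurable_fun E g.
Hypothesis gM : forall y, E y -> `|g y| <= M.

Let M0 : 0 <= M.
Proof. by apply: le_trans (gM (_ : E 0)) => //; rewrite /= in_itv/= lexx. Qed.

Let mE : measurable E. Proof. exact: measurable_itv. Qed.

Let mghat : measurable_fun setT (g \_ E).
Proof. by apply/(measurable_restrictT g). Qed.

Let ghatM y : `|(g \_ E) y| <= M.
Proof. by rewrite patchE; case: ifPn; rewrite ?normr0// inE => /gM. Qed.

Lemma avg_integrable z : mu.-integrable setT (EFin \o (fun y => K z y * g y)).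
Proof.
rewrite avg_hat; under eq_fun do rewrite mulrC.
exact: (integrable_mulr_bounded measurableT (avg_kernel_integrable z) mghat
  (fun y _ => ghatM y)).
Qed.

Lemma avg_bound z : 0 < z -> `|avg g z| <= M / (alpha + 1).
Proof.
move=> z0; rewrite /avg.
rewrite (le_trans (le_normr_Rintegral _ (avg_integrable z)))//.
apply: le_trans (_ : \int[mu]_y (M * K z y) <= _).
  apply: le_Rintegral => //.
  - exact: (integrable_normr _ (avg_integrable z)).
  - exact: (integrableZl_real _ _ (avg_kernel_integrable z)).
  - move=> y _; rewrite normrM ger0_norm ?avg_kernel_ge0// mulrC.
    have [y0|y0] := leP 0 y; last by rewrite avg_kernel_out ?(ltW y0)// !mulr0.
    by rewrite ler_wpM2r ?avg_kernel_ge0// gM//= in_itv/= y0.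
rewrite RintegralZl//; last exact: avg_kernel_integrable.
by rewrite /Rintegral avg_kernel_integral.
Qed.

(** Fubini's theorem applies since $\int K(z,y)\,dy=1/(\alpha+1)$ for every
    $z>0$. *)
Lemma avg_int_fubini a b : 0 <= a ->
  [/\ mu.-integrable `]a, b] (EFin \o avg g),
      mu.-integrable setT (EFin \o (fun y => psi a b y * g y)) &
      avg_int a b g = \int[mu]_y (psi a b y * g y)].
Proof.
move=> a0; pose I z : R := \1_(`]a, b]) z.
have mI : measurable_fun setT I by apply: measurable_indic; exact: measurable_itv.
pose F (p : R * R) := (g \_ E) p.2 * (I p.1 * K p.1 p.2).
have IK := avg_kernel_integrable_prod b a0.
have IF : (mu \x mu)%E.-integrable setT (EFin \o F).
  apply: (integrable_mulr_bounded measurableT IK _ (fun p _ => ghatM p.2)).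
  exact: (measurableT_comp mghat measurable_snd).
have inner1 z : (\int[mu]_y (F (z, y))%:E = (I z * avg g z)%:E)%E.
  rewrite /avg EFinM fineK; last exact: (integrable_fin_num _ (avg_integrable z)).
  rewrite -integralZl//; last exact: avg_integrable.
  apply: eq_integral => y _; rewrite -EFinM; congr EFin.
  by rewrite (congr1 (fun h => h y) (avg_hat g z)) /F /=; ring.
have inner2 y : (\int[mu]_z (F (z, y))%:E = (psi a b y * g y)%:E)%E.
  have [y0|y0] := leP y 0.
    rewrite (_ : psi a b y = 0); last first.
      by rewrite /psi; under eq_Rintegral do rewrite avg_kernel_out//; rewrite /Rintegral integral0.
    rewrite mul0r; under eq_integral do rewrite /F /= avg_kernel_out// !mulr0.
    by rewrite integral0.
  have Ey : E y by rewrite /= in_itv/= (ltW y0).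
  have Ipsi : mu.-integrable `]a, b] (EFin \o K ^~ y).
    apply: (@finite_bounded_integrable _ _ _ _ _ _ y^-1) => //.
    - by rewrite /= lebesgue_measure_itv/=; case: ifP => _; rewrite ltry.
    - by apply: measurable_funS (measurable_avg_kernel2 y).
    - by move=> z _; rewrite ger0_norm ?avg_kernel_ge0// avg_kernel_le.
  rewrite /psi mulrC EFinM fineK; last exact: (integrable_fin_num _ Ipsi).
  rewrite -integralZl// [RHS]integral_mkcond.
  apply: eq_integral => z _; rewrite /F /= !patchE mem_set// /I indicE.
  by case: (z \in _); rewrite ?mul1r// mul0r mulr0.
have h1 := integrable_fubini_F IF.
have h2 := integrable_fubini_G IF.
have {}h1 : mu.-integrable setT (EFin \o (fun z => I z * avg g z)).
  by apply: eq_integrable h1 => // z _; exact: inner1.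
have {}h2 : mu.-integrable setT (EFin \o (fun y => psi a b y * g y)).
  by apply: eq_integrable h2 => // y _; exact: inner2.
have IE : EFin \o (fun z => I z * avg g z) = (EFin \o avg g) \_ `]a, b].
  apply/funext => z; rewrite patchE /= /I indicE.
  by case: (z \in _); rewrite ?mul1r ?mul0r.
split => //.
  move: h1; rewrite IE => /integrable_restrict; rewrite setTI; apply => //.
rewrite /avg_int /Rintegral integral_mkcond; congr fine.
transitivity (\int[mu]_z \int[mu]_y (F (z, y))%:E)%E.
  apply: eq_integral => z _; rewrite inner1.
  exact: (esym (congr1 (fun h => h z) IE)).
by rewrite (Fubini IF); apply: eq_integral => y _; exact: inner2.
Qed.

Lemma avg_int_bound a b : 0 <= a -> a <= b ->
  `|avg_int a b g| <= M / (alpha + 1) * (b - a).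
Proof.
move=> a0 ab; have [I1 _ _] := avg_int_fubini b a0.
have mab : (mu `]a, b] = (b - a)%:E)%E.
  rewrite /= lebesgue_measure_itv/= lte_fin; case: ltP => [_//|ba].
  by rewrite (_ : b = a) ?subrr//; apply/le_anti/andP.
rewrite /avg_int (le_trans (le_normr_Rintegral _ I1))//.
apply: (@le_trans _ _ (\int[mu]_(z in `]a, b]) (M / (alpha + 1)))).
  apply: le_Rintegral => //.
  - exact: (integrable_normr _ I1).
  - by apply: finite_cst_integrable => //; rewrite [X in (X < _)%E]mab ltry.
  - move=> z; rewrite /= in_itv/= => /andP[az _].
    by apply: avg_bound; exact: le_lt_trans az.
rewrite Rintegral_cst//.
by rewrite [X in fine X]mab.
Qed.

Lemma avg_int_add a b : 0 <= a -> a <= b ->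
  avg_int 0 b g - avg_int 0 a g = avg_int a b g.
Proof.
move=> a0 ab; have [I1 _ _] := avg_int_fubini b (lexx 0).
by apply: Rintegral_itvB => //; rewrite bnd_simp.
Qed.

End bounded.

Let bE1 y : E y -> `|1 : R| <= 1. Proof. by rewrite normr1. Qed.

Lemma psi_integrable a b : 0 <= a -> mu.-integrable setT (EFin \o psi a b).
Proof.
move=> a0; have [_ + _] := avg_int_fubini (measurable_cst (1 : R)) bE1 b a0.
apply: eq_integrable => // y _ /=; by rewrite mulr1.
Qed.

Lemma psi_ge0 a b y : 0 <= psi a b y.
Proof. by apply: Rintegral_ge0 => z _; exact: avg_kernel_ge0. Qed.

Lemma psi_out a b y : y <= 0 -> psi a b y = 0.
Proof.
move=> y0; rewrite /psi; under eq_Rintegral do rewrite avg_kernel_out//.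
by rewrite /Rintegral integral0.
Qed.

Lemma avg_int_lin a b g (h : R -> R) (M N c d : R) : 0 <= a ->
  measurable_fun E g -> (forall y, E y -> `|g y| <= M) ->
  measurable_fun E h -> (forall y, E y -> `|h y| <= N) ->
  avg_int a b (fun y => c * g y + d * h y) = c * avg_int a b g + d * avg_int a b h.
Proof.
move=> a0 mg gM mh hN.
have [_ Ig ->] := avg_int_fubini mg gM b a0.
have [_ Ih ->] := avg_int_fubini mh hN b a0.
have mgh : measurable_fun E (fun y => c * g y + d * h y).
  by apply: measurable_funD; apply: measurable_funM.
have ghM y : E y -> `|c * g y + d * h y| <= `|c| * M + `|d| * N.
  move=> Ey; rewrite (le_trans (ler_normD _ _))// !normrM.
  by rewrite lerD// ler_wpM2l//; [exact: gM|exact: hN].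
have [_ _ ->] := avg_int_fubini mgh ghM b a0.
rewrite -!RintegralZl// -RintegralD//; try exact: integrableZl_real.
by apply: eq_Rintegral => y _; ring.
Qed.

Lemma avg_int_cvg a b (g_ : nat -> R -> R) g M : 0 <= a ->
  (forall n, measurable_fun E (g_ n)) ->
  (forall n y, E y -> `|g_ n y| <= M) ->
  (forall y, E y -> g_ n y @[n --> \oo] --> g y) ->
  avg_int a b (g_ n) @[n --> \oo] --> avg_int a b g.
Proof.
move=> a0 mg_ g_M cg.
have M0 : 0 <= M by apply: le_trans (g_M 0%N 0 _) => //; rewrite /= in_itv/= lexx.
have mg : measurable_fun E g by exact: (measurable_fun_cvg mg_).
have gM y : E y -> `|g y| <= M.
  move=> Ey; have /cvg_norm c := cg y Ey.
  rewrite -(cvg_lim (@Rhausdorff R) c); apply: limr_le.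
    by apply/cvg_ex; eexists; exact: c.
  by apply: nearW => n; exact: g_M.
have [_ Ig ->] := avg_int_fubini mg gM b a0.
rewrite (_ : (fun n => _) = (fun n => \int[mu]_y (psi a b y * g_ n y))); last first.
  by apply/funext => n; have [_ _ ->] := avg_int_fubini (mg_ n) (g_M n) b a0.
have [||||_ _ //] := @dominated_convergence_real _ _ _ mu setT
    (fun n y => psi a b y * g_ n y) (fun y => psi a b y * g y)
    (fun y => M * psi a b y) measurableT.
- move=> n; have [_ + _] := avg_int_fubini (mg_ n) (g_M n) b a0.
  by move/integrableP => [/measurable_EFinP].
- move=> y _; have [y0|y0] := leP y 0.
    by rewrite psi_out// mul0r; apply: cvg_near_cst; apply: nearW => n; rewrite mul0r.
  apply: cvgM; first exact: cvg_cst.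
  by apply: cg; rewrite /= in_itv/= (ltW y0).
- by apply: integrableZl_real => //; exact: psi_integrable.
- move=> n y _; have [y0|y0] := leP y 0; first by rewrite psi_out// mul0r mulr0 normr0.
  rewrite normrM ger0_norm ?psi_ge0// mulrC ler_wpM2r ?psi_ge0//.
  by apply: g_M; rewrite /= in_itv/= (ltW y0).
Qed.

(** $y^\alpha Be_s=(y^{\alpha+1}e_s')'$, so averaging undoes the outer
    derivative. *)
Lemma avg_bessel_decay s z : 0 < s -> 0 < z ->
  avg (bessel_decay alpha s) z = - s * decay s z.
Proof.
move=> s0 z0.
pose G y : R := y `^ (alpha + 1) * (- s * decay s y).
pose g y : R := y `^ alpha * bessel_decay alpha s y.
have dG y : 0 < y -> is_derive y 1 G (g y).
  move=> y0; have d1 := is_derive1_powR (alpha + 1) y0.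
  have d2 := is_deriveZ (- s) (is_derive_decay s y).
  apply: (is_derive_eq (is_deriveM d1 d2)).
  rewrite /GRing.scale/= addrK /g /bessel_decay.
  have -> : y `^ (alpha + 1) = y `^ alpha * y.
    by rewrite -{3}(powRr1 (ltW y0)) -powRD// (gt_eqF y0) implybT.
  by rewrite -[- s *: decay s y]/(- s * decay s y); ring.
have cpow (c y : R) : 0 < y -> {for y, continuous (@powR R ^~ c)}.
  move=> y0; apply/differentiable_continuous/derivable1_diffP.
  by have [] := is_derive1_powR c y0.
have cb : continuous (bessel_decay alpha s).
  move=> y; apply: cvgM; last exact: continuous_decay.
  by apply: cvgB; [apply: cvgM; [exact: cvg_cst|exact: cvg_id]|exact: cvg_cst].
have cg y : 0 < y -> {for y, continuous g}.
  by move=> y0; apply: cvgM; [exact: cpow|exact: cb].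
have G0 : G 0 = 0 by rewrite /G powR_at0// mul0r.
have cG : G y @[y --> 0^'+] --> G 0.
  rewrite G0; have : G y @[y --> 0^'+] --> 0 * (- s * decay s 0).
    apply: cvgM; first exact: powR_cvg0.
    apply: (@cvg_at_right_filter _ _ (fun y => - s * decay s y)).
    by apply: cvgM; [exact: cvg_cst|exact: continuous_decay].
  by rewrite mul0r.
have cE : closed E by exact: interval_closed.
have [M _ bM] := C_infty_bounded cE (C_infty_bessel_decay alpha s0).
have Ih : mu.-integrable `]0, z] (EFin \o (fun y => M * y `^ alpha)).
  by apply: integrableZl_real => //; exact: power_integrable.
have F : \int[mu]_(y in `]0, z]) g y = G z - G 0.
  apply: (improper_FTC_dominated z0 cg dG cG Ih) => y /andP[y0 _].
  rewrite normrM ger0_norm ?powR_ge0// mulrC ler_wpM2r ?powR_ge0//.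
  by apply: bM; rewrite /= in_itv/= (ltW y0).
have zp : 0 < z `^ (alpha + 1) by rewrite powR_gt0.
transitivity ((z `^ (alpha + 1))^-1 * \int[mu]_(y in `]0, z]) g y); last first.
  by rewrite F G0 subr0 /G mulrA mulVf ?gt_eqF// mul1r.
rewrite -RintegralZl//; last first.
  apply: dominated_integrable_real Ih _ => //.
    apply: subspace_continuous_measurable_fun => //.
    apply: continuous_in_subspaceT => y; rewrite inE/= in_itv/= => /andP[y0 _].
    exact: cg.
  move=> y; rewrite /= in_itv/= => /andP[y0 _].
  rewrite normrM ger0_norm ?powR_ge0// mulrC ler_wpM2r ?powR_ge0//.
  by apply: bM; rewrite /= in_itv/= (ltW y0).
rewrite [RHS]Rintegral_mkcond; apply: eq_Rintegral => y _.
exact: avg_patch.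
Qed.

Lemma avg_int_bessel_decay s a b : 0 < s -> 0 <= a -> a <= b ->
  avg_int a b (bessel_decay alpha s) = decay s b - decay s a.
Proof.
move=> s0 a0; rewrite le_eqVlt => /predU1P[<-|ab].
  by rewrite subrr /avg_int set_itvoc0 Rintegral_set0.
have cd : continuous (fun z => - s * decay s z).
  by move=> z; apply: cvgM; [exact: cvg_cst|exact: continuous_decay].
transitivity (\int[mu]_(z in `]a, b]) (- s * decay s z)).
  apply: eq_Rintegral => z; rewrite inE/= in_itv/= => /andP[az _].
  by apply: avg_bessel_decay => //; exact: le_lt_trans az.
rewrite Rintegral_itv_obnd_cbnd; last first.
  apply: (@integrableS _ _ _ mu `[a, b]%classic) => //.
    by move=> z; rewrite /= !in_itv/= => /andP[/ltW -> ->].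
  apply: continuous_compact_integrable; first exact: segment_compact.
  exact: continuous_subspaceT.
rewrite /Rintegral (@continuous_FTC2 _ _ (decay s))//.
- exact: continuous_subspaceT.
- split; first by move=> z _; have [] := is_derive_decay s z.
  + by apply: cvg_at_right_filter; exact: continuous_decay.
  + by apply: cvg_at_left_filter; exact: continuous_decay.
- by move=> z _; rewrite derive1E; apply: (@derive_val _ _ _ _ _ _ _ (is_derive_decay s z)).
Qed.

End averaging.

(** * The one-dimensional intertwining *)

Section intertwining1.
Context (R : realType).
Local Notation E := (`[0, +oo[%classic : set R).
Implicit Types (s x y u a b M N : R) (g h : R -> R).
Variables (alpha : R) (Q : R -> R -> probability R R) (t : R).
Hypothesis alpha_gt : -1 < alpha.
Hypothesis hQ : laguerre_diffusion alpha Q.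
Hypothesis t0 : 0 <= t.

Local Notation T := (kernel_op E (Q t)).
Local Notation Phi g := (fun u => avg_int alpha 0 u g).

Let a1_gt0 : 0 < alpha + 1. Proof. by rewrite -ltrBlDr sub0r. Qed.
Let mE : measurable E. Proof. exact: measurable_itv. Qed.
Let cE : closed E. Proof. exact: interval_closed. Qed.
Let EP y : E y <-> 0 <= y. Proof. by rewrite /= in_itv/= andbT. Qed.

(** Fatou's lemma for $(1-e_s)/s\uparrow\mathrm{id}$ as $s\downarrow0$, with the
    explicit values of $Q_te_s$. *)
Lemma first_moment x : 0 <= x -> (Q t x).-integrable E (EFin \o id).
Proof.
move=> x0; apply/integrableP; split; first exact/measurable_EFinP.
pose f n y : R := n.+1%:R * (1 - decay n.+1%:R^-1 y).
have f0 n y : 0 <= y -> 0 <= f n y.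
  by move=> y0; rewrite mulr_ge0// subr_ge0 decay_le1.
have mf n : measurable_fun E (f n).
  apply: subspace_continuous_measurable_fun => //; apply: continuous_subspaceT => y.
  apply: cvgM; first exact: cvg_cst.
  by apply: cvgB; [exact: cvg_cst|exact: continuous_decay].
have cf y : 0 <= y -> f n y @[n --> \oo] --> y.
  move=> y0; apply/cvgrPdist_le => e e0; near=> n.
  pose v := n.+1%:R^-1 * y.
  have n0 : 0 < n.+1%:R :> R by rewrite ltr0n.
  have v0 : 0 <= v by rewrite mulr_ge0// invr_ge0 ltW.
  have vy : v <= y by rewrite /v ler_piMl// invf_le1// ler1n.
  have -> : y - f n y = n.+1%:R * (expR (- v) - 1 - (- v)).
    rewrite /f /decay -/v (_ : y = n.+1%:R * v); last first.
      by rewrite /v mulrA divff ?mul1r// gt_eqF.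
    by ring.
  rewrite normrM gtr0_norm//.
  rewrite (le_trans (ler_wpM2l (ltW n0) (expR_second_order _)))//.
  rewrite normrN (ger0_norm v0) sqrrN.
  rewrite (@le_trans _ _ (n.+1%:R * (v ^+ 2 * expR y)))//.
    by rewrite ler_wpM2l ?(ltW n0)// ler_wpM2l ?sqr_ge0// ler_expR.
  rewrite (_ : n.+1%:R * (v ^+ 2 * expR y) = n.+1%:R^-1 * (y ^+ 2 * expR y)); last first.
    by rewrite /v; field; rewrite gt_eqF.
  rewrite ler_pdivrMl// -ler_pdivrMr//.
  rewrite (@le_trans _ _ n%:R) ?ler_nat//.
  by near: n; exact: nbhs_infty_ger.
have D1 s : 0 < s -> 1 - s * ((alpha + 1) + x) <= flow_mass alpha s t * decay (flow_rate s t) x.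
  move=> s0; rewrite /flow_mass /flow_rate /decay.
  have et0 := expR_gt0 (- t).
  have et1 : expR (- t) <= 1 by rewrite -expR0 ler_expR oppr_le0.
  have c0 : 0 <= s * (1 - expR (- t)) by rewrite mulr_ge0 ?(ltW s0)// subr_ge0.
  set D := 1 + s * (1 - expR (- t)); have D1 : 1 <= D by rewrite lerDl.
  have D0 : 0 < D by exact: lt_le_trans D1.
  have lnD : ln D <= s.
    apply: le_trans (_ : s * (1 - expR (- t)) <= _).
      by apply: le_ln1Dx; apply: lt_le_trans c0; rewrite oppr_lt0.
    by rewrite ler_piMr ?(ltW s0)// lerBlDr lerDl ltW.
  have lnD0 : 0 <= ln D by exact: ln_ge0.
  have r1 : s * expR (- t) / D * x <= s * x.
    rewrite ler_wpM2r// ler_pdivrMr// ler_pM2l//; exact: le_trans D1.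
  rewrite /powR gt_eqF// -expRD.
  apply: le_trans (expR_ge1Dx _).
  have : (alpha + 1) * ln D <= (alpha + 1) * s by rewrite ler_wpM2l// ltW.
  lra.
have intf n : (\int[Q t x]_(y in E) (f n y)%:E <= ((alpha + 1) + x)%:E)%E.
  have n0 : 0 < n.+1%:R^-1 :> R by rewrite invr_gt0 ltr0n.
  have bd y : E y -> `|decay n.+1%:R^-1 y| <= 1.
    by move=> /EP y0; rewrite ger0_norm ?decay_ge0// decay_le1// ltW.
  have Id : (Q t x).-integrable E (EFin \o decay n.+1%:R^-1).
    by apply: bounded_integrable bd => //; exact: C_infty_measurable (C_infty_decay n0).
  have I1 := finite_cst_integrable (1 : R) mE
    (le_lt_trans (probability_le1 (Q t x) mE) (ltry 1)).
  have If : (Q t x).-integrable E (EFin \o f n).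
    apply: integrableZl_real => //.
    by have := integrableB mE I1 Id; apply: eq_integrable.
  rewrite -(fineK (integrable_fin_num mE If)) lee_fin.
  rewrite -[X in X <= _]/(\int[Q t x]_(y in E) f n y) /f.
  rewrite RintegralZl//; last by have := integrableB mE I1 Id; apply: eq_integrable.
  rewrite RintegralB// prob_Rintegral_cst//; last first.
    by apply: (laguerre_conservative hQ) => //; exact/EP.
  have := laguerre_decay alpha_gt hQ n0 t0 x0; rewrite /kernel_op => ->.
  rewrite -ler_pdivlMl ?ltr0n//.
  by rewrite lerBlDr -lerBlDl; exact: D1.
have f0' n y : E y -> (0 <= (EFin \o f n) y)%E by move=> /EP; exact: f0.
have F := fatou (Q t x) mE (fun n => (measurable_EFinP _ _).2 (mf n)) f0'.
apply: (@le_lt_trans _ _ ((alpha + 1) + x)%:E); last exact: ltry.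
apply: le_trans (_ : limn_einf (fun n => \int[Q t x]_(y in E) (EFin \o f n) y)%E <= _)%E.
  apply: le_trans F.
  rewrite le_eqVlt; apply/orP; left; apply/eqP; apply: eq_integral => y.
  rewrite inE => /EP y0 /=; rewrite ger0_norm//.
  have cEf : (f n y)%:E @[n --> \oo] --> y%:E.
    by apply: cvg_EFin; [exact: nearW|exact: cf].
  by rewrite is_cvg_limn_einfE; [apply/esym/cvg_lim|exact: cvgP cEf].
rewrite limn_einf_lim; apply: lime_le; first exact: is_cvg_einfs.
apply: nearW => n; apply: le_trans (intf n); apply: ereal_inf_lbound.
by exists n => /=.
Unshelve. all: by end_near. Qed.


Section Phi.
Variables (g : R -> R) (M : R).
Hypothesis mg : measurable_fun E g.
Hypothesis gM : forall y, E y -> `|g y| <= M.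

Lemma avg_int0_lipschitz a b : 0 <= a -> a <= b ->
  `|Phi g b - Phi g a| <= M / (alpha + 1) * (b - a).
Proof.
move=> a0 ab; rewrite (avg_int_add alpha_gt mg gM a0 ab).
exact: avg_int_bound.
Qed.

Lemma measurable_avg_int0 : measurable_fun E (Phi g).
Proof.
apply: subspace_continuous_measurable_fun => //.
apply/subspace_continuousP => x /EP x0.
have M0 : 0 <= M by apply: le_trans (gM (_ : E 0)) => //; exact/EP.
have c0 : 0 < M / (alpha + 1) + 1 by rewrite ltr_wpDl// divr_ge0// ltW.
apply/cvgrPdist_le => e e0.
have d0 : 0 < e / (M / (alpha + 1) + 1) by rewrite divr_gt0.
near=> y.
have y0 : 0 <= y by apply/EP; near: y; exact: withinT.
have xy : `|x - y| <= e / (M / (alpha + 1) + 1).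
  near: y; apply: cvg_within; have /cvgrPdist_le := @cvg_id _ (nbhs x).
  exact.
have H : `|Phi g x - Phi g y| <= (M / (alpha + 1) + 1) * `|x - y|.
  have [xley|/ltW ylex] := leP x y.
    rewrite distrC (le_trans (avg_int0_lipschitz x0 xley))// distrC.
    by rewrite ler_pM ?subr_ge0 ?divr_ge0 ?lerDl ?ler_norm ?(ltW a1_gt0).
  rewrite (le_trans (avg_int0_lipschitz y0 ylex))//.
  by rewrite ler_pM ?subr_ge0 ?divr_ge0 ?lerDl ?ler_norm ?(ltW a1_gt0).
by rewrite (le_trans H)// -ler_pdivlMl// mulrC.
Unshelve. all: by end_near. Qed.

Lemma avg_int0_le u : 0 <= u -> `|Phi g u| <= M / (alpha + 1) * u.
Proof.
by move=> u0; rewrite (le_trans (avg_int_bound alpha_gt mg gM (lexx 0) u0))// subr0.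
Qed.

Lemma avg_int0_integrable x : 0 <= x -> (Q t x).-integrable E (EFin \o Phi g).
Proof.
move=> x0; apply: (dominated_integrable_real mE measurable_avg_int0
  (integrableZl_real (M / (alpha + 1)) mE (first_moment x0))) => u /EP u0.
exact: avg_int0_le.
Qed.

End Phi.

(** Bounded measurable functions with measurable image under $Q_t$; the bound
    is part of the data, since it must be uniform along sequences. *)
Definition admissible M g := [/\ measurable_fun E g,
  forall y, E y -> `|g y| <= M & measurable_fun E (T g)].

(** What separates $g$ from the one-dimensional intertwining relation. *)
Definition defect a b g : R :=
  expR t * (T (Phi g) b - T (Phi g) a) - avg_int alpha a b (T g).

Let T_integrable M g x : admissible M g -> (Q t x).-integrable E (EFin \o g).
Proof. by move=> [mg gM _]; exact: (bounded_integrable _ mE mg gM). Qed.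

Let T_lin_integrable g h (c d : R) x :
  (Q t x).-integrable E (EFin \o g) -> (Q t x).-integrable E (EFin \o h) ->
  T (fun y => c * g y + d * h y) x = c * T g x + d * T h x.
Proof.
move=> Ig Ih; rewrite /kernel_op RintegralD//; try exact: integrableZl_real.
by rewrite !RintegralZl.
Qed.

Lemma admissible_ge0 M g : admissible M g -> 0 <= M.
Proof. by move=> [_ gM _]; apply: le_trans (gM 0 _) => //; exact/EP. Qed.

Lemma admissible_bound M g x : admissible M g -> `|T g x| <= M.
Proof.
by move=> ag; have [mg gM _] := ag; apply: prob_Rintegral_le => //;
  exact: admissible_ge0 ag.
Qed.

Lemma C_infty_admissible g : C_infty E g -> exists M, admissible M g.
Proof.
move=> Cg; have [M _ gM] := C_infty_bounded cE Cg; exists M; split => //.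
  exact: C_infty_measurable.
by apply: C_infty_measurable => //; exact: (feller_C_infty (laguerre_feller hQ)).
Qed.

Lemma admissible_lin M N g h (c d : R) : admissible M g -> admissible N h ->
  admissible (`|c| * M + `|d| * N) (fun y => c * g y + d * h y) /\
  forall x, T (fun y => c * g y + d * h y) x = c * T g x + d * T h x.
Proof.
move=> ag ah; have [mg gM mTg] := ag; have [mh hN mTh] := ah.
have TE x : T (fun y => c * g y + d * h y) x = c * T g x + d * T h x.
  by apply: T_lin_integrable; [exact: T_integrable ag|exact: T_integrable ah].
split => //; split.
- by apply: measurable_funD; apply: measurable_funM.
- move=> y Ey; rewrite (le_trans (ler_normD _ _))// !normrM.
  by rewrite lerD// ler_wpM2l//; [exact: gM|exact: hN].
- rewrite (_ : T _ = fun x => c * T g x + d * T h x); last exact/funext.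
  by apply: measurable_funD; apply: measurable_funM.
Qed.

#[local] Opaque kernel_op avg_int.

Lemma defect_lin M N g h (c d : R) a b : 0 <= a -> 0 <= b ->
  admissible M g -> admissible N h ->
  defect a b (fun y => c * g y + d * h y) = c * defect a b g + d * defect a b h.
Proof.
move=> a0 b0 ag ah; have [_ TE] := admissible_lin c d ag ah.
have [mg gM mTg] := ag; have [mh hN mTh] := ah.
have PE : Phi (fun y => c * g y + d * h y) = (fun u => c * Phi g u + d * Phi h u).
  by apply/funext => u; rewrite (avg_int_lin alpha_gt _ _ _ (lexx 0) mg gM mh hN).
have TPE x : 0 <= x -> T (Phi (fun y => c * g y + d * h y)) x =
    c * T (Phi g) x + d * T (Phi h) x.
  move=> x0; rewrite PE; apply: T_lin_integrable.
    exact: (avg_int0_integrable mg gM x0).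
  exact: (avg_int0_integrable mh hN x0).
have AE : avg_int alpha a b (T (fun y => c * g y + d * h y)) =
    c * avg_int alpha a b (T g) + d * avg_int alpha a b (T h).
  rewrite -(avg_int_lin alpha_gt b _ _ a0 mTg (fun y _ => admissible_bound y ag)
    mTh (fun y _ => admissible_bound y ah)).
  by congr (avg_int alpha a b _); apply/funext => x; exact: TE.
have alg (e A1 A2 A3 A4 A5 A6 : R) :
  e * ((c * A1 + d * A2) - (c * A3 + d * A4)) - (c * A5 + d * A6) =
  c * (e * (A1 - A3) - A5) + d * (e * (A2 - A4) - A6) by ring.
by rewrite {1}/defect AE (TPE b b0) (TPE a a0); exact: alg.
Qed.

#[local] Transparent kernel_op avg_int.

Definition defect_const a b : R :=
  expR t * (T id b + T id a) / (alpha + 1) + (b - a) / (alpha + 1).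

Lemma defect_bound M g a b : 0 <= a -> a <= b -> admissible M g ->
  `|defect a b g| <= M * defect_const a b.
Proof.
move=> a0 ab ag; have [mg gM mTg] := ag; have b0 := le_trans a0 ab.
have TP x : 0 <= x -> `|T (Phi g) x| <= M / (alpha + 1) * T id x.
  move=> x0; have I1 := avg_int0_integrable mg gM x0.
  rewrite /kernel_op (le_trans (le_normr_Rintegral _ I1))//.
  have I2 := first_moment x0.
  rewrite -RintegralZl//; apply: le_Rintegral => //.
  - exact: integrable_normr.
  - exact: integrableZl_real.
  - by move=> u /EP u0; exact: avg_int0_le.
have := avg_int_bound alpha_gt mTg (fun y _ => admissible_bound y ag) a0 ab.
have := TP a a0; have := TP b b0.
rewrite /defect /defect_const => h1 h2 h3.
rewrite (le_trans (ler_normB _ _))//.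
rewrite (_ : M * _ = expR t * (M / (alpha + 1) * T id b + M / (alpha + 1) * T id a)
  + M / (alpha + 1) * (b - a)); last by ring.
rewrite lerD// normrM gtr0_norm ?expR_gt0// ler_wpM2l ?expR_ge0//.
by rewrite (le_trans (ler_normB _ _))// lerD.
Qed.

Lemma admissible_cvg M (g_ : nat -> R -> R) g :
  (forall n, admissible M (g_ n)) ->
  (forall y, E y -> g_ n y @[n --> \oo] --> g y) ->
  admissible M g /\ forall x, T (g_ n) x @[n --> \oo] --> T g x.
Proof.
move=> ag_ cg.
have mg_ n : measurable_fun E (g_ n) by have [] := ag_ n.
have g_M n y : E y -> `|g_ n y| <= M by have [_ + _] := ag_ n; exact.
have mg : measurable_fun E g by exact: (measurable_fun_cvg mg_).
have gM y : E y -> `|g y| <= M.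
  move=> Ey; have /cvg_norm c := cg y Ey.
  rewrite -(cvg_lim (@Rhausdorff R) c); apply: limr_le.
    by apply/cvg_ex; eexists; exact: c.
  by apply: nearW => n; exact: g_M.
have Qoo x : (Q t x E < +oo)%E by rewrite (le_lt_trans (probability_le1 _ _))// ltry.
have cT x : T (g_ n) x @[n --> \oo] --> T g x.
  by have [] := dominated_convergence_real mE mg_ cg
    (finite_cst_integrable M mE (Qoo x)) g_M.
split => //; split => //.
apply: (@measurable_fun_cvg _ _ _ E (fun n => T (g_ n))).
  by move=> n; have [] := ag_ n.
by move=> x _; exact: cT.
Qed.

Lemma defect_cvg M (g_ : nat -> R -> R) g a b : 0 <= a -> 0 <= b ->
  (forall n, admissible M (g_ n)) ->
  (forall y, E y -> g_ n y @[n --> \oo] --> g y) ->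
  defect a b (g_ n) @[n --> \oo] --> defect a b g.
Proof.
move=> a0 b0 ag_ cg; have [[mg gM mTg] cT] := admissible_cvg ag_ cg.
have mg_ n : measurable_fun E (g_ n) by have [] := ag_ n.
have g_M n y : E y -> `|g_ n y| <= M by have [_ + _] := ag_ n; exact.
have cP u : Phi (g_ n) u @[n --> \oo] --> Phi g u.
  exact: (avg_int_cvg alpha_gt (lexx 0) mg_ g_M cg).
have cTP x : 0 <= x -> T (Phi (g_ n)) x @[n --> \oo] --> T (Phi g) x.
  move=> x0.
  have [] // := @dominated_convergence_real _ _ _ (Q t x) E (fun n => Phi (g_ n))
    (Phi g) (fun u => M / (alpha + 1) * u) mE.
  - by move=> n; exact: measurable_avg_int0 (mg_ n) (g_M n).
  - by apply: integrableZl_real => //; exact: first_moment.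
  - by move=> n u /EP u0; exact: (avg_int0_le (mg_ n) (g_M n)).
rewrite /defect; apply: cvgB.
  by apply: cvgM; [exact: cvg_cst|apply: cvgB; exact: cTP].
apply: (avg_int_cvg alpha_gt a0 (M := M)).
- by move=> n; have [] := ag_ n.
- by move=> n y _; exact: (admissible_bound _ (ag_ n)).
- by move=> y _; exact: cT.
Qed.

End intertwining1.

Section intertwining2.
Context (R : realType).
Local Notation E := (`[0, +oo[%classic : set R).
Local Notation mu := (@lebesgue_measure R).
Implicit Types (s x y u a b c M N : R) (g h : R -> R).

Lemma avg_int_ext (alpha : R) a b g h : (forall y, 0 <= y -> g y = h y) ->
  avg_int alpha a b g = avg_int alpha a b h.
Proof.
move=> gh; apply: eq_Rintegral => z _; apply: eq_Rintegral => y _.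
have [y0|/ltW y0] := leP 0 y; first by rewrite gh.
by rewrite avg_kernel_out// !mul0r.
Qed.

Lemma is_derive_quadratic (f : R -> R) s (l C d : R) : 0 < d ->
  (forall h : R, `|h| < d -> `|f (s + h) - f s - h * l| <= C * h ^+ 2) ->
  is_derive s 1 f l.
Proof.
move=> d0 H.
have C0 : 0 <= C.
  have := H (d / 2); rewrite ger0_norm ?divr_ge0 ?(ltW d0)//.
  have d2 : d / 2 < d by lra.
  move=> /(_ d2) /(le_trans (normr_ge0 _)); rewrite pmulr_lge0// exprn_gt0//.
  by rewrite divr_gt0.
have L : h^-1 *: ((f \o shift s) (h *: 1) - f s) @[h --> 0^'] --> l.
  apply/cvgrPdist_le => e e0; near=> h.
  have h0 : h != 0 by near: h; exact: nbhs_dnbhs_neq.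
  have hd : `|h| < d by near: h; exact: dnbhs0_lt.
  have he : `|h| < e / (C + 1) by near: h; apply: dnbhs0_lt; rewrite divr_gt0// ltr_wpDl.
  have := H h hd; rewrite /= [h *: 1]mulr1 [h + s]addrC.
  rewrite -[h^-1 *: _]/(h^-1 * _) => Hh.
  rewrite (_ : l - h^-1 * (f (s + h) - f s) = - h^-1 * (f (s + h) - f s - h * l)); last first.
    by field.
  rewrite normrM normrN normfV ler_pdivrMl ?normr_gt0//.
  rewrite (le_trans Hh)// -[h ^+ 2]real_normK ?num_real// expr2 mulrA mulrC ler_wpM2l//.
  rewrite (@le_trans _ _ ((C + 1) * `|h|)) ?ler_wpM2r ?lerDl//.
  by rewrite mulrC -ler_pdivlMr ?(ltW he)// ltr_wpDl.
apply: DeriveDef; first by apply/cvg_ex; exists l; exact: L.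
by apply/cvg_lim.
Unshelve. all: by end_near. Qed.

Variables (alpha : R) (Q : R -> R -> probability R R) (t : R).
Hypothesis alpha_gt : -1 < alpha.
Hypothesis hQ : laguerre_diffusion alpha Q.
Hypothesis t0 : 0 <= t.

Local Notation T := (kernel_op E (Q t)).
Local Notation Phi g := (fun u => avg_int alpha 0 u g).
Local Notation adm := (admissible Q t).
Local Notation dfct := (defect alpha Q t).

Let a1_gt0 : 0 < alpha + 1. Proof. by rewrite -ltrBlDr sub0r. Qed.
Let mE : measurable E. Proof. exact: measurable_itv. Qed.
Let cE : closed E. Proof. exact: interval_closed. Qed.
Let EP y : E y <-> 0 <= y. Proof. by rewrite /= in_itv/= andbT. Qed.

Lemma admissible_rebound M N g : adm M g -> (forall y, E y -> `|g y| <= N) -> adm N g.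
Proof. by move=> [mg _ mTg] gN. Qed.

Lemma decay_admissible s : 0 < s -> adm 1 (decay s).
Proof.
move=> s0; have [M aM] := C_infty_admissible hQ t0 (C_infty_decay s0).
apply: admissible_rebound aM _ => y /EP y0.
by rewrite ger0_norm ?decay_ge0// decay_le1// ltW.
Qed.

(** Both terms are explicit: $\Phi Be_s=e_s-1$, and $Q_tBe_s$ is a multiple of
    some $Be_\rho$. *)
Lemma defect_bessel_decay s a b : 0 < s -> 0 <= a -> a <= b ->
  dfct a b (bessel_decay alpha s) = 0.
Proof.
move=> s0 a0 ab; have b0 := le_trans a0 ab.
have r0 := flow_rate_gt0 s0 t0.
have TP x : 0 <= x -> T (Phi (bessel_decay alpha s)) x =
    flow_mass alpha s t * decay (flow_rate s t) x - 1.
  move=> x0; rewrite -(laguerre_decay alpha_gt hQ s0 t0 x0).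
  transitivity (\int[Q t x]_(y in E) (decay s y - 1)).
    apply: eq_Rintegral => u; rewrite inE => /EP u0.
    by rewrite (avg_int_bessel_decay alpha_gt s0 (lexx 0) u0) decay0.
  have [md bd _] := decay_admissible s0.
  have Qoo : (Q t x E < +oo)%E by rewrite (le_lt_trans (probability_le1 _ _))// ltry.
  rewrite RintegralB//; last 2 first.
  - exact: (bounded_integrable _ mE md bd).
  - exact: finite_cst_integrable.
  rewrite prob_Rintegral_cst//; apply: (laguerre_conservative hQ) => //; exact/EP.
have [M [mb bM _]] := C_infty_admissible hQ t0 (C_infty_bessel_decay alpha r0).
have AE : avg_int alpha a b (T (bessel_decay alpha s)) =
    expR t * flow_mass alpha s t * (decay (flow_rate s t) b - decay (flow_rate s t) a).
  rewrite -(avg_int_bessel_decay alpha_gt r0 a0 ab).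
  set k := expR t * _.
  transitivity (avg_int alpha a b (fun y => k * bessel_decay alpha (flow_rate s t) y
      + 0 * bessel_decay alpha (flow_rate s t) y)).
    apply: avg_int_ext => y y0.
    by rewrite (laguerre_bessel_decay alpha_gt hQ s0 t0 y0) mul0r addr0.
  by rewrite (avg_int_lin alpha_gt _ _ _ a0 mb bM mb bM) mul0r addr0.
by rewrite /defect AE (TP b b0) (TP a a0); ring.
Qed.

Let mul_decay s y : R := y * decay s y.

Let C_infty_mul_decay s : 0 < s -> C_infty E (mul_decay s).
Proof.
move=> s0; rewrite (_ : mul_decay s = fun y => (1 * y + 0) * decay s y).
  exact: C_infty_affine_decay.
by apply/funext => y; rewrite mul1r addr0.
Qed.

Let defect_mul_decay s a b : 0 < s -> 0 <= a -> a <= b ->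
  dfct a b (mul_decay s) = (1 + alpha) / s * dfct a b (decay s).
Proof.
move=> s0 a0 ab.
have [M am] := C_infty_admissible hQ t0 (C_infty_mul_decay s0).
have := defect_lin alpha_gt hQ t0 (s ^+ 2) (- ((1 + alpha) * s)) a0 (le_trans a0 ab)
  am (decay_admissible s0).
rewrite (_ : (fun y => _) = bessel_decay alpha s); last first.
  by apply/funext => y; rewrite /bessel_decay /mul_decay; ring.
rewrite defect_bessel_decay//.
move: (dfct a b (mul_decay s)) (dfct a b (decay s)) => X Y H.
have {}H : s ^+ 2 * X = (1 + alpha) * s * Y by lra.
apply: (mulfI (_ : s ^+ 2 != 0)); first by rewrite expf_eq0/= gt_eqF.
by rewrite H; field; rewrite gt_eqF.
Qed.

Let is_derive_defect_decay s a b : 0 < s -> 0 <= a -> a <= b ->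
  is_derive s 1 (fun s => dfct a b (decay s)) (- dfct a b (mul_decay s)).
Proof.
move=> s0 a0 ab; have b0 := le_trans a0 ab.
apply: (@is_derive_quadratic _ s _ (32 / s ^+ 2 * defect_const alpha Q t a b) (s / 2)).
  by rewrite divr_gt0.
move=> h hs.
have sh0 : 0 < s + h.
  have := ler_norm (- h); rewrite normrN; lra.
have [M am] := C_infty_admissible hQ t0 (C_infty_mul_decay s0).
have ad1 := decay_admissible s0; have ad2 := decay_admissible sh0.
have [ad3 _] := admissible_lin 1 (-1) ad2 ad1.
have [ad4 _] := admissible_lin 1 h ad3 am.
have L1 := defect_lin alpha_gt hQ t0 1 (-1) a0 b0 ad2 ad1.
have L2 := defect_lin alpha_gt hQ t0 1 h a0 b0 ad3 am.
rewrite L1 in L2.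
have bd y : E y -> `|1 * (1 * decay (s + h) y + -1 * decay s y) + h * mul_decay s y|
    <= 32 / s ^+ 2 * h ^+ 2.
  move=> /EP y0; rewrite !mul1r mulN1r; apply: decay_taylor => //; exact: ltW.
have := defect_bound alpha_gt hQ t0 a0 ab (admissible_rebound ad4 bd).
rewrite L2 !mul1r !mulN1r mulrN opprK mulrAC.
by [].
Qed.

(** The defect $S(s)$ of $e^{-sy}$ satisfies $sS'=-(\alpha+1)S$, because $Be_s$
    is a combination of $ye_s$ and $e_s$ without defect. So $s^{\alpha+1}S(s)$
    is constant, and it tends to $0$ with $s$ since $S$ is bounded. *)
Lemma defect_decay s a b : 0 < s -> 0 <= a -> a <= b -> dfct a b (decay s) = 0.
Proof.
move=> s0 a0 ab.
pose S s := dfct a b (decay s).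
pose W (u : R) : R := expR ((1 + alpha) * u) * S (expR u).
have dW (u : R) : is_derive u 1 W 0.
  have e0 := expR_gt0 u.
  have d1 := is_derive1_comp (is_derive_defect_decay e0 a0 ab) (is_derive_expR u).
  have d2 : is_derive u 1 (fun u => expR ((1 + alpha) * u))
      ((1 + alpha) * expR ((1 + alpha) * u)).
    by apply: is_derive_eq; rewrite /GRing.scale/= mulr1 mulrC.
  apply: (is_derive_eq (is_deriveM d2 d1)).
  rewrite /GRing.scale/= defect_mul_decay// -/(S (expR u)).
  by field; rewrite gt_eqF.
have WW u v : W u = W v by apply: is_derive_0_is_cst.
pose K := defect_const alpha Q t a b.
have SK r : 0 < r -> `|S r| <= K.
  by move=> r0; have := defect_bound alpha_gt hQ t0 a0 ab (decay_admissible r0); rewrite mul1r.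
have K0 : 0 <= K by apply: le_trans (SK 1 _).
have WK u : `|W u| <= expR ((1 + alpha) * u) * K.
  by rewrite normrM gtr0_norm ?expR_gt0// ler_wpM2l ?expR_ge0// SK ?expR_gt0.
have W0 : W 0 = 0.
  apply/eqP; rewrite -normr_le0 leNgt; apply/negP => W0.
  pose c := `|W 0| / (K + 1).
  have c0 : 0 < c by rewrite divr_gt0// ltr_wpDl.
  pose u := ln c / (1 + alpha).
  have := WK u; rewrite (WW u 0) (_ : (1 + alpha) * u = ln c); last first.
    by rewrite /u; field; rewrite addrC gt_eqF.
  rewrite lnK ?posrE// leNgt => /negP; apply.
  rewrite /c mulrAC ltr_pdivrMr ?ltr_wpDl//.
  by rewrite ltr_pM2l// ltrDl.
have := WW (ln s) 0; rewrite W0 /W lnK ?posrE// => /eqP.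
by rewrite mulf_eq0 gt_eqF ?expR_gt0//= => /eqP.
Qed.

Let power_good (c : R) m : 0 < c -> forall r : R, 0 < r ->
  adm 1 (fun y => decay r y * (1 - decay c y) ^+ m) /\
  forall a b, 0 <= a -> a <= b -> dfct a b (fun y => decay r y * (1 - decay c y) ^+ m) = 0.
Proof.
move=> c0; elim: m => [|m IH] r r0.
  rewrite (_ : (fun y => _) = decay r); last by apply/funext => y; rewrite expr0 mulr1.
  by split; [exact: decay_admissible|move=> a b a0 ab; exact: defect_decay].
have rc0 : 0 < r + c by rewrite addr_gt0.
have [A1 D1] := IH r r0; have [A2 D2] := IH _ rc0.
have E1 : (fun y => decay r y * (1 - decay c y) ^+ m.+1) =
    (fun y => 1 * (decay r y * (1 - decay c y) ^+ m)
       + (-1) * (decay (r + c) y * (1 - decay c y) ^+ m)).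
  by apply/funext => y; rewrite decayD exprS; ring.
have [A3 _] := admissible_lin 1 (-1) A1 A2.
rewrite E1; split.
  apply: admissible_rebound A3 _ => y /EP y0; rewrite -(congr1 (fun f => f y) E1).
  have d0 := decay_ge0 c y; have d1 := decay_le1 (ltW c0) y0.
  rewrite ger0_norm ?mulr_ge0 ?decay_ge0 ?exprn_ge0 ?subr_ge0//.
  rewrite mulr_ile1 ?decay_ge0 ?decay_le1 ?exprn_ge0 ?subr_ge0 ?(ltW r0)//.
  by rewrite exprn_ile1 ?subr_ge0// lerBlDr lerDl.
move=> a b a0 ab.
by rewrite (defect_lin alpha_gt hQ t0 1 (-1) a0 (le_trans a0 ab) A1 A2) D1// D2// !mulr0 addr0.
Qed.

Let gompertz_good (c : R) m : 0 < c ->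
  adm 1 (fun y => 1 - (1 - decay c y) ^+ m.+1) /\
  forall a b, 0 <= a -> a <= b -> dfct a b (fun y => 1 - (1 - decay c y) ^+ m.+1) = 0.
Proof.
move=> c0; elim: m => [|m [A1 D1]].
  rewrite (_ : (fun y => _) = decay c); last by apply/funext => y; rewrite expr1 subKr.
  by split; [exact: decay_admissible|move=> a b a0 ab; exact: defect_decay].
have [A2 D2] := power_good m.+1 c0 c0.
have E1 : (fun y => 1 - (1 - decay c y) ^+ m.+2) =
    (fun y => 1 * (1 - (1 - decay c y) ^+ m.+1)
       + 1 * (decay c y * (1 - decay c y) ^+ m.+1)).
  by apply/funext => y; rewrite [in LHS]exprS; ring.
have [A3 _] := admissible_lin 1 1 A1 A2.
rewrite E1; split.
  apply: admissible_rebound A3 _ => y /EP y0; rewrite -(congr1 (fun f => f y) E1).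
  have d0 := decay_ge0 c y; have d1 := decay_le1 (ltW c0) y0.
  have e0 : 0 <= (1 - decay c y) ^+ m.+2 by rewrite exprn_ge0 ?subr_ge0.
  rewrite ger0_norm ?lerBlDr ?lerDl// subr_ge0.
  by rewrite exprn_ile1 ?subr_ge0// lerBlDr lerDl.
move=> a b a0 ab.
by rewrite (defect_lin alpha_gt hQ t0 1 1 a0 (le_trans a0 ab) A1 A2) D1// D2// !mulr0 addr0.
Qed.

Let bernoulli_le (u : R) m : 0 <= u <= 1 -> 1 - (1 - u) ^+ m <= m%:R * u.
Proof.
move=> /andP[u0 u1]; elim: m => [|m IH]; first by rewrite expr0 subrr mul0r.
have p1 : (1 - u) ^+ m <= 1 by rewrite exprn_ile1 ?subr_ge0// lerBlDr lerDl.
rewrite exprS -natr1; nra.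
Qed.

Let power_le (u : R) m : 0 <= u <= 1 -> 0 < m%:R * u -> (1 - u) ^+ m <= (m%:R * u)^-1.
Proof.
move=> /andP[u0 u1] mu0.
have h1 : 1 - u <= expR (- u) by exact: expR_ge1Dx.
have : (1 - u) ^+ m <= expR (- u) ^+ m by rewrite lerXn2r ?nnegrE ?subr_ge0 ?expR_ge0.
move=> /le_trans; apply; rewrite -expRM_natl mulrN expRN.
by rewrite lef_pV2 ?posrE ?expR_gt0// (le_trans _ (expR_ge1Dx _))// lerDr.
Qed.

(** With $m\approx Ne^{Nc}$ the double exponential $1-(1-e^{-Ny})^m$ tends
    to the indicator of $[0,c]$ as $N\to\infty$. *)
Let gompertz_cvg c y : 0 < c -> 0 <= y ->
  1 - (1 - decay n.+1%:R y) ^+ (Num.trunc (n.+1%:R * expR (n.+1%:R * c))).+1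
    @[n --> \oo] --> (\1_(`[0, c]%classic) y : R).
Proof.
move=> c0 y0.
suff [C C0 H] : exists2 C : R, 0 < C & forall n : nat,
   `|(\1_(`[0, c]%classic) y : R) - (1 - (1 - decay n.+1%:R y) ^+
      (Num.trunc (n.+1%:R * expR (n.+1%:R * c))).+1)| <= C / n.+1%:R.
  apply/cvgrPdist_le => e e0; near=> n.
  rewrite (le_trans (H n))// ler_pdivrMr ?ltr0n// mulrC -ler_pdivrMr//.
  rewrite (@le_trans _ _ n%:R) ?ler_nat//.
  by near: n; exact: nbhs_infty_ger.
have [yc|cy] := leP y c.
  exists 1 => // n; set m := (Num.trunc _).+1.
  rewrite indicE mem_set; last by rewrite /= in_itv/= y0.
  have n0 : 0 < n.+1%:R :> R by rewrite ltr0n.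
  have u01 : 0 <= decay n.+1%:R y <= 1 by rewrite decay_ge0 decay_le1// ltW.
  rewrite subKr ger0_norm; last by rewrite exprn_ge0// subr_ge0; case/andP: u01.
  have mN : n.+1%:R * expR (n.+1%:R * c) <= m%:R by rewrite ltW// truncnS_gt.
  have Nm : n.+1%:R <= m%:R * decay n.+1%:R y.
    rewrite (le_trans _ (ler_wpM2r (decay_ge0 _ _) mN))//.
    by rewrite -mulrA ler_peMr ?(ltW n0)// /decay -expRD -expR0 ler_expR subr_ge0 ler_pM2l.
  rewrite (le_trans (power_le u01 _)) ?(lt_le_trans n0)//.
  by rewrite mul1r lef_pV2 ?posrE ?(lt_le_trans n0).
pose d := y - c; have d0 : 0 < d by rewrite subr_gt0.
exists (8 / d ^+ 2) => [|n]; first by rewrite divr_gt0// exprn_gt0.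
set m := (Num.trunc _).+1.
rewrite indicE memNset; last by rewrite /= in_itv/= y0/= => /(lt_le_trans cy); rewrite ltxx.
have n0 : 0 < n.+1%:R :> R by rewrite ltr0n.
have u01 : 0 <= decay n.+1%:R y <= 1 by rewrite decay_ge0 decay_le1// ltW.
have p0 : 0 <= (1 - decay n.+1%:R y) ^+ m <= 1.
  have /andP[u0 u1] := u01.
  by rewrite exprn_ge0 ?subr_ge0// exprn_ile1 ?subr_ge0// lerBlDr lerDl.
rewrite sub0r normrN ger0_norm; last by rewrite subr_ge0; case/andP: p0.
rewrite (le_trans (bernoulli_le _ u01))//.
have e1 : 1 <= n.+1%:R * expR (n.+1%:R * c).
  rewrite -[leLHS]mulr1 ler_pM ?ler1n//.
  by rewrite -expR0 ler_expR mulr_ge0 ?(ltW n0) ?(ltW c0).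
have mN : m%:R <= 2 * (n.+1%:R * expR (n.+1%:R * c)).
  have := e1; rewrite /m; set w := n.+1%:R * expR (n.+1%:R * c) => w1.
  have : (Num.trunc w)%:R <= w by rewrite truncn_le// (le_trans ler01).
  by rewrite -[(Num.trunc w).+1%:R]natr1 => ?; lra.
rewrite (le_trans (ler_wpM2r (decay_ge0 _ _) mN))//.
have -> : 2 * (n.+1%:R * expR (n.+1%:R * c)) * decay n.+1%:R y =
    2 * (n.+1%:R * decay d n.+1%:R).
  by rewrite /decay -!mulrA -expRD; congr (_ * (_ * expR _)); rewrite /d; ring.
rewrite (le_trans (ler_wpM2l _ (mul_decay_le d0 (ltW n0))))//.
have : decay (d / 2) n.+1%:R <= (d / 2 * n.+1%:R)^-1.
  have p : 0 < d / 2 * n.+1%:R by rewrite mulr_gt0// divr_gt0.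
  rewrite /decay expRN lef_pV2 ?posrE ?expR_gt0//.
  by rewrite (le_trans _ (expR_ge1Dx _))// lerDr.
move=> h; rewrite mulrA (le_trans (ler_wpM2l _ h))//.
  by rewrite mulr_ge0// divr_ge0// ltW.
by rewrite le_eqVlt; apply/orP; left; apply/eqP; field; rewrite !gt_eqF.
Unshelve. all: by end_near. Qed.

Let segment_good c : 0 < c -> adm 1 (\1_(`[0, c]%classic) : R -> R) /\
  forall a b, 0 <= a -> a <= b -> dfct a b (\1_(`[0, c]%classic) : R -> R) = 0.
Proof.
move=> c0.
pose f n y : R := 1 - (1 - decay n.+1%:R y) ^+ (Num.trunc (n.+1%:R * expR (n.+1%:R * c))).+1.
have fg n := gompertz_good (Num.trunc (n.+1%:R * expR (n.+1%:R * c))) (ltr0Sn R n).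
have fa n : adm 1 (f n) by have [] := fg n.
have cf y : E y -> f n y @[n --> \oo] --> (\1_(`[0, c]%classic) y : R).
  by move=> /EP y0; exact: gompertz_cvg.
have [ad _] := admissible_cvg fa cf.
split=> // a b a0 ab.
have := defect_cvg alpha_gt hQ t0 a0 (le_trans a0 ab) fa cf.
rewrite (_ : (fun n => _) = cst 0) => [/cvg_lim <-//|]; first by rewrite lim_cst.
by apply/funext => n; have [_ ->] := fg n.
Qed.

(** With $A$ the averaging operator and $\Phi g=\int_0^{\cdot}Ag$, the relation
    says that $e^tQ_t\Phi g$ is a primitive of $AQ_tg$. Only increments are
    compared, as only they enter the determinant of the link. *)
Lemma laguerre_intertwining c d : 0 < c -> c <= d ->
  adm 1 (\1_(`]c, d]%classic) : R -> R) /\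
  forall a b, 0 <= a -> a <= b ->
    avg_int alpha a b (T \1_(`]c, d]%classic)) =
    expR t * (T (Phi \1_(`]c, d]%classic)) b - T (Phi \1_(`]c, d]%classic)) a).
Proof.
move=> c0 cd; have [A1 D1] := segment_good c0.
have [A2 D2] := segment_good (lt_le_trans c0 cd).
have E1 : (\1_(`]c, d]%classic) : R -> R) =
    (fun y => 1 * \1_(`[0, d]%classic) y + (-1) * \1_(`[0, c]%classic) y).
  apply/funext => y; rewrite !indicE !mem_setE !in_itv/=.
  have [y0|y0] := leP 0 y; have [yc|cy] := leP y c; have [yd|dy] := leP y d => //=;
    rewrite ?(mulr1, mulr0, mul1r, subrr, addr0, mulN1r, add0r, subr0)//.
  - by have := le_lt_trans yc (le_lt_trans cd dy); rewrite ltxx.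
  - by have := lt_trans y0 (lt_trans c0 cy); rewrite ltxx.
have [A3 _] := admissible_lin 1 (-1) A2 A1.
split.
  apply: (@admissible_rebound (`|1| * 1 + `|-1| * 1)).
    by rewrite E1.
  by move=> y _; rewrite indicE; case: (_ \in _); rewrite ?normr0 ?normr1.
move=> a b a0 ab; apply/eqP; rewrite eq_sym -subr_eq0; apply/eqP.
have := defect_lin alpha_gt hQ t0 1 (-1) a0 (le_trans a0 ab) A2 A1.
by rewrite -E1 D1// D2// !mulr0 addr0.
Qed.

End intertwining2.

(** * Integration of products and determinants on $\mathbb R^n$ *)

Section product_integrals.
Context (R : realType).
Local Notation mu := (@lebesgue_measure R).
Local Notation lam n := (@lebesgue_row R n).

Lemma integrable_prod2 d1 d2 (T1 : measurableType d1) (T2 : measurableType d2)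
    (m1 : {sigma_finite_measure set T1 -> \bar R})
    (m2 : {sigma_finite_measure set T2 -> \bar R}) (f : T1 -> R) (g : T2 -> R) :
  m1.-integrable setT (EFin \o f) -> m2.-integrable setT (EFin \o g) ->
  (m1 \x m2)%E.-integrable setT (EFin \o (fun p => f p.1 * g p.2)) /\
  (\int[m1 \x m2]_p (f p.1 * g p.2)%:E =
   (\int[m1]_x f x * \int[m2]_y g y)%:E)%E.
Proof.
move=> If Ig.
have mf : measurable_fun setT f by apply/measurable_EFinP; exact: measurable_int If.
have mg : measurable_fun setT g by apply/measurable_EFinP; exact: measurable_int Ig.
have I : (m1 \x m2)%E.-integrable setT (EFin \o (fun p => f p.1 * g p.2)).
  apply/integrable12ltyP.
    apply/measurable_EFinP; apply: measurable_funM.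
      exact: (measurableT_comp mf measurable_fst).
    exact: (measurableT_comp mg measurable_snd).
  rewrite (_ : (fun x => _) = (fun x => (\int[m2]_y `|g y|)%:E * `|f x|%:E)%E).
    rewrite integralZl//; last exact: integrable_normr.
    rewrite -[X in (_ * X)%E]fineK ?ltry//.
    exact: (integrable_fin_num _ (integrable_normr _ If)).
  apply/funext => x; rewrite /Rintegral fineK; last first.
    exact: (integrable_fin_num _ (integrable_normr _ Ig)).
  rewrite muleC -integralZl//; last exact: integrable_normr.
  by apply: eq_integral => y _; rewrite /= normrM EFinM.
split => //.
rewrite -(integral12_prod_meas1 I) /fubini_F /=.
transitivity (\int[m1]_x ((\int[m2]_y g y)%:E * (f x)%:E))%E.
  apply: eq_integral => x _; rewrite /Rintegral fineK; last exact: (integrable_fin_num _ Ig).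
  by rewrite muleC -integralZl.
rewrite integralZl// EFinM muleC; congr (_ * _)%E.
by rewrite /Rintegral fineK//; exact: (integrable_fin_num _ If).
Qed.

Lemma prod_integrable n (h : 'I_n -> R -> R) :
  (forall i, mu.-integrable setT (EFin \o h i)) ->
  (lam n).-integrable setT (EFin \o (fun x : 'rV[R]_n => \prod_(i < n) h i (x ord0 i))) /\
  \int[lam n]_x (\prod_(i < n) h i (x ord0 i)) = \prod_(i < n) \int[mu]_u h i u.
Proof.
elim: n h => [|n IH] h Ih.
  have E0 : (fun x : 'rV[R]_0 => \prod_(i < 0) h i (x ord0 i)) = (fun=> 1).
    by apply/funext => x; rewrite big_ord0.
  rewrite E0 big_ord0; split.
    by apply: finite_cst_integrable => //; rewrite /= diracT ltry.
  transitivity (1 * fine (lam 0 setT)); first exact: Rintegral_cst.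
  by rewrite mul1r -[RHS]/(fine (1%:E)); congr fine; exact: diracT.
have [I1 E1] := IH (fun i => h (lift ord0 i)) (fun i => Ih _).
have [I2 E2] := integrable_prod2 (Ih ord0) I1.
pose F (x : 'rV[R]_n.+1) := \prod_(i < n.+1) h i (x ord0 i).
have FE p : F (row_cons p) = h ord0 p.1 * \prod_(i < n) h (lift ord0 i) (p.2 ord0 i).
  rewrite /F big_ord_recl row_cons0; congr (_ * _).
  by apply: eq_bigr => i _; rewrite row_consS.
have mF : measurable_fun setT F.
  apply: measurable_prod => i _; apply: measurableT_comp (measurable_row_coord i).
  by apply/measurable_EFinP; exact: measurable_int (Ih i).
have I3 : (mu \x lam n)%E.-integrable setT ((EFin \o F) \o (@row_cons R n)).
  by apply: eq_integrable I2 => // p _ /=; rewrite FE.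
have mEF : measurable_fun setT (EFin \o F) by exact/measurable_EFinP.
have mrc : measurable_fun [set: measurableTypeR R * 'rV[R]_n] (@row_cons R n).
  exact: measurable_row_cons.
split.
  exact: (integrable_pushforward mrc mEF I3 measurableT).
transitivity (fine (\int[pushforward (mu \x lam n)%E (@row_cons R n)]_x (F x)%:E)%E).
  by [].
rewrite (integral_pushforward mrc mEF I3)// preimage_setT.
rewrite big_ord_recl -E1 -[RHS]/(fine (_%:E)) -E2; congr fine.
by apply: eq_integral => p _ /=; rewrite FE.
Qed.

End product_integrals.

(** * Andréief's identity on the chamber *)

Section andreief.
Context (R : realType).
Local Notation mu := (@lebesgue_measure R).
Local Notation lam n := (@lebesgue_row R n).

Lemma det_integrable n (m : 'I_n -> 'I_n -> R -> R) :
  (forall i j, mu.-integrable setT (EFin \o m i j)) ->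
  (lam n).-integrable setT
    (EFin \o (fun y : 'rV[R]_n => \det (\matrix_(i, j) m i j (y ord0 i)))) /\
  \int[lam n]_y (\det (\matrix_(i, j) m i j (y ord0 i))) =
  \det (\matrix_(i, j) \int[mu]_u m i j u).
Proof.
move=> Im.
have Is (s : 'S_n) := prod_integrable (fun i => Im i (s i)).
have [I1 E1] := Rintegral_sum (index_enum _) xpredT measurableT
  (fun s : {perm 'I_n} => integrableZl_real ((-1) ^+ s) measurableT (Is s).1).
have DE : (fun y : 'rV[R]_n => \det (\matrix_(i, j) m i j (y ord0 i))) =
    (fun y => \sum_(s : {perm 'I_n}) (-1) ^+ s * \prod_(i < n) m i (s i) (y ord0 i)).
  apply/funext => y; apply: eq_bigr => s _; congr (_ * _).
  by apply: eq_bigr => i _; rewrite mxE.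
rewrite DE; split; first exact: I1.
rewrite E1; apply: eq_bigr => s _.
rewrite RintegralZl//; last exact: (Is s).1.
rewrite (Is s).2; congr (_ * _).
by apply: eq_bigr => i _; rewrite mxE.
Qed.

Definition row_box n : set (set 'rV[R]_n) :=
  [set B | exists2 A : 'I_n -> set R, (forall i, measurable (A i)) &
     B = [set x : 'rV[R]_n | forall i, A i (x ord0 i)]].

Lemma row_box_measurable n (B : set 'rV[R]_n) : row_box B -> measurable B.
Proof.
case=> A mA ->.
rewrite (_ : [set _ | _] = \bigcap_(i in [set: 'I_n])
    ((fun x : 'rV[R]_n => x ord0 i) @^-1` A i)); last first.
  by apply/seteqP; split => x /= Ax i => [_|]; exact: Ax.
apply: fin_bigcap_measurable => // i _.
by rewrite -[X in measurable X]setTI; exact: measurable_row_coord.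
Qed.

Lemma measurable_row_boxE n :
  (measurable : set (set 'rV[R]_n)) = <<s (@row_box n) >>.
Proof.
apply/seteqP; split.
  apply: smallest_sub; first exact: smallest_sigma_algebra.
  move=> A; rewrite -bigcup_seq/= => -[i _ [B mB <-]].
  apply: sub_sigma_algebra; rewrite setTI.
  exists (fun j => if j == i then B else setT) => [j|].
    by case: ifP.
  apply/seteqP; split => x /= => [Bx j|/(_ i)]; last by rewrite eqxx.
  by case: eqP => // ->.
apply: smallest_sub => [|B /row_box_measurable//].
exact: sigma_algebra_measurable.
Qed.

Lemma measurable_col_perm n (s : 'S_n) :
  measurable_fun [set: 'rV[R]_n] (@col_perm R 1 n s).
Proof.
apply: measurable_fun_row => i.
rewrite (_ : (fun t => _) = (fun x : 'rV[R]_n => x ord0 (s i))).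
  exact: measurable_row_coord.
by apply/funext => x; rewrite mxE.
Qed.

(** The boxes form a $\pi$-system that generates the Borel sets, and permuting
    the sides of a box does not change its volume. *)
Lemma lebesgue_row_perm n (s : 'S_n) (A : set 'rV[R]_n) : measurable A ->
  lam n (@col_perm R 1 n s @^-1` A) = lam n A.
Proof.
move=> mA.
have boxE (C : 'I_n -> set R) : (forall i, measurable (C i)) ->
    lam n [set x | forall i, C i (x ord0 i)] = (\prod_(i < n) mu (C i))%E.
  exact: lebesgue_row_box.
pose g k : set 'rV[R]_n := [set x | forall i, `[- k%:R, k%:R]%classic (x ord0 i)].
suff H : pushforward (lam n) (@col_perm R 1 n s) A = lam n A by [].
apply: (measure_unique (@row_box n) g) => //.
- exact: measurable_row_boxE.
- move=> _ _ [B mB ->] [C mC ->]; exists (fun i => B i `&` C i) => [i|].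
    exact: measurableI.
  apply/seteqP; split => x /= => [[Bx Cx] i|H]; first by split.
  by split => i; have [] := H i.
- by move=> k; exists (fun=> `[- k%:R, k%:R]%classic) => [i|]//; exact: measurable_itv.
- rewrite -subTset => x _.
  pose M : R := \sum_i `|x ord0 i|.
  exists (Num.trunc M).+1 => // i /=; rewrite in_itv/= -ler_norml.
  apply: (@le_trans _ _ M).
    by rewrite /M (bigD1 i)//= lerDl sumr_ge0.
  by rewrite ltW// truncnS_gt.
- exact: measurable_col_perm.
- move=> ms _ [B mB ->] /=; rewrite /pushforward.
  rewrite (_ : _ @^-1` _ =
      [set x : 'rV[R]_n | forall i, B (s^-1%g i) (x ord0 i)]); last first.
    apply/seteqP; split => x /= H i.
      by have := H (s^-1%g i); rewrite mxE permKV.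
    by rewrite mxE; have := H (s i); rewrite permK.
  transitivity (\prod_(i < n) mu (B (s^-1%g i)))%E; first exact: boxE.
  rewrite boxE// (reindex_inj (@perm_inj _ s)).
  by apply: eq_bigr => i _; rewrite permK.
- move=> ms k; rewrite /= /pushforward.
  rewrite (_ : _ @^-1` _ = g k); last first.
    apply/seteqP; split => x /= H i.
      by have := H (s^-1%g i); rewrite mxE permKV.
    by rewrite mxE; exact: H.
  rewrite /g [X in (X < _)%E](boxE (fun=> `[- k%:R, k%:R]%classic)); last first.
    by move=> i; exact: measurable_itv.
  rewrite ltey_eq prode_fin_num// => i _.
  by rewrite /= lebesgue_measure_itv/=; case: ifP.
Qed.

Lemma increasing_ord_ge n (h : 'I_n -> 'I_n) :
  {homo h : i j / (i < j)%N >-> (i < j)%N} -> forall i : 'I_n, (i <= h i)%N.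
Proof.
move=> hh [i]; elim: i => [//|i IH] lt_i.
have := hh (Ordinal (ltnW lt_i)) (Ordinal lt_i) (leqnn _).
exact: leq_ltn_trans (IH _).
Qed.

Lemma perm_increasing_id n (s : 'S_n) :
  {homo s : i j / (i < j)%N >-> (i < j)%N} -> s = 1%g.
Proof.
move=> hs; apply/permP => i; rewrite perm1; apply/val_inj/anti_leq.
rewrite (increasing_ord_ge hs) andbT -{2}(permK s i); apply: increasing_ord_ge.
move=> a b ab; case: (ltngtP (s^-1%g a) (s^-1%g b)) => // [/hs|/val_inj].
  by rewrite !permKV ltnNge ltnW.
by move=> /perm_inj E; rewrite E ltnn in ab.
Qed.

Lemma perm_inversion n (s : 'S_n) : s != 1%g ->
  exists i j : 'I_n, (i < j)%N /\ (s j < s i)%N.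
Proof.
move=> s1; apply: contrapT => H; move/eqP: s1; apply.
apply: perm_increasing_id => i j ij.
have [//|ji|/val_inj/perm_inj E] := ltngtP (s i) (s j).
  by exfalso; apply: H; exists i, j.
by rewrite E ltnn in ij.
Qed.

Definition increasing_row n : set 'rV[R]_n :=
  [set y | forall i j : 'I_n, (i < j)%N -> y ord0 i < y ord0 j].
Arguments increasing_row : clear implicits.

Lemma measurable_true_set n (b : 'rV[R]_n -> bool) :
  measurable_fun setT b -> measurable [set y | b y].
Proof.
move=> mb; have := mb measurableT [set true] I.
by rewrite setTI.
Qed.

Lemma increasing_row_measurable n : measurable (increasing_row n).
Proof.
rewrite (_ : increasing_row n = \bigcap_(i in [set: 'I_n]) \bigcap_(j in [set: 'I_n])
    [set y : 'rV[R]_n | (i < j)%N ==> (y ord0 i < y ord0 j)]); last first.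
  apply/seteqP; split => y /= Hy i => [_ j _ /=|j ij].
    by apply/implyP; exact: Hy.
  by have := Hy i I j I; rewrite /= ij.
apply: fin_bigcap_measurable => // i _; apply: fin_bigcap_measurable => // j _.
case: (i < j)%N => /=; last by rewrite (_ : [set _ | _] = setT)//; exact/seteqP.
exact: measurable_true_set (measurable_fun_ltr (measurable_row_coord i) (measurable_row_coord j)).
Qed.

Lemma weyl_interior_measurable n : measurable (weyl_interior n : set 'rV[R]_n).
Proof.
rewrite (_ : weyl_interior n = (\bigcap_(i in [set: 'I_n]) [set y : 'rV[R]_n | 0 < y ord0 i])
    `&` increasing_row n); last first.
  by apply/seteqP; split => y [Hy yI]; split => // i *; exact: Hy.
apply: measurableI; last exact: increasing_row_measurable.
apply: fin_bigcap_measurable => // i _.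
exact: measurable_true_set (measurable_fun_ltr (measurable_cst _) (measurable_row_coord i)).
Qed.

Lemma exists_increasing_perm n (y : 'rV[R]_n) : injective (y ord0) ->
  exists s : 'S_n, increasing_row n (col_perm s y).
Proof.
move=> yI; pose t := [tuple y ord0 i | i < n].
have /tuple_permP[s Es] : perm_eq (sort <=%O t) t by rewrite perm_sort.
exists s => i j ij; rewrite !mxE lt_neqAle.
have nth_s (k : 'I_n) : y ord0 (s k) = nth 0 (sort <=%O t) k.
  by rewrite Es -tnth_nth !tnth_mktuple.
apply/andP; split.
  by apply/eqP => /yI /perm_inj E; rewrite E ltnn in ij.
rewrite !nth_s; apply: le_sorted_leq_nth; rewrite ?sort_le_sorted// ?inE ?size_sort ?size_tuple//.
exact: ltnW.
Qed.

Lemma increasing_perm_uniq n (y : 'rV[R]_n) (s1 s2 : 'S_n) :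
  increasing_row n (col_perm s1 y) -> increasing_row n (col_perm s2 y) -> s1 = s2.
Proof.
move=> y1 y2; apply/eqP; rewrite eq_sym eq_mulgV1; apply/eqP.
apply: perm_increasing_id => i j ij; rewrite !permM.
have {}y2 := y2 _ _ ij; rewrite !mxE in y2.
rewrite ltnNge leq_eqVlt; apply/negP => /orP[/eqP/val_inj/perm_inj E|/y1].
  by rewrite E ltxx in y2.
by rewrite !mxE !permKV; move: y2 => /ltW; rewrite leNgt => /negP.
Qed.

Lemma lebesgue_row_perm_integral n (s : 'S_n) D (F : 'rV[R]_n -> R) :
  measurable D -> (lam n).-integrable setT (EFin \o F) ->
  (lam n).-integrable D (EFin \o (F \o @col_perm R 1 n s)) /\
  \int[lam n]_(y in D) F (col_perm s y) =
  \int[lam n]_(y in @col_perm R 1 n s^-1%g @^-1` D) F y.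
Proof.
move=> mD IF; have mphi := @measurable_col_perm n s^-1%g.
have mF : measurable_fun setT (EFin \o (F \o @col_perm R 1 n s)).
  exact: measurableT_comp (measurable_int _ IF) (measurable_col_perm s).
have E A : measurable A -> lam n A = pushforward (lam n) (@col_perm R 1 n s^-1%g) A.
  by move=> mA; rewrite /pushforward lebesgue_row_perm.
have FE : (EFin \o (F \o @col_perm R 1 n s)) \o @col_perm R 1 n s^-1%g = EFin \o F.
  apply/funext => y /=; congr (F _)%:E; apply/rowP => i.
  by rewrite !mxE permK.
have IF' : (lam n).-integrable (@col_perm R 1 n s^-1%g @^-1` D)
    ((EFin \o (F \o @col_perm R 1 n s)) \o @col_perm R 1 n s^-1%g).
  rewrite FE; apply: integrableS IF => //.
  by rewrite -[X in measurable X]setTI; exact: mphi.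
split.
  apply/integrableP; split; first exact: measurable_funTS.
  have /integrableP[_] := integrable_pushforward mphi mF IF' mD.
  apply: le_lt_trans; rewrite le_eqVlt; apply/orP; left; apply/eqP.
  by apply: eq_measure_integral => A mA _; exact: E.
rewrite /Rintegral; congr fine.
transitivity (\int[lam n]_(y in @col_perm R 1 n s^-1%g @^-1` D)
  ((EFin \o (F \o @col_perm R 1 n s)) \o @col_perm R 1 n s^-1%g) y)%E; last by rewrite FE.
rewrite -(integral_pushforward mphi mF IF' mD).
by apply: eq_measure_integral => A mA _; exact: E.
Qed.

(** A point with distinct coordinates is sorted by exactly one permutation, so
    the images of the open chamber tile the space up to points where the
    integrand vanishes. *)
Lemma fold_integral n (F : 'rV[R]_n -> R) :
  (lam n).-integrable setT (EFin \o F) ->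
  (forall y : 'rV[R]_n, ~ injective (y ord0) -> F y = 0) ->
  (lam n).-integrable (increasing_row n)
    (EFin \o (fun y => \sum_(s : {perm 'I_n}) F (col_perm s y))) /\
  \int[lam n]_(y in increasing_row n) (\sum_(s : {perm 'I_n}) F (col_perm s y)) =
  \int[lam n]_y F y.
Proof.
move=> IF F0.
have mW := @increasing_row_measurable n.
have Is (s : 'S_n) := lebesgue_row_perm_integral s mW IF.
have [I1 E1] := Rintegral_sum (index_enum _) xpredT mW (fun s : {perm 'I_n} => (Is s).1).
split; first exact: I1.
pose C (s : 'S_n) := @col_perm R 1 n s^-1%g @^-1` increasing_row n.
have mC s : measurable (C s).
  by rewrite -[C s]setTI; exact: measurable_col_perm.
transitivity (\sum_(s : {perm 'I_n}) \int[lam n]_y (F \_ (C s)) y).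
  rewrite E1; apply: eq_bigr => s _.
  by rewrite (Is s).2 Rintegral_mkcond.
have IC (s : 'S_n) : (lam n).-integrable setT (EFin \o (F \_ (C s))).
  rewrite -restrict_EFin; apply/(integrable_mkcond _ (mC s)).
  exact: integrableS IF.
rewrite -(Rintegral_sum _ _ measurableT IC).2.
apply: eq_Rintegral => y _.
have [/exists_increasing_perm[s ys]|yN] := pselect (injective (y ord0)); last first.
  by rewrite F0// big1// => s _; rewrite patchE; case: ifP => // _; exact: F0.
rewrite (bigD1 s^-1%g)//= patchE mem_set/=; last by rewrite /C/= invgK.
rewrite big1 ?addr0// => s' s's; rewrite patchE memNset// => Cs'.
move/eqP: s's; apply; rewrite (increasing_perm_uniq ys Cs').
by rewrite invgK.
Qed.

Lemma weyl_measurable n : measurable (weyl n : set 'rV[R]_n).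
Proof.
rewrite (_ : weyl n = \bigcap_(i in [set: 'I_n]) ([set y : 'rV[R]_n | 0 <= y ord0 i] `&`
    \bigcap_(j in [set: 'I_n]) [set y : 'rV[R]_n | (i < j)%N ==> (y ord0 i <= y ord0 j)])); last first.
  apply/seteqP; split => [y [y0 Hy] i _ /=|y Hy].
    by split => // j _; apply/implyP; exact: Hy.
  split => [i|i j ij]; first by have [] := Hy i I.
  by have [_ /(_ j I)/=] := Hy i I; rewrite ij.
apply: fin_bigcap_measurable => // i _; apply: measurableI.
  exact: measurable_true_set (measurable_fun_ler (measurable_cst _) (measurable_row_coord i)).
apply: fin_bigcap_measurable => // j _.
case: (i < j)%N => /=; last by rewrite (_ : [set _ | _] = setT)//; exact/seteqP.
exact: measurable_true_set (measurable_fun_ler (measurable_row_coord i) (measurable_row_coord j)).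
Qed.

Lemma det_row_scale n (c : 'I_n -> R) (A : 'M[R]_n) :
  \det (\matrix_(i, j) (c i * A i j)) = \prod_i c i * \det A.
Proof.
rewrite (_ : \matrix_(i, j) _ = diag_mx (\row_i c i) *m A); last first.
  by apply/matrixP => i j; rewrite mul_diag_mx !mxE.
by rewrite det_mulmx det_diag; congr (_ * _); apply: eq_bigr => i _; rewrite mxE.
Qed.

Lemma det_eq_coord n (a : 'I_n -> R -> R) (y : 'rV[R]_n) (i j : 'I_n) :
  i != j -> y ord0 i = y ord0 j -> \det (\matrix_(k, l) a l (y ord0 k)) = 0.
Proof.
by move=> ij E; apply: (determinant_alternate ij) => k; rewrite !mxE E.
Qed.

(** The integral of $\prod_ia_i(y_i)\det[b_j(y_i)]$ over the whole space is the
    determinant on the right. Folding it onto the chamber restores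
    $\det[a_j(y_i)]$, since permuting the coordinates only changes the sign of
    $\det[b_j(y_i)]$. *)
Lemma andreief n (a b : 'I_n -> R -> R) :
  (forall i u, u <= 0 -> a i u = 0) ->
  (forall i j, mu.-integrable setT (EFin \o (fun u => a i u * b j u))) ->
  (lam n).-integrable (weyl_interior n) (EFin \o (fun y : 'rV[R]_n =>
     \det (\matrix_(i, j) a j (y ord0 i)) * \det (\matrix_(i, j) b j (y ord0 i)))) /\
  \int[lam n]_(y in weyl_interior n)
     (\det (\matrix_(i, j) a j (y ord0 i)) * \det (\matrix_(i, j) b j (y ord0 i))) =
  \det (\matrix_(i, j) \int[mu]_u (a i u * b j u)).
Proof.
move=> a0 Iab.
have [IG EG] := det_integrable Iab.
pose G (y : 'rV[R]_n) := \det (\matrix_(i, j) (a i (y ord0 i) * b j (y ord0 i))).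
have GE y : G y = \prod_i a i (y ord0 i) * \det (\matrix_(i, j) b j (y ord0 i)).
  by rewrite -det_row_scale; congr (\det _); apply/matrixP => i j; rewrite !mxE.
have G0 (y : 'rV[R]_n) : ~ injective (y ord0) -> G y = 0.
  move=> yN; rewrite GE; apply/eqP; rewrite mulf_eq0; apply/orP; right; apply/eqP.
  have [[i [j [ij E]]]|H] := pselect (exists i j : 'I_n, i != j /\ y ord0 i = y ord0 j).
    exact: det_eq_coord ij E.
  exfalso; apply: yN => i j E; apply/eqP/negPn/negP => ij; apply: H.
  by exists i, j.
have [IF EF] := fold_integral IG G0.
have SE (y : 'rV[R]_n) : \sum_(s : {perm 'I_n}) G (col_perm s y) =
    \det (\matrix_(i, j) a j (y ord0 i)) * \det (\matrix_(i, j) b j (y ord0 i)).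
  rewrite -(det_tr (\matrix_(i, j) a j _)) [\det (_ ^T)]/determinant mulr_suml.
  apply: eq_bigr => s _; rewrite GE.
  rewrite (_ : (\matrix_(i, j) b j (col_perm s y ord0 i)) =
      row_perm s (\matrix_(i, j) b j (y ord0 i))); last first.
    by apply/matrixP => i j; rewrite !mxE.
  rewrite row_permE det_mulmx det_perm mulrA [in LHS](mulrC (\prod_i _)).
  by congr (_ * _ * _); apply: eq_bigr => i _; rewrite !mxE.
set F := (fun y : 'rV[R]_n => _ * _).
have FE : F \_ (weyl_interior n) =
    (fun y => \sum_(s : {perm 'I_n}) G (col_perm s y)) \_ (increasing_row n).
  apply/funext => y; rewrite !patchE SE -/(F y).
  have [yW|yW] := boolP (y \in weyl_interior n).
    by rewrite mem_set//; have [] := set_mem yW.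
  have [yI|//] := boolP (y \in increasing_row n).
  apply/esym/eqP; rewrite mulf_eq0; apply/orP; left; apply/eqP.
  have [[i yi]|H] := pselect (exists i : 'I_n, y ord0 i <= 0).
    rewrite (expand_det_row _ i) big1// => j _.
    by rewrite mxE a0// mul0r.
  exfalso; move/negP: yW => []; apply/mem_set; split => [i|]; last exact: (set_mem yI).
  by rewrite ltNge; apply/negP => yi; apply: H; exists i.
split.
  apply/(integrable_mkcond _ (@weyl_interior_measurable n)); rewrite restrict_EFin FE -restrict_EFin.
  by apply/(integrable_mkcond _ (@increasing_row_measurable n)).
by rewrite Rintegral_mkcond FE -Rintegral_mkcond EF EG.
Qed.

(** The faces $y_i=0$ of the chamber are null, and the diagonals carry no mass
    as soon as the density vanishes there. *)
Lemma integral_weyl_interior n (A : set 'rV[R]_n) (rho : 'rV[R]_n -> R) :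
  measurable A -> measurable_fun (weyl n) rho ->
  (forall y, weyl n y -> ~ increasing_row n y -> rho y = 0) ->
  (\int[lam n]_(y in A `&` weyl n) (rho y)%:E =
   \int[lam n]_(y in A `&` weyl_interior n) (rho y)%:E)%E.
Proof.
move=> mA mrho rho0.
have mAW : measurable (A `&` weyl n) by apply: measurableI => //; exact: weyl_measurable.
have sub : weyl_interior n `<=` (weyl n : set 'rV[R]_n).
  by move=> y [y0 yI]; split => [i|i j ij]; [exact: ltW|exact/ltW/yI].
rewrite (_ : A `&` weyl_interior n = (A `&` weyl n) `&` weyl_interior n); last first.
  by rewrite -setIA; congr (_ `&` _); apply/esym/setIidr.
rewrite [RHS]integral_mkcondr; apply: ae_eq_integral => //.
- by apply/measurable_EFinP; apply: measurable_funS mrho => //; exact: weyl_measurable.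
- apply/(measurable_restrict _ (@weyl_interior_measurable n) mAW).
  apply/measurable_EFinP; apply: measurable_funS mrho; first exact: weyl_measurable.
  by move=> y [[]].
pose Z i : set 'rV[R]_n := [set y | y ord0 i = 0].
have Z0 i : (lam n).-negligible (Z i).
  have mZ : measurable (Z i).
    rewrite (_ : Z i = (fun y : 'rV[R]_n => y ord0 i) @^-1` [set 0])//.
    by rewrite -[X in measurable X]setTI; exact: measurable_row_coord.
  exists (Z i); split => //.
  transitivity (\prod_(j < n) mu ((if j == i then [set 0%R] else setT) : set R))%E.
    rewrite -(@lebesgue_row_box R n (fun j => if j == i then [set 0%R] else setT)); last first.
      by move=> j; case: ifP.
    congr (lam n _); apply/seteqP; split => y /= => [yi j|/(_ i)]; last by rewrite eqxx.
    by case: eqP => // ->.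
  by rewrite (bigD1 i)//= eqxx lebesgue_measure_set1 mul0e.
have : (lam n).-negligible (\big[setU/set0]_(i < n) Z i).
  by elim/big_ind : _ => // [|*]; [exact: negligible_set0|exact: negligibleU].
apply: negligibleS => y /= /not_implyP[[_ yW]]; rewrite patchE.
case: ifPn => // /negP yI neq0; apply: contrapT => yZ; apply: yI; apply/mem_set.
have yI : increasing_row n y.
  by apply: contrapT => /(rho0 _ yW) E; apply: neq0; rewrite E.
split => // i; have [y0 _] := yW; rewrite lt_neqAle y0 andbT.
apply/negP => /eqP yi; apply: yZ; rewrite -bigcup_seq/=.
by exists i => //=; exact: mem_index_enum.
Qed.

End andreief.
Arguments increasing_row {R} n.

(** * The density of the link as a determinant *)

Section power_mass.
Context (R : realType) (alpha : R) (alpha_gt : -1 < alpha).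
Local Notation mu := (@lebesgue_measure R).
Local Notation W := (fun c v => \int[mu]_(z in `]c, v]) (z `^ (alpha + 1))^-1).

Lemma measurable_inv_powR (b : R) : measurable_fun setT (fun z : R => (z `^ b)^-1).
Proof. by under eq_fun do rewrite -powRN; exact: measurable_powR. Qed.

Lemma inv_power_integrable (c v : R) : 0 < c ->
  mu.-integrable `[c, v] (EFin \o (fun z => (z `^ (alpha + 1))^-1)).
Proof.
move=> c0; have mI : measurable `[c, v] by exact: measurable_itv.
have m1 : measurable_fun `[c, v] (fun z : R => (z `^ (alpha + 1))^-1).
  exact: measurable_funS (measurable_inv_powR _).
have Ioo : (mu `[c, v] < +oo)%E.
  by rewrite lebesgue_measure_itv/=; case: ifP; rewrite ltry.
apply: (@finite_bounded_integrable _ _ _ _ _ _ (c `^ (alpha + 1))^-1) => //.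
move=> z /=; rewrite in_itv/= => /andP[cz _].
have z0 := lt_le_trans c0 cz.
rewrite ger0_norm ?invr_ge0 ?powR_ge0// lef_pV2 ?posrE ?powR_gt0//.
by apply: ge0_ler_powR => //; rewrite ?nnegrE; [rewrite -lerBlDr sub0r ltW|exact: ltW..].
Qed.

Lemma inv_power_integrable_oc (c v w : R) : 0 < c -> c <= w ->
  mu.-integrable `]w, v] (EFin \o (fun z => (z `^ (alpha + 1))^-1)).
Proof.
move=> c0 cw; apply: integrableS (inv_power_integrable v c0) => //.
by apply: subset_itvr; rewrite bnd_simp.
Qed.

Lemma inv_power_integral_cc (c u v : R) : 0 < c -> c <= u ->
  \int[mu]_(z in `[u, v]) (z `^ (alpha + 1))^-1 = W c v - W c (Num.min u v).
Proof.
move=> c0 cu; have [vu|uv] := ltP v u.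
  rewrite subrr set_itv_ge ?Rintegral_set0// bnd_simp.
  by rewrite -ltNge.
rewrite -(Rintegral_itv_obnd_cbnd (inv_power_integrable_oc v c0 cu)).
by rewrite Rintegral_itvB ?bnd_simp//; exact: (inv_power_integrable_oc v c0 (lexx c)).
Qed.

Lemma inv_power_integral_nd (c : R) : 0 < c -> {homo W c : u v / u <= v}.
Proof.
move=> c0 u v uv /=.
have [uc|cu] := leP u c.
  rewrite [leLHS](_ : _ = 0); last by rewrite set_itv_ge ?Rintegral_set0// bnd_simp -leNgt.
  by apply: Rintegral_ge0 => z _; rewrite invr_ge0 powR_ge0.
rewrite -subr_ge0 Rintegral_itvB ?bnd_simp//.
  by apply: Rintegral_ge0 => z _; rewrite invr_ge0 powR_ge0.
  exact: inv_power_integrable_oc (lexx c).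
exact: ltW.
Qed.

Lemma psiE (c a b y : R) : 0 < c -> c <= a -> 0 < y ->
  psi alpha a b y = y `^ alpha * (W c b - W c (Num.min (Num.max a y) b)).
Proof.
move=> c0 ca y0.
have a0 := lt_le_trans c0 ca.
rewrite -inv_power_integral_cc//; last by rewrite le_max ca.
rewrite -RintegralZl//; last first.
  by apply: inv_power_integrable; rewrite lt_max a0.
rewrite /psi.
have [ya|ay] := leP y a.
  rewrite -Rintegral_itv_obnd_cbnd; last first.
    exact: integrableZl_real (inv_power_integrable_oc _ a0 (lexx a)).
  apply: eq_Rintegral => z /set_mem; rewrite /= in_itv/= => /andP[az _].
  by rewrite /avg_kernel y0 (le_trans ya (ltW az)).
rewrite Rintegral_mkcond [RHS]Rintegral_mkcond.
apply: eq_Rintegral => z _; rewrite !patchE !mem_setE !in_itv/= /avg_kernel y0/=.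
have [zb|] := leP z b; rewrite ?andbF// !andbT.
by have [yz|] := leP y z; [rewrite (lt_le_trans ay yz)|case: ifP].
Qed.

End power_mass.

Section interlacing.
Context (R : realType) (N : nat) (X Y : nat -> R) (W : R -> R).
Hypothesis incX : forall i j, (i < j <= N)%N -> X i < X j.
Hypothesis incY : forall i j, (i < j < N)%N -> Y i < Y j.

(** With $W$ a primitive of $z^{-\alpha-1}$, the increment of $W$ between
    clamped values is the mass of the intersection of two intervals. *)
Let clamp i u := Num.min (Num.max (X i) u) (X i.+1).
Let upper i := if i.+1 == N then X i.+1 else Num.min (X i.+1) (Y i.+1).
Let T i j := if (j < N)%N then W (clamp i (Y j)) else W (X i.+1).

Let leX i j : (i <= j <= N)%N -> X i <= X j.
Proof.
move=> /andP[]; rewrite leq_eqVlt => /predU1P[->//|ij] jN.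
by apply/ltW/incX; rewrite ij.
Qed.

(** Subtracting adjacent columns replaces the half-lines $[y_j,\infty)$ by the
    disjoint intervals $[y_j,y_{j+1})$. *)
Lemma interlacing_diff :
  \matrix_(i < N, j < N) (T i j.+1 - T i j) =
  \matrix_(i < N, j < N) (W (X i.+1) - W (clamp i (Y j))) *m
  \matrix_(l < N, j < N) ((l == j :> nat)%:R - (l == j.+1 :> nat)%:R).
Proof.
apply/matrixP => i j; rewrite !mxE.
under eq_bigr do rewrite !mxE mulrBr.
rewrite sumrB (bigD1 j)//= eqxx mulr1 big1 ?addr0; last first.
  by move=> l lj; rewrite (_ : (l == j :> nat) = false) ?mulr0//; apply/negbTE.
rewrite {2}/T ltn_ord /T; case: ltnP => jN.
  rewrite (bigD1 (Ordinal jN))//= eqxx mulr1 big1 ?addr0; first by ring.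
  move=> l lj; rewrite (_ : (l == j.+1 :> nat) = false) ?mulr0//.
  by apply: contraNF lj => /eqP E; apply/eqP/val_inj.
rewrite big1 ?subr0// => l _; rewrite (_ : (l == j.+1 :> nat) = false) ?mulr0//.
by apply/negbTE; rewrite neq_ltn (leq_trans (ltn_ord l) jN).
Qed.

Let T_low (i j : nat) : (i < N)%N -> (j.+1 < N)%N -> Y j.+1 <= X i -> T i j.+1 = T i j.
Proof.
move=> iN jN YX; rewrite /T jN (ltnW jN) /clamp.
rewrite !(max_idPl _)//.
by apply: le_trans YX; apply/ltW/incY; rewrite leqnn.
Qed.

Let T_high (i j : nat) : (i < N)%N -> (j < N)%N -> X i.+1 <= Y j -> T i j.+1 = T i j.
Proof.
move=> iN jN XY; have Xi : X i <= X i.+1 by apply: leX; rewrite leqnSn.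
have E k : X i.+1 <= Y k -> clamp i (Y k) = X i.+1.
  move=> h; rewrite /clamp (max_idPr _) ?(min_idPr _)//.
  exact: le_trans h.
rewrite /T jN; case: ifP => j1N; rewrite !E//.
by apply: (le_trans XY); apply/ltW/incY; rewrite leqnn.
Qed.

Lemma interlacing_diag (i : nat) : (i < N)%N ->
  T i i.+1 - T i i = W (upper i) - W (Num.min (Num.max (X i) (Y i)) (upper i)).
Proof.
move=> iN; have Xi : X i < X i.+1 by apply: incX; rewrite leqnn.
rewrite /T iN /upper /clamp; case: (ltnP i.+1 N) => h; last first.
  by rewrite (_ : i.+1 == N) // eqn_leq h iN.
rewrite (ltn_eqF h); have Yi : Y i < Y i.+1 by apply: incY; rewrite leqnn.
have [XY|YX] := leP (X i) (Y i.+1).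
  rewrite [Num.min (Y _) _]minC; congr (_ - W _).
  rewrite minA [RHS](min_idPl _)//.
  by rewrite ge_min ge_max XY (ltW Yi).
rewrite (max_idPl (ltW (lt_trans Yi YX))).
rewrite (min_idPr (ltW (lt_trans YX Xi))) (min_idPl (ltW Xi)) (min_idPr (ltW YX)).
by rewrite !subrr.
Qed.

(** If $i<i'$ and $\sigma(i)>\sigma(i')$, the interval $[y_{\sigma(i)},
    y_{\sigma(i)+1})$ lies to the right of $[y_{\sigma(i')},y_{\sigma(i')+1})$, so
    they cannot meet $[x_i,x_{i+1}]$ and $[x_{i'},x_{i'+1}]$ respectively in a set of
    positive measure. Only the identity contributes. *)
Lemma interlacing_det :
  \det (\matrix_(i < N, j < N) (W (X i.+1) - W (clamp i (Y j)))) =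
  \prod_(i < N) (W (upper i) - W (Num.min (Num.max (X i) (Y i)) (upper i))).
Proof.
transitivity (\det (\matrix_(i < N, j < N) (T i j.+1 - T i j))).
  rewrite interlacing_diff det_mulmx [X in _ * X]det_trig; last first.
    apply/is_trig_mxP => i j ij; rewrite mxE !(ltn_eqF _) ?subrr//.
    exact: ltn_trans ij _.
  by rewrite big1 ?mulr1// => i _; rewrite mxE eqxx ltn_eqF// subr0.
rewrite /determinant (bigD1 (1%g : {perm 'I_N}))//= odd_perm1 mul1r.
rewrite [X in _ + X]big1 ?addr0.
  by apply: eq_bigr => i _; rewrite perm1 mxE interlacing_diag.
move=> s s1; apply/eqP; rewrite mulf_eq0; apply/orP; right; apply/eqP.
have [i [j [ij sij]]] := perm_inversion s1.
have XX : X i.+1 <= X j by apply: leX; rewrite ij ltnW.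
have [YX|XY] := leP (Y (s i)) (X i.+1).
  rewrite (bigD1 j)//= mxE T_low ?subrr ?mul0r//; first exact: leq_ltn_trans sij _.
  apply: le_trans (le_trans YX XX).
  move: sij; rewrite leq_eqVlt => /predU1P[->//|h].
  by apply/ltW/incY; rewrite h ltn_ord.
by rewrite (bigD1 i)//= mxE T_high ?subrr ?mul0r// ltW.
Qed.

(** A factor with $y_i\notin[x_{i-1},x_{i+1}]$ forces the factor $i$ or the
    factor $i-1$ to vanish. *)
Lemma interlacing_indicator (X0 : R) : X0 <= X 0 -> (forall i, (i < N)%N -> X0 <= Y i) ->
  \prod_(i < N) (((if i : nat is k.+1 then X k else X0) <= Y i <= X i.+1)%R%:R *
     (W (upper i) - W (Num.min (Num.max (X i) (Y i)) (upper i)))) =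
  \prod_(i < N) (W (upper i) - W (Num.min (Num.max (X i) (Y i)) (upper i))).
Proof.
move=> X00 X0Y.
have [H|] := pselect (forall i : 'I_N, (if i : nat is k.+1 then X k else X0) <= Y i <= X i.+1).
  by apply: eq_bigr => i _; rewrite H mul1r.
move=> /existsNP[i /negP Hi].
rewrite (bigD1 i)//= (negbTE Hi) !mul0r; apply/esym.
move: Hi; rewrite negb_and -!ltNge => /orP[|XY]; last first.
  by rewrite (bigD1 i)//= -interlacing_diag// T_high ?subrr ?mul0r// ltW.
case: i => -[|k] /= kN; first by rewrite ltNge X0Y.
move=> YX; rewrite (bigD1 (Ordinal (ltnW kN)))//= -interlacing_diag ?(ltnW kN)//.
by rewrite T_low ?subrr ?mul0r// ?(ltnW kN)// ltW.
Qed.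

End interlacing.

Section link_density_determinant.
Context (R : realType) (alpha : R) (alpha_gt : -1 < alpha) (N : nat).
Local Notation mu := (@lebesgue_measure R).
Local Notation W := (fun c v => \int[mu]_(z in `]c, v]) (z `^ (alpha + 1))^-1).
Implicit Types (x : 'rV[R]_N.+1) (y : 'rV[R]_N).

Lemma coord1_ord n (u : 'rV[R]_n) (i : 'I_n) : coord1 u i.+1 = u ord0 i.
Proof. by rewrite /coord1 insubT//= => h; congr (u _ _); exact: val_inj. Qed.

Lemma coord1_lt n (u : 'rV[R]_n) : increasing_row n u ->
  forall i j, (i < j < n)%N -> coord1 u i.+1 < coord1 u j.+1.
Proof.
move=> ui i j /andP[ij jn].
by rewrite (coord1_ord u (Ordinal (ltn_trans ij jn))) (coord1_ord u (Ordinal jn)) ui.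
Qed.

Lemma coord1_gt0 n (u : 'rV[R]_n) : (forall i, 0 < u ord0 i) ->
  forall i, (i < n)%N -> 0 < coord1 u i.+1.
Proof. by move=> u0 i lt_in; rewrite (coord1_ord u (Ordinal lt_in)). Qed.

Lemma link_density_product x y : weyl_interior N.+1 x ->
  link_density alpha x y =
  N`!%:R * pochhammer (alpha + 1) N * (vdm y / vdm x) *
  \prod_(k < N) ((coord1 x k <= coord1 y k.+1 <= coord1 x k.+2)%R%:R *
   (coord1 y k.+1 `^ alpha *
    (W (coord1 x 1) (link_upper x y k.+1) -
     W (coord1 x 1) (Num.min (Num.max (coord1 x k.+1) (coord1 y k.+1)) (link_upper x y k.+1))))).
Proof.
move=> [x0 xI]; rewrite /link_density; congr (_ * _).
rewrite big_add1 big_mkord; apply: eq_bigr => k _ /=.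
have c0 : 0 < coord1 x 1 by exact: coord1_gt0.
have ck : coord1 x 1 <= Num.max (coord1 x k.+1) (coord1 y k.+1).
  rewrite le_max; apply/orP; left; case: k => -[|k] kN //=.
  by apply/ltW/(@coord1_lt N.+1) => //; rewrite ltnS/= ltnW.
congr (_ * _).
  by rewrite indicE mem_setE in_itv.
rewrite -inv_power_integral_cc// RintegralZl//.
by apply: inv_power_integrable => //; exact: lt_le_trans ck.
Qed.

Definition link_det x y : R :=
  \det (\matrix_(i < N, j < N) psi alpha (coord1 x j.+1) (coord1 x j.+2) (y ord0 i)).

(** The powers $y_j^\alpha$ are taken out of the columns; the remaining entries
    are masses of the intervals $[x_i,x_{i+1}]\cap[y_j,\infty)$. *)
Lemma link_density_det x y : weyl_interior N.+1 x -> weyl_interior N y ->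
  link_density alpha x y =
  N`!%:R * pochhammer (alpha + 1) N * (vdm y / vdm x) * link_det x y.
Proof.
move=> xW [y0 yI]; rewrite link_density_product//; have [x0 xI] := xW.
congr (_ * _).
have c0 : 0 < coord1 x 1 by exact: coord1_gt0.
pose X k := coord1 x k.+1; pose Y k := coord1 y k.+1.
have incX i j : (i < j <= N)%N -> X i < X j by move=> h; exact: (coord1_lt xI).
have incY i j : (i < j < N)%N -> Y i < Y j by move=> h; exact: (coord1_lt yI).
have XX i : X i.+1 = coord1 x i.+2 by [].
transitivity (\prod_(k < N) (Y k `^ alpha) *
    \prod_(k < N) ((coord1 x k <= Y k <= X k.+1)%R%:R *
      (W (X 0) (link_upper x y k.+1) - W (X 0) (Num.min (Num.max (X k) (Y k)) (link_upper x y k.+1))))).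
  rewrite -big_split/=; apply: eq_bigr => k _.
  by rewrite mulrCA.
rewrite /link_det.
transitivity (\det (\matrix_(j < N, i < N) (Y j `^ alpha *
    (\matrix_(i < N, j < N) (W (X 0) (X i.+1) - W (X 0) (Num.min (Num.max (X i) (Y j)) (X i.+1))))^T j i)));
    last first.
  congr (\det _); apply/matrixP => j i; rewrite !mxE (@psiE _ _ alpha_gt (X 0))//.
  - by rewrite /Y coord1_ord.
  - by case: i => -[|i] iN //=; apply/ltW/incX; rewrite /= ltnW.
rewrite det_row_scale det_tr; congr (_ * _).
apply: etrans (esym (@interlacing_det R N X Y (W (X 0)) incX incY)).
apply: etrans (@interlacing_indicator R N X Y (W (X 0)) incX incY 0 _ _).
- by apply: eq_bigr => -[[|k] kN].
- exact: ltW.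
- by move=> i iN; apply/ltW/coord1_gt0.
Qed.

Lemma measurable_coord1 n k : measurable_fun setT (fun u : 'rV[R]_n => coord1 u k).
Proof.
case: k => [|k]; first exact: measurable_cst.
rewrite /coord1; case: insubP => [i _ _|_] /=; last exact: measurable_cst.
exact: measurable_row_coord.
Qed.

Lemma measurable_vdm n : measurable_fun setT (@vdm R n).
Proof.
have -> : @vdm R n = fun u => \prod_(i < n) \prod_(j < n)
    (if (i < j)%N then u ord0 j - u ord0 i else 1).
  by apply/funext => u; apply: eq_bigr => i _; rewrite big_mkcond.
apply: measurable_prod => i _; apply: measurable_prod => j _; case: (i < j)%N; last exact: measurable_cst.
by apply: measurable_funB; exact: measurable_row_coord.
Qed.

Lemma measurable_link_density x : weyl_interior N.+1 x ->
  measurable_fun setT (link_density alpha x).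
Proof.
move=> xW; have [x0 _] := xW; have c0 : 0 < coord1 x 1 by exact: coord1_gt0.
apply: (eq_measurable_fun _ (fun y _ => esym (link_density_product y xW))).
have mW : measurable_fun setT (W (coord1 x 1)).
  by apply: nondecreasing_measurable => // u v; exact: inv_power_integral_nd.
have mup k : measurable_fun setT (fun y => link_upper x y k).
  rewrite /link_upper; case: (k == N); first exact: measurable_cst.
  by apply: measurable_minr; [exact: measurable_cst|exact: measurable_coord1].
apply: measurable_funM.
  apply: measurable_funM; first exact: measurable_cst.
  by apply: measurable_funM; [exact: measurable_vdm|exact: measurable_cst].
apply: measurable_prod => k _; apply: measurable_funM.
  apply: (measurable_comp (F := setT) (f := fun b : bool => b%:R : R)) => //.
  by apply: measurable_and; apply: measurable_fun_ler => //; exact: measurable_coord1.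
apply: measurable_funM.
  exact: measurableT_comp (measurable_powR _) (measurable_coord1 _).
apply: measurable_funB; apply: (measurableT_comp mW); first exact: mup.
apply: measurable_minr => //; apply: measurable_maxr; first exact: measurable_cst.
exact: measurable_coord1.
Qed.

End link_density_determinant.

(** * Integration against the densities *)

Section density_unbounded.
Context d (T : measurableType d) (R : realType).
Variables (mu : {measure set T -> \bar R}) (m : probability T R).
Variables (W : set T) (rho : T -> R).
Hypothesis mW : measurable W.
Hypothesis mrho : measurable_fun W rho.
Hypothesis rho0 : forall x, W x -> 0 <= rho x.
Hypothesis mE : forall A, measurable A ->
  m A = (\int[mu]_(x in A `&` W) (rho x)%:E)%E.

(** Truncation at height $k$ reduces the formula to bounded functions. *)
Lemma Rintegral_density_integrable (g : T -> R) : m.-integrable W (EFin \o g) ->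
  mu.-integrable W (EFin \o (fun x => g x * rho x)) /\
  \int[m]_(x in W) g x = \int[mu]_(x in W) (g x * rho x).
Proof.
move=> Ig; have mg : measurable_fun W g by apply/measurable_EFinP; exact: measurable_int Ig.
pose h k x : R := (`|g x| <= k%:R)%R%:R.
have mh k : measurable_fun W (h k).
  apply: (measurable_comp (F := setT) (f := fun b : bool => b%:R : R)) => //.
  by apply: measurable_fun_ler => //; exact: measurableT_comp.
have h01 k x : 0 <= h k x <= 1 by rewrite /h; case: (_ <= k%:R); rewrite ?lexx ?ler01.
have hk k x : `|h k x * g x| <= k%:R.
  by rewrite /h; have [H|H] := boolP (`|g x| <= k%:R); rewrite ?mul1r// mul0r normr0 ler0n.
have hcvg x : \forall k \near \oo, h k x = 1.
  near=> k; rewrite /h (_ : `|g x| <= k%:R)//.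
  by near: k; exact: nbhs_infty_ger.
have hnd x : {homo h ^~ x : i j / (i <= j)%N >-> i <= j}.
  move=> i j ij; rewrite /h ler_nat; have [gi|//] := boolP (`|g x| <= i%:R).
  by rewrite (_ : `|g x| <= j%:R)// (le_trans gi)// ler_nat.
have mhg k : measurable_fun W (fun x => h k x * g x) by exact: measurable_funM.
have mahg k : measurable_fun W (fun x => h k x * `|g x|).
  by apply: measurable_funM => //; exact: measurableT_comp.
have Ea k : \int[m]_(x in W) (h k x * `|g x|) = \int[mu]_(x in W) (h k x * `|g x| * rho x).
  apply: (Rintegral_density (M := k%:R) mW mrho mE (mahg k)) => x Wx.
  by have := hk k x; rewrite !normrM normr_id.
have Iabs := integrable_normr mW Ig.
have h1 k x : h k x * `|g x| <= `|g x|.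
  by have /andP[_ ?] := h01 k x; rewrite ler_piMl.
have Iahg k : m.-integrable W (EFin \o (fun x => h k x * `|g x|)).
  apply: (dominated_integrable_real mW (mahg k) Iabs) => x _.
  by have /andP[? _] := h01 k x; rewrite ger0_norm ?mulr_ge0// h1.
have Irho := density_integrable mW mrho mE.
have mmrho : measurable_fun W (fun x => g x * rho x) by exact: measurable_funM.
have I : mu.-integrable W (EFin \o (fun x => g x * rho x)).
  apply/integrableP; split; first exact/measurable_EFinP.
  apply: (@le_lt_trans _ _ (\int[m]_(x in W) `|g x|)%:E); last exact: ltry.
  pose f_ k x := (h k x * `|g x| * rho x)%:E.
  have mf_ k : measurable_fun W (f_ k).
    by apply/measurable_EFinP; exact: measurable_funM.
  have f_0 k x : W x -> (0 <= f_ k x)%E.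
    by move=> Wx; have /andP[? _] := h01 k x; rewrite lee_fin !mulr_ge0// rho0.
  have f_nd x : W x -> {homo f_ ^~ x : i j / (i <= j)%N >-> (i <= j)%E}.
    by move=> Wx i j ij; rewrite lee_fin ler_wpM2r ?rho0// ler_wpM2r// hnd.
  have := @cvg_monotone_convergence _ _ _ mu _ mW _ mf_ f_0 f_nd.
  rewrite [X in _ --> X](_ : _ = \int[mu]_(x in W) `|(g x * rho x)%:E|)%E; last first.
    apply: eq_integral => x /set_mem Wx; apply/cvg_lim => //.
    apply: cvg_near_cst; have := hcvg x; apply: filterS => k hkx.
    by rewrite /f_ hkx mul1r /= normrM (ger0_norm (rho0 Wx)).
  move=> C; apply: (@cvge_le _ _ _ _ _ _ _ _ C); near=> k.
  have -> : (\int[mu]_(x in W) f_ k x = (\int[m]_(x in W) (h k x * `|g x|))%:E)%E.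
    rewrite Ea /Rintegral fineK//; apply: (integrable_fin_num mW).
    apply: (integrable_mulr_bounded (M := k%:R) mW Irho (mahg k)) => x Wx.
    by have := hk k x; rewrite !normrM normr_id.
  by rewrite lee_fin; apply: le_Rintegral.
split => //.
have [|||_ _ lim1] := @dominated_convergence_real _ _ _ m W
  (fun k x => h k x * g x) g (fun x => `|g x|) mW mhg.
- move=> x _; apply: cvg_near_cst; have := hcvg x; apply: filterS => k ->.
  by rewrite mul1r.
- exact: Iabs.
- move=> k x _; rewrite normrM.
  by have /andP[? _] := h01 k x; rewrite (ger0_norm (x := h k x))// h1.
have [|||_ _ lim2] := @dominated_convergence_real _ _ _ mu W
  (fun k x => h k x * g x * rho x) (fun x => g x * rho x)
  (fun x => `|g x * rho x|) mW (fun k => measurable_funM (mhg k) mrho).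
- move=> x _; apply: cvg_near_cst; have := hcvg x; apply: filterS => k ->.
  by rewrite mul1r.
- exact: integrable_normr.
- move=> k x _; rewrite -mulrA normrM.
  have /andP[? ?] := h01 k x; rewrite (ger0_norm (x := h k x))//.
  by rewrite ler_piMl.
have E k : \int[m]_(x in W) (h k x * g x) = \int[mu]_(x in W) (h k x * g x * rho x).
  exact: (Rintegral_density (M := k%:R) mW mrho mE (mhg k) (fun x _ => hk k x)).
move: lim1; under eq_fun do rewrite E.
by move=> lim1; exact: (cvg_unique _ lim1 lim2).
Unshelve. all: by end_near. Qed.

End density_unbounded.

Section weyl_density.
Context (R : realType) (n : nat).
Local Notation lam n := (@lebesgue_row R n).
Variables (m : probability 'rV[R]_n R) (rho : 'rV[R]_n -> R).
Hypothesis mrho : measurable_fun (weyl n) rho.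
Hypothesis rho0 : forall y, weyl n y -> ~ increasing_row n y -> rho y = 0.
Hypothesis mE : forall A, measurable A ->
  m A = (\int[lam n]_(y in A `&` weyl n) (rho y)%:E)%E.

Lemma weyl_interior_sub : weyl_interior n `<=` (weyl n : set 'rV[R]_n).
Proof. by move=> y [y0 yI]; split => [i|i j ij]; [exact: ltW|exact/ltW/yI]. Qed.

Let mI := @weyl_interior_measurable R n.
Let mW := @weyl_measurable R n.
Let mrhoI : measurable_fun (weyl_interior n) rho.
Proof. exact: measurable_funS weyl_interior_sub mrho. Qed.

Let mEI A : measurable A ->
  m A = (\int[lam n]_(y in A `&` weyl_interior n) (rho y)%:E)%E.
Proof. by move=> mA; rewrite mE// integral_weyl_interior. Qed.

Lemma Rintegral_interior_density (g : 'rV[R]_n -> R) (M : R) :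
  measurable_fun (weyl_interior n) g ->
  (forall y, weyl_interior n y -> `|g y| <= M) ->
  \int[m]_(y in weyl_interior n) g y =
  \int[lam n]_(y in weyl_interior n) (g y * rho y).
Proof. exact: Rintegral_density mI mrhoI mEI _ _. Qed.

Lemma Rintegral_weyl_density (g : 'rV[R]_n -> R) (M : R) :
  measurable_fun (weyl n) g -> (forall y, weyl n y -> `|g y| <= M) ->
  \int[m]_(y in weyl n) g y = \int[m]_(y in weyl_interior n) g y.
Proof.
move=> mg gM; rewrite (Rintegral_density mW mrho mE mg gM).
rewrite (Rintegral_interior_density (M := M)).
- rewrite /Rintegral; congr fine.
  have := integral_weyl_interior (A := setT) (rho := fun y => g y * rho y) measurableT.
  rewrite !setTI; apply; first exact: measurable_funM.
  by move=> y Wy yI; rewrite rho0// mulr0.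
- exact: measurable_funS weyl_interior_sub mg.
- by move=> y /weyl_interior_sub; exact: gM.
Qed.

End weyl_density.

Section determinantal_laws.
Context (R : realType).
Local Notation mu := (@lebesgue_measure R).
Local Notation lam n := (@lebesgue_row R n).
Local Notation E := (`[0, +oo[%classic : set R).

Lemma measurable_det d (T : measurableType d) (D : set T) n (A : T -> 'M[R]_n) :
  (forall i j, measurable_fun D (fun t => A t i j)) ->
  measurable_fun D (fun t => \det (A t)).
Proof.
move=> mA; apply: measurable_sum => s; apply: measurable_funM => //.
by apply: measurable_prod => i _; exact: mA.
Qed.

Lemma vdm_gt0 n (y : 'rV[R]_n) : weyl_interior n y -> 0 < vdm y.
Proof.
move=> [_ yI]; apply: prodr_gt0 => i _; apply: prodr_gt0 => j ij.
by rewrite subr_gt0 yI.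
Qed.

Lemma vdm_eq0 n (y : 'rV[R]_n) : weyl n y -> ~ increasing_row n y -> vdm y = 0.
Proof.
move=> [_ yW] yI; apply: contrapT => /eqP v0; apply: yI => i j ij.
rewrite lt_neqAle yW// andbT; apply: contraNneq v0 => E'.
by rewrite /vdm (bigD1 i)//= (bigD1 j)//= E' subrr !mul0r.
Qed.

(** The common form of the laws of the semigroup and of the link. It is stated
    for the integrals of bounded functions, in which the two laws are used. *)
Definition determinantal n (m : probability 'rV[R]_n R) (c : R)
    (a : 'I_n -> R -> R) := forall (g : 'rV[R]_n -> R) (M : R),
  measurable_fun (weyl_interior n) g ->
  (forall y, weyl_interior n y -> `|g y| <= M) ->
  \int[m]_(y in weyl_interior n) g y = \int[lam n]_(y in weyl_interior n)
    (g y * (c * (vdm y * \det (\matrix_(i, j) a j (y ord0 i))))).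

Definition det_quotient n (b : 'I_n -> R -> R) (y : 'rV[R]_n) : R :=
  \det (\matrix_(i, j) b j (y ord0 i)) / vdm y.

Lemma measurable_det_quotient n (b : 'I_n -> R -> R) :
  (forall j, measurable_fun E (b j)) ->
  measurable_fun (weyl_interior n) (det_quotient b).
Proof.
move=> mb; apply: measurable_funM.
  apply: measurable_det => i j; under eq_fun do rewrite mxE.
  apply: (measurable_comp (F := E)) (mb j) _ => //.
    by move=> _ [y [y0 _] <-] /=; rewrite in_itv/= andbT ltW.
  exact: measurable_funS (measurable_row_coord i).
apply: (@eq_measurable_fun _ _ _ _ _ (fun y : 'rV[R]_n => vdm y `^ (-1))).
  by move=> y /set_mem /vdm_gt0 v0; rewrite powR_inv1// ltW.
apply: measurable_funS (_ : measurable_fun setT _) => //.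
exact: measurableT_comp (measurable_powR _) (@measurable_vdm R n).
Qed.

(** The Vandermonde factor of the density cancels the denominator, which leaves
    Andréief's identity. *)
Lemma determinantal_integral n (m : probability 'rV[R]_n R) c (a b : 'I_n -> R -> R) M :
  determinantal m c a -> (forall i u, u <= 0 -> a i u = 0) ->
  (forall j, measurable_fun E (b j)) ->
  (forall y, weyl_interior n y -> `|det_quotient b y| <= M) ->
  (forall i j, mu.-integrable setT (EFin \o (fun u => a i u * b j u))) ->
  \int[m]_(y in weyl_interior n) det_quotient b y =
  c * \det (\matrix_(i, j) \int[mu]_u (a i u * b j u)).
Proof.
move=> mE a0 mb bM Iab; rewrite (mE _ _ (measurable_det_quotient mb) bM).
have [I1 <-] := andreief a0 Iab.
rewrite -RintegralZl//; last exact: weyl_interior_measurable.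
apply: eq_Rintegral => y /set_mem /vdm_gt0 v0.
by rewrite /det_quotient; field; rewrite gt_eqF.
Qed.

End determinantal_laws.

Section laguerre_laws.
Context (R : realType) (alpha : R) (alpha_gt : -1 < alpha).
Variables (p : R -> R -> R -> R) (Q : R -> R -> probability R R).
Local Notation mu := (@lebesgue_measure R).
Local Notation lam n := (@lebesgue_row R n).
Local Notation E := (`[0, +oo[%classic : set R).
Hypothesis hpQ : forall t x : R, 0 < t -> E x ->
  [/\ measurable_fun E (p t x), forall y, E y -> 0 <= p t x y &
      forall A, measurable A ->
        Q t x A = (\int[mu]_(y in A `&` E) (p t x y)%:E)%E].

(** The value $0$ at the origin, a null set, makes $\det[a_j(y_i)]$ vanish outside
    the open chamber. *)
Definition zero_extended_density (t x u : R) : R := if 0 < u then p t x u else 0.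
Local Notation pp := zero_extended_density.

Lemma density_integral (t x : R) (g : R -> R) : 0 < t -> E x ->
  (Q t x).-integrable E (EFin \o g) ->
  mu.-integrable setT (EFin \o (fun u => pp t x u * g u)) /\
  \int[mu]_u (pp t x u * g u) = kernel_op E (Q t) g x.
Proof.
move=> t0 Ex Ig; have [mp p0 pE] := hpQ t0 Ex.
have mid : measurable_fun [set: measurableTypeR R] (idfun : measurableTypeR R -> R).
  by move=> _ Y mY; rewrite setTI preimage_id.
pose mu' := pushforward mu (idfun : measurableTypeR R -> R).
have mE : measurable (E : set R) by exact: measurable_itv.
have pE' A : measurable A -> Q t x A = (\int[mu']_(y in A `&` E) (p t x y)%:E)%E.
  move=> mA; rewrite pE// /mu' (ge0_integral_pushforward mid)//.
  - exact: measurableI.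
  - by apply/measurable_EFinP; apply: measurable_funS mp.
  - by move=> y /set_mem [_ Ey]; rewrite lee_fin p0.
have [I1' E1'] := Rintegral_density_integrable mE mp p0 pE' Ig.
have mgp : measurable_fun E (fun u => g u * p t x u).
  by apply/measurable_EFinP; exact: measurable_int I1'.
have I1 : mu.-integrable E (EFin \o (fun u => g u * p t x u)).
  apply/integrableP; split; first exact/measurable_EFinP.
  have /integrableP[_] := I1'; rewrite (ge0_integral_pushforward mid)//.
  by apply: measurableT_comp => //; exact/measurable_EFinP.
have E1 : \int[Q t x]_(u in E) g u = \int[mu]_(u in E) (g u * p t x u).
  rewrite E1' /Rintegral; congr fine.
  rewrite [LHS]integral_mkcond [RHS]integral_mkcond (integral_pushforward mid)//.
    apply/(measurable_restrict _ mE measurableT); rewrite setTI.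
    exact/measurable_EFinP.
  have I0 : mu.-integrable setT ((EFin \o (fun u => g u * p t x u)) \_ E).
    have mE' : measurable (E : set (measurableTypeR R)) by exact: mE.
    by apply/(integrable_mkcond _ mE'); exact: I1.
  exact: I0.
have I2 : mu.-integrable `]0, +oo[ (EFin \o (fun u => g u * p t x u)).
  by apply: integrableS I1 => //; apply: subset_itvr; rewrite bnd_simp.
have PE : (fun u => pp t x u * g u) = (fun u => g u * p t x u) \_ `]0, +oo[.
  apply/funext => u; rewrite patchE mem_setE in_itv/= andbT /pp.
  by case: ifP => _; rewrite ?mul0r// mulrC.
rewrite PE; split.
  have mE' : measurable (`]0, +oo[%classic : set (measurableTypeR R)).
    by have : measurable (`]0, +oo[%classic : set R) by exact: measurable_itv.
  by rewrite -restrict_EFin; apply/(integrable_mkcond _ mE').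
rewrite -Rintegral_mkcond /kernel_op E1.
exact: Rintegral_itv_obnd_cbnd.
Qed.

Lemma weyl_semigroup_determinantal n (P : R -> 'rV[R]_n -> probability 'rV[R]_n R) (t : R) x :
  laguerre_weyl_semigroup p P -> 0 < t -> weyl_interior n x ->
  determinantal (P t x) (expR (- laguerre_lambda n * t) / vdm x)
    (fun j => pp t (x ord0 j)) /\
  (forall (g : 'rV[R]_n -> R) (M : R), measurable_fun (weyl n) g -> (forall y, weyl n y -> `|g y| <= M) ->
    \int[P t x]_(y in weyl n) g y = \int[P t x]_(y in weyl_interior n) g y).
Proof.
move=> hP t0 xI; have mE := laguerre_weyl_densityE hP t0 xI.
have mrho : measurable_fun (weyl n) (laguerre_weyl_density p t x).
  apply: measurable_funM.
    apply: measurable_funM => //; apply: measurable_funM => //.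
    exact: measurable_funS (@measurable_vdm R n).
  apply: measurable_det => i j; under eq_fun do rewrite mxE.
  have Ex : E (x ord0 i) by case: xI => x0 _; rewrite /= in_itv/= andbT ltW.
  have [mp _ _] := hpQ t0 Ex.
  apply: (measurable_comp (F := E)) mp _ => //.
    by move=> _ [y [y0 _] <-] /=; rewrite in_itv/= andbT.
  exact: measurable_funS (measurable_row_coord j).
have rho0 y : weyl n y -> ~ increasing_row n y -> laguerre_weyl_density p t x y = 0.
  by move=> yW yI; rewrite /laguerre_weyl_density (vdm_eq0 yW yI) mul0r mulr0 mul0r.
split; last by move=> g M mg gM; exact: (Rintegral_weyl_density mrho rho0 mE mg gM).
move=> g M mg gM; rewrite (Rintegral_interior_density mrho rho0 mE mg gM).
apply: eq_Rintegral => y /set_mem [y0 _]; congr (_ * _).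
rewrite /laguerre_weyl_density [_ / _ * (_ * _)]mulrA [_ / _ * vdm y]mulrAC -[in RHS]mulrA.
congr (_ * _); rewrite -det_tr; congr (\det _); apply/matrixP => i j.
by rewrite !mxE /pp y0.
Qed.

Lemma link_determinantal n (K : 'rV[R]_n.+1 -> probability 'rV[R]_n R) x :
  laguerre_link alpha K -> weyl_interior n.+1 x ->
  determinantal (K x) (n`!%:R * pochhammer (alpha + 1) n / vdm x)
    (fun j => psi alpha (coord1 x j.+1) (coord1 x j.+2)) /\
  (forall (g : 'rV[R]_n -> R) (M : R), measurable_fun (weyl n) g -> (forall y, weyl n y -> `|g y| <= M) ->
    \int[K x]_(y in weyl n) g y = \int[K x]_(y in weyl_interior n) g y).
Proof.
move=> hK xI; have mE := fun A => laguerre_link_densityE hK xI (A := A).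
have mrho : measurable_fun (weyl n) (link_density alpha x).
  exact: measurable_funS (measurable_link_density alpha_gt xI).
have rho0 y : weyl n y -> ~ increasing_row n y -> link_density alpha x y = 0.
  by move=> yW yI; rewrite /link_density (vdm_eq0 yW yI) mul0r mulr0 mul0r.
split; last by move=> g M mg gM; exact: (Rintegral_weyl_density mrho rho0 mE mg gM).
move=> g M mg gM; rewrite (Rintegral_interior_density mrho rho0 mE mg gM).
apply: eq_Rintegral => y /set_mem yI; congr (_ * _).
rewrite (link_density_det alpha_gt xI yI) -/(link_det alpha x y).
have alg (a b c e : R) : a * (b / c) * e = a / c * (b * e) by rewrite -!mulrA; congr (_ * _); rewrite mulrCA.
exact: alg.
Qed.

End laguerre_laws.

(** * The intertwining on boxes *)

Section determinant_lemmas.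
Context (R : realType).

Definition augment n (h : 'I_n -> R -> R) (j : 'I_n.+1) : R -> R :=
  if unlift ord0 j is Some k then h k else fun=> 1.

(** Subtracting from each row the previous one clears the column of ones. *)
Lemma det_increments n (h : 'I_n -> R -> R) (X : nat -> R) :
  \det (\matrix_(i < n.+1, j < n.+1) augment h j (X i)) =
  \det (\matrix_(i < n, j < n) (h j (X i.+1) - h j (X i))).
Proof.
set G := \matrix_(i, j) augment h j (X i).
pose D : 'M[R]_n.+1 := \matrix_(i, l) ((i == l :> nat)%:R - (i == l.+1 :> nat)%:R).
have detD : \det D = 1.
  rewrite det_trig; last first.
    by apply/is_trig_mxP => i j ij; rewrite mxE !ltn_eqF ?subrr// ltnW.
  by rewrite big1// => i _; rewrite mxE eqxx ltn_eqF// subr0.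
have DG0 j : (D *m G) ord0 j = G ord0 j.
  rewrite mxE (bigD1 ord0)//= mxE eqxx subr0 mul1r big1 ?addr0// => l l0.
  by rewrite mxE/= (_ : (0 == l :> nat) = false) ?subrr ?mul0r// eq_sym; apply/negbTE.
have DGS (i : 'I_n) j :
    (D *m G) (lift ord0 i) j = augment h j (X i.+1) - augment h j (X i).
  rewrite mxE; under eq_bigr do rewrite !mxE lift0 mulrBl.
  rewrite sumrB (bigD1 (lift ord0 i))// lift0 eqxx mul1r big1 ?addr0; last first.
    move=> l /andP[_ li]; rewrite (_ : (i.+1 == l :> nat) = false) ?mul0r//.
    by apply: contraNF li => /eqP E; apply/eqP/ord_inj; rewrite lift0.
  rewrite [in LHS]/= addr0; congr (_ - _); rewrite (bigD1 (widen_ord (leqnSn n) i))//= eqxx mul1r big1 ?addr0//.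
  move=> l li; rewrite (_ : (i.+1 == l.+1 :> nat) = false) ?mul0r//.
  by apply: contraNF li; rewrite eqSS => /eqP E; apply/eqP/ord_inj.
rewrite -[LHS]mul1r -detD -det_mulmx (expand_det_col _ ord0) big_ord_recl big1 ?addr0.
  rewrite DG0 /G mxE /augment unlift_none mul1r /cofactor expr0 mul1r.
  congr (\det _); apply/matrixP => i j; rewrite 2!mxE [RHS]mxE.
  by have := DGS i (lift ord0 j); rewrite mxE /augment liftK.
by move=> i _; rewrite DGS /augment unlift_none subrr mul0r.
Qed.

Variables (n : nat) (c d : 'I_n -> R).
Hypothesis cd_sep : forall i j : 'I_n, (i < j)%N -> d i < c j.

Local Notation b := (fun i => \1_(`]c i, d i]%classic) : R -> R).

(** The intervals are ordered, so an inversion of the permutation would place a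
    smaller coordinate in a later interval. *)
Lemma det_indicator (y : 'rV[R]_n) : increasing_row n y ->
  \det (\matrix_(i, j) b j (y ord0 i)) = [forall i, c i < y ord0 i <= d i]%:R.
Proof.
move=> yI; rewrite /determinant (bigD1 (1%g : {perm 'I_n}))//= odd_perm1 mul1r.
have bE i u : b i u = (c i < u <= d i)%R%:R by rewrite indicE mem_setE in_itv.
rewrite [X in _ + X]big1 ?addr0; last first.
  move=> s /perm_inversion[i [j [ij sij]]]; apply/eqP; rewrite mulf_eq0; apply/orP; right.
  apply/prodf_eq0; apply: contrapT => H.
  have {}H k : (c (s k) < y ord0 k <= d (s k)).
    apply: contrapT => /negP/negbTE E; apply: H; exists k => //.
    by rewrite mxE bE E.
  have /andP[ci _] := H i; have /andP[_ jd] := H j.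
  by have := lt_trans ci (lt_le_trans (yI _ _ ij) jd); rewrite ltNge ltW// cd_sep.
have [/forallP H|] := boolP [forall i, c i < y ord0 i <= d i].
  by rewrite big1// => i _; rewrite mxE bE perm1 H.
rewrite negb_forall => /existsP[i /negbTE Hi].
by rewrite (bigD1 i)//= mxE bE perm1 Hi mul0r.
Qed.

Lemma det_quotient_indicator (y : 'rV[R]_n) : weyl_interior n y ->
  det_quotient b y = [forall i, c i < y ord0 i <= d i]%:R / vdm y.
Proof. by move=> [_ yI]; rewrite /det_quotient det_indicator. Qed.

Lemma det_quotient_bounded (y : 'rV[R]_n) : weyl_interior n y ->
  `|det_quotient b y| <= (\prod_(i < n) \prod_(j < n | (i < j)%N) (c j - d i))^-1.
Proof.
move=> yI; have v0 := vdm_gt0 yI; rewrite det_quotient_indicator//.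
have pos : 0 < \prod_(i < n) \prod_(j < n | (i < j)%N) (c j - d i).
  by apply: prodr_gt0 => i _; apply: prodr_gt0 => j ij; rewrite subr_gt0 cd_sep.
have [/forallP H|_] := boolP [forall i, c i < y ord0 i <= d i]; last by rewrite mul0r normr0 invr_ge0 ltW.
rewrite mul1r ger0_norm ?invr_ge0 ?(ltW v0)// lef_pV2 ?posrE//.
apply: ler_prod => i _; apply/andP; split.
  by apply: prodr_ge0 => j ij; rewrite subr_ge0 ltW// cd_sep.
apply: ler_prod => j ij; rewrite subr_ge0 (ltW (cd_sep ij))/=.
have /andP[_ yd] := H i; have /andP[cy _] := H j.
by rewrite lerB// ltW.
Qed.

End determinant_lemmas.

Section box_intertwining.
Context (R : realType) (alpha : R) (alpha_gt : -1 < alpha).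
Variables (p : R -> R -> R -> R) (Q : R -> R -> probability R R).
Local Notation mu := (@lebesgue_measure R).
Local Notation lam n := (@lebesgue_row R n).
Local Notation E := (`[0, +oo[%classic : set R).
Hypothesis hQ : laguerre_diffusion alpha Q.
Hypothesis hpQ : forall t x : R, 0 < t -> E x ->
  [/\ measurable_fun E (p t x), forall y, E y -> 0 <= p t x y &
      forall A, measurable A ->
        Q t x A = (\int[mu]_(y in A `&` E) (p t x y)%:E)%E].
Variables (N : nat).
Variable (P : R -> 'rV[R]_N -> probability 'rV[R]_N R).
Hypothesis hP : laguerre_weyl_semigroup p P.
Variable (P1 : R -> 'rV[R]_N.+1 -> probability 'rV[R]_N.+1 R).
Hypothesis hP1 : laguerre_weyl_semigroup p P1.
Variable (K : 'rV[R]_N.+1 -> probability 'rV[R]_N R).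
Hypothesis hK : laguerre_link alpha K.
Variable (t : R).
Hypothesis t0 : 0 < t.

Local Notation I n := (@weyl_interior R n).
Local Notation KI f := (fun x => \int[K x]_(y in I N) f y).
Local Notation PI f := (fun x => \int[P t x]_(y in I N) f y).
Local Notation T := (kernel_op E (Q t)).
Local Notation Phi g := (fun u => avg_int alpha 0 u g).

(** The functions on the interior of the chamber on which the two compositions
    agree. Here the integrals run over the interior only, where the laws have
    explicit densities. *)
Record intertwined (M : R) (f : 'rV[R]_N -> R) : Prop := Intertwined {
  intertwined_meas : measurable_fun (I N) f ;
  intertwined_le : forall y, I N y -> `|f y| <= M ;
  intertwined_link : measurable_fun (I N.+1) (KI f) ;
  intertwined_semigroup : measurable_fun (I N) (PI f) ;
  intertwined_eq : forall x, I N.+1 x ->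
    \int[P1 t x]_(x' in I N.+1) KI f x' = \int[K x]_(y in I N) PI f y }.

Variables (c d : 'I_N -> R).
Hypothesis c0 : forall i, 0 < c i.
Hypothesis cd : forall i, c i <= d i.
Hypothesis cd_sep : forall i j : 'I_N, (i < j)%N -> d i < c j.

Local Notation b := (fun i => \1_(`]c i, d i]%classic) : R -> R).

Let Ep x : I N x -> forall i, E (x ord0 i).
Proof. by move=> [x0 _] i; rewrite /= in_itv/= andbT ltW. Qed.

Let Ep1 x : I N.+1 x -> forall i, E (x ord0 i).
Proof. by move=> [x0 _] i; rewrite /= in_itv/= andbT ltW. Qed.

Let C : R := N`!%:R * pochhammer (alpha + 1) N.

Let C0 : 0 < C.
Proof.
rewrite mulr_gt0 ?ltr0n ?fact_gt0//; apply: prodr_gt0 => i _.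
by rewrite ltr_wpDr ?ler0n// -ltrBlDr sub0r.
Qed.

Let M : R := (\prod_(i < N) \prod_(j < N | (i < j)%N) (c j - d i))^-1.

Let M0 : 0 <= M.
Proof.
rewrite invr_ge0; apply: prodr_ge0 => i _; apply: prodr_ge0 => j ij.
by rewrite subr_ge0 ltW// cd_sep.
Qed.

Let mb i : measurable_fun E (b i).
Proof. exact: measurable_indic (measurable_itv _). Qed.

Let bM i u : E u -> `|b i u| <= 1.
Proof. by move=> _ /=; rewrite indicE; case: (_ \in _); rewrite ?normr0 ?normr1. Qed.

Let q := det_quotient b.
Let mq : measurable_fun (I N) q.
Proof. exact: measurable_det_quotient. Qed.

Let qM y : I N y -> `|q y| <= M.
Proof. exact: det_quotient_bounded. Qed.

Let Tb i := laguerre_intertwining alpha_gt hQ (ltW t0) (c0 i) (cd i).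

Let int_bM (m : probability 'rV[R]_N R) : `|\int[m]_(y in I N) q y| <= M.
Proof. by apply: prob_Rintegral_le => //; exact: weyl_interior_measurable. Qed.

(** The link maps the quotient for $b_j$ to the quotient for the functions
    $1,\Phi b_1,\dots,\Phi b_N$ in one more variable. *)
Let g := augment (fun j => Phi (b j)).

Let mg j : measurable_fun E (g j).
Proof.
rewrite /g /augment; case: unliftP => [k _|_]; last exact: measurable_cst.
exact: (measurable_avg_int0 alpha_gt (mb k) (bM k)).
Qed.

Let Ig x j : 0 <= x -> (Q t x).-integrable E (EFin \o g j).
Proof.
move=> x0; rewrite /g /augment; case: unliftP => [k _|_].
  exact: (avg_int0_integrable alpha_gt hQ (ltW t0) (mb k) (bM k)).
apply: finite_cst_integrable; first exact: measurable_itv.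
by rewrite (le_lt_trans (probability_le1 _ _))// ltry.
Qed.

Let coord1E n (x : 'rV[R]_n) i : coord1 x (i : 'I_n).+1 = x ord0 i.
Proof. exact: coord1_ord. Qed.

Let link_quotient x : I N.+1 x -> \int[K x]_(y in I N) q y = C * det_quotient g x.
Proof.
move=> xI; have [D _] := link_determinantal alpha_gt hK xI.
have mono k : (k < N)%N -> 0 <= coord1 x k.+1 <= coord1 x k.+2.
  move=> kN; have [x0 xinc] := xI.
  rewrite (ltW (coord1_gt0 x0 _)) ?(leqW kN)//= ltW// (coord1_lt xinc)//.
  by rewrite leqnn ltnS.
rewrite (determinantal_integral D _ mb qM); last 2 first.
- by move=> i u; exact: psi_out.
- move=> i j; have /andP[x0 _] := mono i (ltn_ord i).
  by have [_ + _] := avg_int_fubini alpha_gt (mb j) (bM j) (coord1 x i.+2) x0.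
rewrite /det_quotient mulrAC -mulrA; congr (_ * (_ / _)).
transitivity (\det (\matrix_(i < N.+1, j < N.+1) g j (coord1 x i.+1))); last first.
  by congr (\det _); apply/matrixP => i j; rewrite !mxE coord1E.
rewrite (det_increments _ (fun i => coord1 x i.+1)); congr (\det _).
apply/matrixP => i j; rewrite !mxE.
have /andP[x0 xx] := mono i (ltn_ord i).
have [_ _ <-] := avg_int_fubini alpha_gt (mb j) (bM j) (coord1 x i.+2) x0.
by rewrite (avg_int_add alpha_gt (mb j) (bM j)).
Qed.

Let semigroup_quotient x : I N x -> \int[P t x]_(y in I N) q y =
  expR (- laguerre_lambda N * t) * det_quotient (fun j => T (b j)) x.
Proof.
move=> xI; have [D _] := weyl_semigroup_determinantal hpQ hP t0 xI.
have Ib i j := density_integral hpQ t0 (Ep xI i)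
  (@bounded_integrable _ _ _ (Q t (x ord0 i)) _ (measurable_itv _) _ 1 (mb j) (bM j)).
rewrite (determinantal_integral D _ mb qM); last 2 first.
- by move=> i u u0; rewrite /zero_extended_density ltNge u0.
- by move=> i j; exact: (Ib i j).1.
rewrite /det_quotient mulrAC -mulrA; congr (_ * (_ / _)).
by congr (\det _); apply/matrixP => i j; rewrite !mxE (Ib i j).2.
Qed.

Let Tg x j : 0 <= x -> T (g j) x = augment (fun k => T (Phi (b k))) j x.
Proof.
move=> x0; rewrite /g /augment; case: unliftP => [k _//|_].
apply: prob_Rintegral_cst; first exact: measurable_itv.
by apply: (laguerre_conservative hQ) => //; [exact: ltW|rewrite /= in_itv/= andbT].
Qed.

Let exponents : expR (- laguerre_lambda N * t) * expR t ^+ N =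
  expR (- laguerre_lambda N.+1 * t) :> R.
Proof.
rewrite -expRM_natl -expRD; congr expR; rewrite /laguerre_lambda !opprK.
rewrite -[N.+1.-1]/N mulSn natrD mulrDl; case: (N) => [|n].
  by rewrite mul0n !mul0r !addr0 mul0r.
rewrite -[n.+1.-1]/n !natrM -!natr1; by field.
Qed.

(** Both orders lead to $\det[1,Q_t\Phi b_j(x_i)]/\Delta_{N+1}(x)$. *)
Lemma box_intertwined : intertwined M (det_quotient b).
Proof.
have e0 : 0 < expR (- laguerre_lambda N * t) by exact: expR_gt0.
have mTb j : measurable_fun E (T (b j)) by have [[]] := Tb j.
have gM y : I N.+1 y -> `|det_quotient g y| <= M / C.
  move=> yI; rewrite ler_pdivlMr// -[X in _ * X](gtr0_norm C0) -normrM mulrC.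
  by rewrite -link_quotient//; exact: int_bM.
have TbM y : I N y -> `|det_quotient (fun j => T (b j)) y| <=
    M / expR (- laguerre_lambda N * t).
  move=> yI; rewrite ler_pdivlMr// -[X in _ * X](gtr0_norm e0) -normrM mulrC.
  by rewrite -semigroup_quotient//; exact: int_bM.
have mlq := measurable_det_quotient mg.
have msq := measurable_det_quotient mTb.
split => //.
- apply: (@eq_measurable_fun _ _ _ _ _ (fun x => C * det_quotient g x)).
    by move=> x /set_mem xI; rewrite link_quotient.
  exact: measurable_funM.
- apply: (@eq_measurable_fun _ _ _ _ _
    (fun x => expR (- laguerre_lambda N * t) * det_quotient (fun j => T (b j)) x)).
    by move=> x /set_mem xI; rewrite semigroup_quotient.
  exact: measurable_funM.
move=> x xI.
have mI n := @weyl_interior_measurable R n.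
transitivity (C * \int[P1 t x]_(x' in I N.+1) det_quotient g x').
  rewrite -RintegralZl; [|exact: mI|exact: (bounded_integrable _ (mI _) mlq gM)].
  by apply: eq_Rintegral => x' /set_mem x'I; exact: link_quotient.
transitivity (expR (- laguerre_lambda N * t) *
    \int[K x]_(y in I N) det_quotient (fun j => T (b j)) y); last first.
  rewrite -RintegralZl; [|exact: mI|exact: (bounded_integrable _ (mI _) msq TbM)].
  by apply: eq_Rintegral => y /set_mem yI; rewrite semigroup_quotient.
have [D1 _] := weyl_semigroup_determinantal hpQ hP1 t0 xI.
have x0 i : 0 <= x ord0 i by case: xI => x0 _; exact: ltW.
have I1 i j := density_integral hpQ t0 (Ep1 xI i) (Ig j (x0 i)).
rewrite (determinantal_integral D1 _ mg gM); last 2 first.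
- by move=> i u u0; rewrite /zero_extended_density ltNge u0.
- by move=> i j; exact: (I1 i j).1.
have [D _] := link_determinantal alpha_gt hK xI.
have mono k : (k < N)%N -> 0 <= coord1 x k.+1 <= coord1 x k.+2.
  move=> kN; have [xp xinc] := xI.
  rewrite (ltW (coord1_gt0 xp _)) ?(leqW kN)//= ltW// (coord1_lt xinc)//.
  by rewrite leqnn ltnS.
have I2 (i j : 'I_N) : [/\ mu.-integrable setT (EFin \o (fun u =>
      psi alpha (coord1 x i.+1) (coord1 x i.+2) u * T (b j) u)) &
    \int[mu]_u (psi alpha (coord1 x i.+1) (coord1 x i.+2) u * T (b j) u) =
    expR t * (T (Phi (b j)) (coord1 x i.+2) - T (Phi (b j)) (coord1 x i.+1))].
  have /andP[xi0 xx] := mono i (ltn_ord i); have [ab eqb] := Tb j.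
  have [_ I3 E3] := avg_int_fubini alpha_gt (mTb j)
    (fun y _ => admissible_bound y ab) (coord1 x i.+2) xi0.
  by split => //; rewrite -E3 eqb.
rewrite (determinantal_integral D _ mTb TbM); last 2 first.
- by move=> i u; exact: psi_out.
- by move=> i j; have [] := I2 i j.
have -> : \det (\matrix_(i, j) \int[mu]_u (psi alpha (coord1 x i.+1) (coord1 x i.+2) u *
      T (b j) u)) =
    expR t ^+ N * \det (\matrix_(i < N.+1, j < N.+1) T (g j) (x ord0 i)).
  transitivity (\det (expR t *: \matrix_(i < N, j < N)
      (T (Phi (b j)) (coord1 x i.+2) - T (Phi (b j)) (coord1 x i.+1)))).
    by congr (\det _); apply/matrixP => i j; rewrite !mxE; have [] := I2 i j.
  rewrite detZ; congr (_ * _).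
  rewrite -(det_increments (fun j => T (Phi (b j))) (fun i => coord1 x i.+1)).
  by congr (\det _); apply/matrixP => i j; rewrite !mxE Tg ?coord1E.
have -> : \det (\matrix_(i, j) \int[mu]_u (zero_extended_density p t (x ord0 i) u * g j u)) =
    \det (\matrix_(i < N.+1, j < N.+1) T (g j) (x ord0 i)).
  by congr (\det _); apply/matrixP => i j; rewrite !mxE (I1 i j).2.
rewrite -exponents.
have alg (a1 a2 a3 a4 a5 : R) : a1 * (a2 * a3 / a4 * a5) = a2 * (a1 / a4 * (a3 * a5)) by ring.
exact: alg.
Qed.

End box_intertwining.

(** * Sequences and continuity on the chamber *)

Section row_sequences.
Context (R : realType) (n : nat).
Implicit Types (u : nat -> 'rV[R]_n) (y : 'rV[R]_n) (A : set 'rV[R]_n).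

Lemma cvg_row u y : (forall i, u k ord0 i @[k --> \oo] --> y ord0 i) ->
  u k @[k --> \oo] --> y.
Proof.
move=> H A [B yB BA].
have : \forall k \near \oo, forall i, B ord0 i (u k ord0 i).
  by apply: filter_forall => i; exact: (H i _ (yB ord0 i)).
apply: filterS => k Bk; apply: BA => i j; rewrite ord1; exact: Bk.
Qed.

Lemma cvg_row_coord u y i : u k @[k --> \oo] --> y ->
  u k ord0 i @[k --> \oo] --> y ord0 i.
Proof.
move=> H B yB; apply: (H [set z : 'rV[R]_n | B (z ord0 i)]).
exists (fun i' j => if j == i then B else setT) => [i' j|z Hz].
  by case: eqP => [->|_]; [rewrite ord1|exact: filterT].
by have := Hz ord0 i; rewrite eqxx.
Qed.

Lemma within_cvg_seq A (f : 'rV[R]_n -> R) u y : {within A, continuous f} -> A y ->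
  (\forall k \near \oo, A (u k)) -> u k @[k --> \oo] --> y ->
  f (u k) @[k --> \oo] --> f y.
Proof.
move=> /subspace_continuousP cf Ay Au uy.
apply: (cvg_comp _ _ _ (cf y Ay)) => B /uy; rewrite /= !nbhs_simpl /= => H.
by apply: filterS2 H Au => k; exact.
Qed.

Lemma seq_within_continuous A (f : 'rV[R]_n -> R) :
  (forall u y, A y -> (forall k, A (u k)) -> u k @[k --> \oo] --> y ->
    f (u k) @[k --> \oo] --> f y) ->
  {within A, continuous f}.
Proof.
move=> H; apply/subspace_continuousP => y Ay; apply/cvgrPdist_lt => e e0.
apply: contrapT => Hn.
have {}Hn k : exists z, [/\ A z, ball y k.+1%:R^-1 z & e <= `|f y - f z|].
  apply: contrapT => Hk; apply: Hn; rewrite /= /within/=.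
  have : nbhs y (ball y k.+1%:R^-1) by apply: nbhsx_ballx; rewrite invr_gt0.
  apply: filterS => z yz Az; rewrite ltNge; apply/negP => ez; apply: Hk.
  by exists z.
have [u Hu] := choice Hn.
have uy : u k @[k --> \oo] --> y.
  apply/cvg_ballP => d d0; near=> k.
  have [_ + _] := Hu k; apply: le_ball; apply: ltW.
  by near: k; exact: (near_infty_natSinv_lt (PosNum d0)).
have := H u y Ay (fun k => let: And3 a _ _ := Hu k in a) uy.
move=> /cvgrPdist_lt /(_ e e0) [k _ /(_ k (leqnn k))].
by have [_ _] := Hu k; rewrite leNgt => /negP.
Unshelve. all: by end_near. Qed.

Lemma cvg_vdm u y : u k @[k --> \oo] --> y -> vdm (u k) @[k --> \oo] --> vdm y.
Proof.
move=> uy; apply: cvg_big => [|i _]; first exact: mul_continuous.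
apply: cvg_big => [|j _]; first exact: mul_continuous.
by apply: cvgB; exact: cvg_row_coord.
Qed.

End row_sequences.

Section chamber_continuity.
Context (R : realType) (n : nat).
Implicit Types (f : 'rV[R]_n -> R).

Let floor_row (k : nat) (y : 'rV[R]_n) : 'rV[R]_n :=
  \row_i ((Num.truncn (k.+1%:R * y ord0 i))%:R / k.+1%:R).

Let floor_row_weyl k y : weyl n y -> weyl n (floor_row k y).
Proof.
move=> [y0 yI]; split => [i|i j ij]; rewrite !mxE.
  by rewrite divr_ge0.
by rewrite ler_pM2r ?invr_gt0// ler_nat le_truncn// ler_wpM2l// yI.
Qed.

Let floor_row_cvg y : weyl n y -> floor_row k y @[k --> \oo] --> y.
Proof.
move=> [y0 _]; apply: cvg_row => i; apply/cvgrPdist_lt => e e0; near=> k.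
rewrite mxE; have m0 : 0 < k.+1%:R :> R by [].
have ky : 0 <= k.+1%:R * y ord0 i by rewrite mulr_ge0.
have /andP[t1 t2] := truncn_itv ky.
rewrite (@le_lt_trans _ _ k.+1%:R^-1)//; last first.
  by near: k; exact: (near_infty_natSinv_lt (PosNum e0)).
rewrite ger0_norm; last by rewrite subr_ge0 ler_pdivrMr// [leRHS]mulrC.
rewrite lerBlDr -[X in X + _]mul1r -mulrDl ler_pdivlMr// mulrC.
by rewrite (le_trans (ltW t2))// -natr1 addrC.
Unshelve. all: by end_near. Qed.

(** Rounding the coordinates down writes a continuous function on the closed
    chamber as a limit of functions with countably many values on boxes. *)
Lemma weyl_continuous_measurable f : {within weyl n, continuous f} ->
  measurable_fun (weyl n) f.
Proof.
move=> cf; apply: (measurable_fun_cvg (h := fun k y => f (floor_row k y))); last first.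
  move=> y Wy; apply: within_cvg_seq (floor_row_cvg Wy) => //.
  by near=> k; exact: floor_row_weyl.
move=> k mW B mB; apply: measurableI => //.
pose box (v : 'rV[nat]_n) : set 'rV[R]_n :=
  [set y | forall i, [set u | Num.truncn (k.+1%:R * u) = v ord0 i] (y ord0 i)].
pose val_at (v : 'rV[nat]_n) : R := f (\row_i ((v ord0 i)%:R / k.+1%:R)).
rewrite (_ : _ @^-1` B = \bigcup_j (if unpickle j is Some v then
    (if val_at v \in B then box v else set0) else set0)); last first.
  apply/seteqP; split => [y By|y [j _]].
    exists (pickle (\row_i Num.truncn (k.+1%:R * y ord0 i))) => //.
    rewrite pickleK mem_set; first by move=> i; rewrite /= mxE.
    rewrite /val_at (_ : \row_i _ = floor_row k y)//.
    by apply/rowP => i; rewrite !mxE.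
  case: unpickle => // v; case: ifPn => // /set_mem Bv yv /=.
  rewrite (_ : floor_row k y = \row_i ((v ord0 i)%:R / k.+1%:R))//.
  by apply/rowP => i; rewrite !mxE; congr (_%:R / _); exact: yv.
apply: bigcupT_measurable => j; case: unpickle => // v; case: ifP => // _.
apply: row_box_measurable; exists (fun i => [set u | Num.truncn (k.+1%:R * u) = v ord0 i]) => // i.
apply: is_interval_measurable => s u /= sv uv z /andP[sz zu].
by apply/anti_leq; rewrite -{1}uv -sv !le_truncn ?ler_wpM2l.
Unshelve. all: by end_near. Qed.

End chamber_continuity.

Section cells.
Context (R : realType).

Lemma cell_exists (m : nat) (u : R) : (0 < m)%N -> 0 < u ->
  exists v : nat, v%:R / m%:R < u <= v.+1%:R / m%:R.
Proof.
move=> m0 u0; have m0' : 0 < m%:R :> R by rewrite ltr0n.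
have ex : exists v, u * m%:R <= v.+1%:R.
  by exists (Num.truncn (u * m%:R)); rewrite ltW// truncnS_gt.
case: (ex_minnP ex) => v Hv Hmin; exists v.
rewrite ltr_pdivrMr// ler_pdivlMr// Hv andbT.
case: v Hv Hmin => [|v] _ Hmin; first by rewrite mulr_gt0.
by rewrite ltNge; apply/negP => /Hmin; rewrite ltnn.
Qed.

Lemma cell_unique (m v w : nat) (u : R) : (0 < m)%N ->
  v%:R / m%:R < u <= v.+1%:R / m%:R -> w%:R / m%:R < u <= w.+1%:R / m%:R -> v = w.
Proof.
move=> m0; have m0' : 0 < m%:R :> R by rewrite ltr0n.
rewrite !ltr_pdivrMr// !ler_pdivlMr// => /andP[v1 v2] /andP[w1 w2].
have vw : (v < w.+1)%N by rewrite -(ltr_nat R) (lt_le_trans v1 w2).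
have wv : (w < v.+1)%N by rewrite -(ltr_nat R) (lt_le_trans w1 v2).
by apply/eqP; rewrite eqn_leq -ltnS vw.
Qed.

End cells.

(** * From boxes to continuous functions *)

Section intertwined_closure.
Context (R : realType) (N : nat).
Variables (P : R -> 'rV[R]_N -> probability 'rV[R]_N R).
Variables (P1 : R -> 'rV[R]_N.+1 -> probability 'rV[R]_N.+1 R).
Variables (K : 'rV[R]_N.+1 -> probability 'rV[R]_N R) (t : R).
Local Notation I n := (@weyl_interior R n).
Local Notation KI f := (fun x => \int[K x]_(y in I N) f y).
Local Notation PI f := (fun x => \int[P t x]_(y in I N) f y).
Local Notation intertwined := (intertwined P P1 K t).

Let mI n : measurable (I n).
Proof. exact: weyl_interior_measurable. Qed.

Let interior_bound (n : nat) (m : probability 'rV[R]_n R) (M : R) (f : 'rV[R]_n -> R) :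
  measurable_fun (I n) f -> (forall y, I n y -> `|f y| <= M) ->
  `|\int[m]_(y in I n) f y| <= `|M|.
Proof.
move=> mf fM; have fM' y : I n y -> `|f y| <= `|M|.
  by move=> Iy; exact: le_trans (fM y Iy) (ler_norm M).
exact: (prob_Rintegral_le m (@mI n) mf (normr_ge0 M) fM').
Qed.

Lemma intertwined_weaken (M M' : R) f : intertwined M f ->
  (forall y, I N y -> `|f y| <= M') -> intertwined M' f.
Proof. by case=> *; split. Qed.

Lemma intertwined_lin (a b M M' : R) f g : intertwined M f -> intertwined M' g ->
  intertwined (`|a| * M + `|b| * M') (fun y => a * f y + b * g y).
Proof.
move=> [mf fM mKf mPf Ef] [mg gM mKg mPg Eg].
have lin (n : nat) (m : probability 'rV[R]_n R) (u v : 'rV[R]_n -> R) (A B : R) :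
    measurable_fun (I n) u -> (forall y, I n y -> `|u y| <= A) ->
    measurable_fun (I n) v -> (forall y, I n y -> `|v y| <= B) ->
    \int[m]_(y in I n) (a * u y + b * v y) =
    a * (\int[m]_(y in I n) u y) + b * (\int[m]_(y in I n) v y).
  move=> mu uA mv vB; have iu := bounded_integrable m (@mI n) mu uA.
  have iv := bounded_integrable m (@mI n) mv vB.
  rewrite (RintegralD (@mI n) (integrableZl_real a (@mI n) iu)
    (integrableZl_real b (@mI n) iv)).
  by rewrite (RintegralZl a (@mI n) iu) (RintegralZl b (@mI n) iv).
have KE x : KI (fun y => a * f y + b * g y) x = a * KI f x + b * KI g x.
  exact: (lin _ _ _ _ M M').
have PE x : PI (fun y => a * f y + b * g y) x = a * PI f x + b * PI g x.
  exact: (lin _ _ _ _ M M').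
split.
- by apply: measurable_funD; exact: measurable_funM.
- move=> y Iy; rewrite (le_trans (ler_normD _ _))// !normrM.
  by rewrite lerD// ler_wpM2l//; [exact: fM|exact: gM].
- apply: (@eq_measurable_fun _ _ _ _ _ (fun x => a * KI f x + b * KI g x)).
    by move=> x _; rewrite KE.
  by apply: measurable_funD; exact: measurable_funM.
- apply: (@eq_measurable_fun _ _ _ _ _ (fun x => a * PI f x + b * PI g x)).
    by move=> x _; rewrite PE.
  by apply: measurable_funD; exact: measurable_funM.
- move=> x Ix; under eq_Rintegral do rewrite KE.
  under [RHS]eq_Rintegral do rewrite PE.
  rewrite (lin _ _ _ _ `|M| `|M'|)//; [|by move=> x' _; exact: interior_bound..].
  rewrite (lin _ _ _ _ `|M| `|M'|)//; [|by move=> x' _; exact: interior_bound..].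
  by rewrite Ef// Eg.
Qed.

Lemma intertwined0 : intertwined 0 (fun=> 0).
Proof.
have I0 (n : nat) (m : probability 'rV[R]_n R) : \int[m]_(y in I n) (0 : R) = 0.
  by rewrite /Rintegral integral0.
split.
- exact: measurable_cst.
- by move=> y _; rewrite normr0.
- by under eq_fun do rewrite I0; exact: measurable_cst.
- by under eq_fun do rewrite I0; exact: measurable_cst.
- by move=> x Ix; under eq_Rintegral do rewrite I0; under [RHS]eq_Rintegral do rewrite I0; rewrite !I0.
Qed.

Lemma intertwined_sum (J : Type) (s : seq J) (Pr : pred J) (a : J -> R) (h : J -> 'rV[R]_N -> R) :
  (forall j, Pr j -> exists M, intertwined M (h j)) ->
  exists M, intertwined M (fun y => \sum_(j <- s | Pr j) a j * h j y).
Proof.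
move=> H; elim: s => [|j s [M IH]].
  by exists 0; under eq_fun do rewrite big_nil; exact: intertwined0.
have [Pj|Pj] := boolP (Pr j); last first.
  by exists M; under eq_fun do rewrite big_cons (negbTE Pj).
have [M' Hj] := H j Pj; exists (`|a j| * M' + `|1| * M).
under eq_fun do rewrite big_cons Pj -[X in _ + X]mul1r.
exact: intertwined_lin.
Qed.

Lemma intertwined_cvg (M : R) f_ f : (forall n, intertwined M (f_ n)) ->
  (forall y, I N y -> f_ n y @[n --> \oo] --> f y) -> intertwined M f.
Proof.
move=> If cf.
have mf_ n := intertwined_meas (If n); have fM_ n := intertwined_le (If n).
have fin (n : nat) (m : probability 'rV[R]_n R) : (m (I n) < +oo)%E.
  apply: (@le_lt_trans _ _ 1%E); last exact: ltry.
  by apply: probability_le1; exact: mI.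
have icst (n : nat) (m : probability 'rV[R]_n R) (c : R) :
    m.-integrable (I n) (EFin \o (fun=> c)).
  exact: (finite_cst_integrable _ (@mI n) (fin n m)).
have cK x : KI (f_ n) x @[n --> \oo] --> KI f x.
  by have [] := dominated_convergence_real (@mI N) mf_ cf (icst _ (K x) M) fM_.
have cP x : PI (f_ n) x @[n --> \oo] --> PI f x.
  by have [] := dominated_convergence_real (@mI N) mf_ cf (icst _ (P t x) M) fM_.
have mK n := intertwined_link (If n); have mP n := intertwined_semigroup (If n).
split.
- exact: measurable_fun_cvg mf_ cf.
- move=> y Iy; have /cvg_norm C := cf y Iy.
  rewrite -(cvg_lim (@Rhausdorff R) C); apply: limr_le.
    by apply/cvg_ex; exists `|f y|.
  by near=> n; exact: fM_.
- by apply: measurable_fun_cvg mK _ => x _; exact: cK.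
- by apply: measurable_fun_cvg mP _ => x _; exact: cP.
move=> x Ix.
have [_ _ c1] := dominated_convergence_real (@mI N.+1) mK (fun x _ => cK x)
  (icst _ (P1 t x) `|M|) (fun n x' _ => interior_bound (K x') (mf_ n) (fM_ n)).
have [_ _ c2] := dominated_convergence_real (@mI N) mP (fun x _ => cP x)
  (icst _ (K x) `|M|) (fun n x' _ => interior_bound (P t x') (mf_ n) (fM_ n)).
move: c1; under eq_fun do rewrite (intertwined_eq (If _) Ix).
by move=> c1; exact: (cvg_unique _ c1 c2).
Unshelve. all: by end_near. Qed.

End intertwined_closure.

Section approximation.
Context (R : realType) (N : nat).
Variables (P : R -> 'rV[R]_N -> probability 'rV[R]_N R).
Variables (P1 : R -> 'rV[R]_N.+1 -> probability 'rV[R]_N.+1 R).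
Variables (K : 'rV[R]_N.+1 -> probability 'rV[R]_N R) (t : R).
Local Notation I n := (@weyl_interior R n).
Local Notation intertwined := (intertwined P P1 K t).
Local Notation box_indic c d := (fun i => \1_(`]c i, d i]%classic) : R -> R).

Hypothesis box_intertwined : forall c d : 'I_N -> R,
  (forall i, 0 < c i) -> (forall i, c i <= d i) ->
  (forall i j : 'I_N, (i < j)%N -> d i < c j) ->
  exists M, intertwined M (det_quotient (box_indic c d)).

Variables (f : 'rV[R]_N -> R) (M : R).
Hypothesis cf : {within weyl N, continuous f}.
Hypothesis fM : forall y, weyl N y -> `|f y| <= M.

Let index n := {ffun 'I_N -> 'I_(n.+1 * n.+1).+1}.
Let lower n (v : nat) : R := v%:R / n.+1%:R.
Let corner n (v : 'I_N -> nat) : 'rV[R]_N := \row_i lower n (v i).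
Let sep (v : 'I_N -> nat) := [forall i, 0 < v i]%N &&
  [forall i : 'I_N, forall j : 'I_N, (i < j)%N ==> (v i < (v j).-1)%N].
Let cell n v : 'rV[R]_N -> R :=
  det_quotient (box_indic (fun i => lower n (v i)) (fun i => lower n (v i).+1)).

(** A step function for the product of $f$ with the Vandermonde determinant,
    divided by the latter. Only cells with a gap of at least one mesh between
    their sides are used: on these the quotient of the determinants at the
    corner and at the point is bounded. *)
Let approx n y : R := \sum_(v : index n | sep (fun i => v i))
  (f (corner n (fun i => v i)) * vdm (corner n (fun i => v i))) * cell n (fun i => v i) y.

Let sepP (v : 'I_N -> nat) : sep v -> (forall i, 0 < v i)%N /\
  forall i j : 'I_N, (i < j)%N -> ((v i).+1 < v j)%N.
Proof.
move=> /andP[/forallP v0 /forallP vs]; split => // i j ij.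
by have /forallP/(_ j) := vs i; rewrite ij/= ltn_predRL.
Qed.

Let lower_lt n (v w : nat) : (v < w)%N -> lower n v < lower n w.
Proof. by move=> vw; rewrite /lower ltr_pM2r ?invr_gt0// ltr_nat. Qed.

Let lower_le n (v w : nat) : (v <= w)%N -> lower n v <= lower n w.
Proof. by move=> vw; rewrite /lower ler_pM2r ?invr_gt0// ler_nat. Qed.

Let corner_interior n v : sep v -> I N (corner n v).
Proof.
move=> /sepP[v0 vs]; split => [i|i j ij]; rewrite !mxE.
  by rewrite divr_gt0 ?ltr0n.
by apply/lower_lt/(leq_trans _ (vs _ _ ij)); rewrite ltnS.
Qed.

Let in_cell n (v : 'I_N -> nat) (y : 'rV[R]_N) :=
  [forall i, lower n (v i) < y ord0 i <= lower n (v i).+1].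

Let cellE n v y : sep v -> I N y -> cell n v y = (in_cell n v y)%:R / vdm y.
Proof.
move=> /sepP[_ vs] Iy; rewrite /cell det_quotient_indicator// => i j ij.
exact/lower_lt/vs.
Qed.

Let approx_intertwined n : exists M', intertwined M' (approx n).
Proof.
apply: intertwined_sum => v /sepP[v0 vs]; apply: box_intertwined => [i|i|i j ij].
- by rewrite divr_gt0 ?ltr0n.
- exact: lower_le.
- exact/lower_lt/vs.
Qed.

Let approxE n y (v : index n) : I N y -> in_cell n (fun i => v i) y ->
  approx n y = if sep (fun i => v i)
    then f (corner n (fun i => v i)) * vdm (corner n (fun i => v i)) / vdm y else 0.
Proof.
move=> Iy yv; rewrite /approx.
have other (w : index n) : w != v -> in_cell n (fun i => w i) y = false.
  apply: contraNF => /forallP yw; apply/eqP/ffunP => i; apply/val_inj.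
  exact: (@cell_unique R n.+1 _ _ (y ord0 i) (ltn0Sn n) (yw i) (forallP yv i)).
case: ifPn => sv.
  rewrite (bigD1 v)//= big1 ?addr0; first by rewrite cellE// yv mul1r.
  by move=> w /andP[sw wv]; rewrite cellE// other// mul0r mulr0.
rewrite big1// => w sw; rewrite cellE// other ?mul0r ?mulr0//.
by apply: contraNneq sv => <-.
Qed.

Let approx_out n y : I N y -> (forall v : index n, ~~ in_cell n (fun i => v i) y) ->
  approx n y = 0.
Proof.
by move=> Iy H; apply: big1 => v sv; rewrite cellE// (negbTE (H v)) mul0r mulr0.
Qed.

Let B : R := \prod_(i < N) \prod_(j < N | (i < j)%N) 2.

Let vdm_ratio n v y : sep v -> I N y -> in_cell n v y -> vdm (corner n v) <= B * vdm y.
Proof.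
move=> sv Iy /forallP yv; have [v0 vs] := sepP sv; have [_ cI] := corner_interior n sv.
rewrite /B /vdm -big_split/=; apply: ler_prod => i _.
rewrite prodr_ge0/=; last by move=> j ij; rewrite subr_ge0 ltW// cI.
rewrite -big_split/=; apply: ler_prod => j ij.
rewrite subr_ge0 ltW ?cI//= !mxE.
have /andP[_ yi] := yv i; have /andP[yj _] := yv j.
have gap : lower n 1 <= lower n (v j) - lower n (v i).+1.
  rewrite lerBrDr /lower -mulrDl ler_pM2r ?invr_gt0// -natrD ler_nat add1n.
  exact: vs.
have e1 : lower n (v i).+1 = lower n (v i) + lower n 1.
  by rewrite /lower -mulrDl -natrD addn1.
lra.
Qed.

Let M0 : 0 <= M.
Proof.
have W0 : weyl N (0 : 'rV[R]_N) by split => *; rewrite !mxE.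
exact: le_trans (fM W0).
Qed.

Let B0 : 0 <= B.
Proof. by apply: prodr_ge0 => i _; apply: prodr_ge0. Qed.

Let approx_bound n y : I N y -> `|approx n y| <= M * B.
Proof.
move=> Iy; have [[v yv]|H] := pselect (exists v : index n, in_cell n (fun i => v i) y).
  rewrite (approxE Iy yv); case: ifPn => sv; last by rewrite normr0 mulr_ge0.
  have cI := corner_interior n sv.
  rewrite -mulrA normrM; apply: ler_pM => //; first exact/fM/weyl_interior_sub.
  rewrite ger0_norm ?divr_ge0 ?(ltW (vdm_gt0 _))//.
  by rewrite ler_pdivrMr ?vdm_gt0//; exact: vdm_ratio.
rewrite approx_out// ?normr0 ?mulr_ge0// => v; apply/negP => yv; apply: H.
by exists v.
Qed.

(** The cell that contains $y$ is separated as soon as the mesh is small compared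
    with the gaps between the coordinates of $y$. *)
Let approx_cvg y : I N y -> approx n y @[n --> \oo] --> f y.
Proof.
move=> Iy; have [y0 yI] := Iy.
have exV (ni : nat * 'I_N) : exists w : nat,
    lower ni.1 w < y ord0 ni.2 <= lower ni.1 w.+1 by exact: cell_exists.
have [V HV] := choice exV.
pose v n i := V (n, i).
have close n i : `|lower n (v n i) - y ord0 i| <= n.+1%:R^-1.
  have /andP[h1 h2] := HV (n, i); rewrite -/(v n i) in h1 h2.
  have e1 : lower n (v n i).+1 = lower n (v n i) + n.+1%:R^-1.
    by rewrite /lower -[X in _ + X]mul1r -mulrDl natr1.
  have gen (l u e : R) : l < u -> u <= l + e -> `|l - u| <= e.
    by move=> lu ue; rewrite ler_norml; apply/andP; split; lra.
  by apply: gen h1 _; rewrite -e1.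
have small (e : R) : 0 < e -> \forall n \near \oo, n.+1%:R^-1 < e.
  by move=> e0; exact: (near_infty_natSinv_lt (PosNum e0)).
have cc : corner n (v n) @[n --> \oo] --> y.
  apply: cvg_row => i; apply/cvgrPdist_lt => e e0; have := small e e0.
  apply: filterS => n ne; rewrite mxE distrC; exact: le_lt_trans (close n i) ne.
have Ev1 : \forall n \near \oo, forall i, (v n i < (n.+1 * n.+1).+1)%N.
  apply: filter_forall => i; near=> n.
  have /andP[h1 _] := HV (n, i); rewrite /= -/(v n i) /lower ltr_pdivrMr// in h1.
  rewrite ltnS ltnW// -(ltr_nat R) (lt_le_trans h1)// natrM ler_pM2r//.
  apply: (@le_trans _ _ n%:R); last by rewrite ler_nat.
  by near: n; exact: nbhs_infty_ger.
have Ev2 : \forall n \near \oo, sep (v n).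
  have H1 : \forall n \near \oo, forall i, (0 < v n i)%N.
    apply: filter_forall => i; have := small _ (y0 i); apply: filterS => n ne.
    rewrite lt0n; apply/eqP => E; have /andP[_] := HV (n, i).
    by rewrite /= -/(v n i) E /lower mul1r leNgt ne.
  have H2 : \forall n \near \oo, forall i j : 'I_N, (i < j)%N -> (v n i < (v n j).-1)%N.
    apply: filter_forall => i; apply: filter_forall => j.
    have [ij|_] := boolP (i < j)%N; last by near=> n.
    have e0 : 0 < (y ord0 j - y ord0 i) / 2 by rewrite divr_gt0// subr_gt0 yI.
    have := small _ e0; apply: filterS => n ne _; rewrite ltn_predRL.
    rewrite -(ltr_nat R) -(ltr_pM2r (_ : 0 < n.+1%:R^-1 :> R)) ?invr_gt0//.
    rewrite -[X in X < _]/(lower n (v n i).+1) -[X in _ < X]/(lower n (v n j)).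
    have /andP[h1 _] := HV (n, i); have /andP[_ h2] := HV (n, j).
    have e1 w : lower n w.+1 = lower n w + n.+1%:R^-1.
      by rewrite /lower -[X in _ + X]mul1r -mulrDl natr1.
    have gen (li lj yi yj e : R) : e < (yj - yi) / 2 -> li < yi -> yj <= lj + e ->
        li + e < lj by move=> *; lra.
    by rewrite e1; apply: gen ne h1 _; rewrite -e1.
  apply: filterS2 H1 H2 => n h1 h2; apply/andP; split; first exact/forallP.
  by apply/forallP => i; apply/forallP => j; apply/implyP; exact: h2.
have lim : f (corner n (v n)) * vdm (corner n (v n)) / vdm y @[n --> \oo] --> f y.
  rewrite -[X in _ --> X](mulfK (lt0r_neq0 (vdm_gt0 Iy))).
  apply: cvgMl; apply: cvgM; last exact: cvg_vdm.
  apply: within_cvg_seq cc => //; first exact: weyl_interior_sub.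
  by apply: filterS Ev2 => n sv; exact/weyl_interior_sub/corner_interior.
apply: cvg_trans lim; apply: near_eq_cvg.
apply: filterS2 Ev1 Ev2 => n h1 sv; apply/esym.
pose w : index n := [ffun i => inord (v n i)].
have wv : (fun i => w i : nat) = v n.
  by apply/funext => i; rewrite ffunE inordK.
have yw : in_cell n (fun i => w i) y.
  by rewrite wv; apply/forallP => i; exact: (HV (n, i)).
by rewrite (approxE Iy yw) wv sv.
Unshelve. all: by end_near. Qed.

Lemma continuous_intertwined : exists M', intertwined M' f.
Proof.
exists (M * B); apply: (intertwined_cvg (f_ := approx)) approx_cvg => n.
by have [M' H] := approx_intertwined n; exact: intertwined_weaken H (@approx_bound n).
Qed.

End approximation.

(** * Continuity of the link *)

Section psi_continuity.
Context (R : realType) (alpha : R) (alpha_gt : -1 < alpha).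
Local Notation mu := (@lebesgue_measure R).
Local Notation psi := (psi alpha).

Let itv_finite (a b : R) : (mu `]a, b] < +oo)%E.
Proof. by rewrite lebesgue_measure_itv/=; case: ifP; rewrite ltry. Qed.

Let kernel_integrable a b y : 0 < y ->
  mu.-integrable `]a, b] (EFin \o (fun z => avg_kernel alpha z y)).
Proof.
move=> y0; apply: (@finite_bounded_integrable _ _ _ _ _ _ y^-1) => //.
- exact: itv_finite.
- exact: measurable_funTS (measurable_avg_kernel2 alpha y).
- by move=> z _; rewrite ger0_norm ?avg_kernel_ge0// avg_kernel_le.
Qed.

Lemma psi_diff a b y : 0 <= a -> a <= b -> psi a b y = psi 0 b y - psi 0 a y.
Proof.
move=> a0 ab; have [y0|y0] := ltP 0 y; last by rewrite !psi_out// subrr.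
by apply/esym; apply: Rintegral_itvB; rewrite ?bnd_simp//; exact: kernel_integrable.
Qed.

Lemma psi_le_mesh a b y : 0 < y -> a <= b -> psi a b y <= (b - a) / y.
Proof.
move=> y0 ab; apply: (@le_trans _ _ (\int[mu]_(z in `]a, b]) y^-1)).
  apply: le_Rintegral => //.
  - exact: kernel_integrable.
  - apply: (@finite_bounded_integrable _ _ _ _ _ _ `|y^-1|) => //.
    exact: itv_finite.
  - by move=> z _; exact: avg_kernel_le.
rewrite Rintegral_cst// mulrC ler_pM2r ?invr_gt0// [leLHS]/=.
rewrite lebesgue_measure_itv/= lte_fin; case: ltP => //= _.
by rewrite subr_ge0.
Qed.

Lemma psi0_nd y : {in `[0, +oo[ &, {homo (fun b => psi 0 b y) : a b / a <= b}}.
Proof.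
move=> a b; rewrite !in_itv/= !andbT => a0 b0 ab.
by rewrite -subr_ge0 -psi_diff// psi_ge0.
Qed.

Lemma cvg_psi0 (b_ : nat -> R) (b y : R) : 0 < y -> 0 <= b -> (forall k, 0 <= b_ k) ->
  b_ k @[k --> \oo] --> b -> psi 0 (b_ k) y @[k --> \oo] --> psi 0 b y.
Proof.
move=> y0 b0 b_0 cb; apply/cvgrPdist_le => e e0.
have ey : 0 < e * y by rewrite mulr_gt0.
have /cvgrPdist_le/(_ _ ey) := cb; apply: filterS => k.
have gen u v : 0 <= u -> u <= v -> v - u <= e * y -> psi 0 v y - psi 0 u y <= e.
  move=> u0 uv h; rewrite -psi_diff// (le_trans (psi_le_mesh y0 uv))//.
  by rewrite ler_pdivrMr.
have nd u v : 0 <= u -> u <= v -> 0 <= psi 0 v y - psi 0 u y.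
  by move=> u0 uv; rewrite -psi_diff// psi_ge0.
have [bb|bb] := leP b (b_ k).
  rewrite distrC ger0_norm ?subr_ge0// => h.
  by rewrite distrC ger0_norm ?nd//; exact: gen.
rewrite ger0_norm ?subr_ge0 ?(ltW bb)// => h.
by rewrite ger0_norm ?nd ?(ltW bb)//; apply: gen => //; exact: ltW.
Qed.

Lemma psi0_out b y : b < y -> psi 0 b y = 0.
Proof.
move=> by_; transitivity (\int[mu]_(z in `]0, b]) (0 : R)).
  apply: eq_Rintegral => z /set_mem; rewrite /= in_itv/= => /andP[_ zb].
  by rewrite /avg_kernel; case: ifP => // /andP[_]; rewrite leNgt (le_lt_trans zb).
by rewrite /Rintegral integral0.
Qed.

End psi_continuity.

Section link_interior_continuity.
Context (R : realType) (alpha : R) (alpha_gt : -1 < alpha) (N : nat).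
Local Notation mu := (@lebesgue_measure R).
Local Notation lam n := (@lebesgue_row R n).
Local Notation I n := (@weyl_interior R n).
Variable (K : 'rV[R]_N.+1 -> probability 'rV[R]_N R).
Hypothesis hK : laguerre_link alpha K.
Variables (f : 'rV[R]_N -> R) (M : R).
Hypothesis mf : measurable_fun (I N) f.
Hypothesis fM : forall y, I N y -> `|f y| <= M.
Local Notation psi := (psi alpha).

Let det_psi (x : 'rV[R]_N.+1) (y : 'rV[R]_N) :=
  \det (\matrix_(i < N, j < N) psi (coord1 x j.+1) (coord1 x j.+2) (y ord0 i)).

Let interior_coord (x : 'rV[R]_N.+1) k : I N.+1 x -> (k < N)%N ->
  0 <= coord1 x k.+1 <= coord1 x k.+2.
Proof.
move=> [x0 xI] kN; rewrite (ltW (coord1_gt0 x0 _)) ?(leqW kN)//= ltW// (coord1_lt xI)//.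
by rewrite leqnn ltnS.
Qed.

(** The entries of the determinant are supported below the largest coordinate
    of $x$, which also bounds the Vandermonde factor. *)
Let det_psi_bound (L : R) x y : I N.+1 x -> (forall i, x ord0 i <= L) -> I N y ->
  `|vdm y * det_psi x y| <=
  (\prod_(i < N) \prod_(j < N | (i < j)%N) L) * (\sum_(s : {perm 'I_N}) 1) *
  \prod_(i < N) psi 0 L (y ord0 i).
Proof.
move=> Ix xL Iy; have [y0 yI] := Iy.
have L0 : 0 <= L by have [x0 _] := Ix; exact: le_trans (ltW (x0 ord0)) (xL ord0).
have det_le : `|det_psi x y| <= (\sum_(s : {perm 'I_N}) 1) * \prod_(i < N) psi 0 L (y ord0 i).
  rewrite mulr_suml (le_trans (ler_norm_sum _ _ _))//; apply: ler_sum => s _.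
  rewrite mul1r normrM normrX normrN1 expr1n mul1r normr_prod.
  apply: ler_prod => i _; rewrite normr_ge0/= mxE ger0_norm ?psi_ge0//.
  have /andP[a0 ab] := interior_coord Ix (ltn_ord (s i)).
  have cL : coord1 x (s i).+2 <= L.
    by have := xL (lift ord0 (s i)); rewrite -coord1_ord lift0.
  rewrite psi_diff// lerBlDr ler_wpDr ?psi_ge0//.
  by apply: psi0_nd => //; rewrite ?in_itv/= ?andbT//; exact: le_trans ab.
have [H|/existsNP[i /negP]] := pselect (forall i, y ord0 i <= L); last first.
  rewrite -ltNge => Ly.
  have P0 : \prod_(i < N) psi 0 L (y ord0 i) = 0 by rewrite (bigD1 i)//= psi0_out ?mul0r.
  by move: det_le; rewrite P0 !mulr0 normrM => d0; rewrite (le_anti (y := 0) (x := `|det_psi x y|)) ?mulr0 ?d0 ?normr_ge0.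
rewrite normrM -mulrA; apply: ler_pM => //.
rewrite normr_prod; apply: ler_prod => i _; rewrite normr_ge0/= normr_prod.
apply: ler_prod => j ij; rewrite normr_ge0/= ger0_norm ?subr_ge0 ?(ltW (yI _ _ ij))//.
by rewrite lerBlDr ler_wpDr// ltW.
Qed.

Let cvg_coord1 (u : nat -> 'rV[R]_N.+1) x k : u n @[n --> \oo] --> x ->
  coord1 (u n) k @[n --> \oo] --> coord1 x k.
Proof.
move=> ux; case: k => [|k] /=; first exact: cvg_cst.
by case: insubP => [i _ _|_] /=; [exact: cvg_row_coord|exact: cvg_cst].
Qed.

(** Dominated convergence: the densities depend continuously on $x$. *)
Lemma link_interior_cvg (u : nat -> 'rV[R]_N.+1) x : (forall n, I N.+1 (u n)) ->
  I N.+1 x -> u n @[n --> \oo] --> x ->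
  \int[K (u n)]_(y in I N) f y @[n --> \oo] --> \int[K x]_(y in I N) f y.
Proof.
move=> Iu Ix ux.
pose C : R := N`!%:R * pochhammer (alpha + 1) N.
have KE z : I N.+1 z -> \int[K z]_(y in I N) f y =
    \int[lam N]_(y in I N) (f y * (C / vdm z * (vdm y * det_psi z y))).
  by move=> Iz; have [D _] := link_determinantal alpha_gt hK Iz; exact: (D f M).
pose L := coord1 x N.+1 + 1.
have xL i : x ord0 i <= coord1 x N.+1.
  have [_ xI] := Ix; rewrite (coord1_ord x ord_max).
  have [->//|iN] := eqVneq i ord_max.
  by apply/ltW/xI; rewrite ltn_neqAle iN -ltnS ltn_ord.
have v0 := vdm_gt0 Ix; have v20 : 0 < vdm x / 2 by rewrite divr_gt0.
have cv := cvg_vdm ux.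
have [k0 _ Hk0] : \forall n \near \oo, (forall i, u n ord0 i <= L) /\ vdm x / 2 <= vdm (u n).
  near=> n; split.
    near: n; apply: filter_forall => i.
    have /cvgrPdist_le/(_ 1 ltr01) := cvg_row_coord (i := i) ux.
    apply: filterS => n; rewrite distrC => /(le_trans (ler_norm _)).
    by rewrite lerBlDr addrC => h; rewrite (le_trans h)// lerD2r.
  near: n; have /cvgrPdist_le/(_ _ v20) := cv.
  apply: filterS => n /(le_trans (ler_norm _)); lra.
pose w n := u (n + k0)%N.
have wx : w n @[n --> \oo] --> x by have := ux; rewrite -(cvg_shiftn k0 u).
have Iw n : I N.+1 (w n) by exact: Iu.
have [wL wv] : (forall n i, w n ord0 i <= L) /\ (forall n, vdm x / 2 <= vdm (w n)).
  by split => n; have [] := Hk0 (n + k0)%N (leq_addl _ _).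
pose B : R := (\prod_(i < N) \prod_(j < N | (i < j)%N) L) * (\sum_(s : {perm 'I_N}) 1).
have L0 : 0 <= L by have [x0 _] := Iw 0%N; exact: le_trans (ltW (x0 ord0)) (wL 0%N ord0).
pose dom (y : 'rV[R]_N) : R := `|M| * (`|C| / (vdm x / 2)) * B * \prod_(i < N) psi 0 L (y ord0 i).
have mI := @weyl_interior_measurable R N.
have Idom : (lam N).-integrable (I N) (EFin \o dom).
  apply: integrableZl_real => //.
  have [IP _] := prod_integrable (fun i : 'I_N => psi_integrable alpha_gt L (lexx 0)).
  exact: integrableS IP.
have mdet z : I N.+1 z -> measurable_fun (I N) (fun y => f y * (C / vdm z * (vdm y * det_psi z y))).
  move=> Iz; apply: measurable_funM => //; apply: measurable_funM => //; apply: measurable_funM.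
    exact: measurable_funTS (@measurable_vdm R N).
  apply: measurable_det => i j; under eq_fun do rewrite mxE.
  apply: measurable_funTS; apply: measurableT_comp (measurable_row_coord i).
  have /andP[a0 _] := interior_coord Iz (ltn_ord j).
  by apply/measurable_EFinP; exact: measurable_int (psi_integrable alpha_gt _ a0).
rewrite -(cvg_shiftn k0 (fun n => \int[K (u n)]_(y in I N) f y)) KE//.
have KEw n : \int[K (u (n + k0)%N)]_(y in I N) f y = _ := KE (w n) (Iw n).
under eq_fun do rewrite KEw.
have [||_ _ H] := @dominated_convergence_real _ _ _ (lam N) (I N)
  (fun n y => f y * (C / vdm (w n) * (vdm y * det_psi (w n) y)))
  (fun y => f y * (C / vdm x * (vdm y * det_psi x y))) dom mI (fun n => mdet _ (Iw n)) _ Idom _; last exact: H.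
- move=> y [y0 yI]; apply: cvgMr; apply: cvgM.
    by apply: cvgMr; apply: cvgV; [rewrite gt_eqF|exact: cvg_vdm].
  apply: cvgMr; apply: cvg_big => [|s _]; first exact: add_continuous.
  apply: cvgMr; apply: cvg_big => [|i _]; first exact: mul_continuous.
  rewrite !mxE; under eq_fun do rewrite mxE.
  have cj := interior_coord Ix (ltn_ord (s i)).
  have cw n := interior_coord (Iw n) (ltn_ord (s i)).
  have psiE n : psi (coord1 (w n) (s i).+1) (coord1 (w n) (s i).+2) (y ord0 i) =
      psi 0 (coord1 (w n) (s i).+2) (y ord0 i) - psi 0 (coord1 (w n) (s i).+1) (y ord0 i).
    by have /andP[? ?] := cw n; rewrite psi_diff.
  under eq_fun do rewrite psiE.
  have /andP[a0 ab] := cj; rewrite psi_diff//.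
  apply: cvgB; apply: (cvg_psi0 alpha_gt) => //; try exact: cvg_coord1.
  + exact: le_trans ab.
  + by move=> n; have /andP[c0 cc] := cw n; exact: le_trans cc.
  + by move=> n; have /andP[] := cw n.
- move=> n y Iy; rewrite 2!normrM /dom -2!mulrA; apply: ler_pM => //.
    exact: le_trans (fM Iy) (ler_norm M).
  apply: ler_pM => //; last exact: det_psi_bound.
  rewrite normrM normfV ler_wpM2l// (ger0_norm (ltW (vdm_gt0 (Iw n)))).
  by rewrite lef_pV2 ?posrE// vdm_gt0.
Unshelve. all: by end_near. Qed.

End link_interior_continuity.

Section link_continuity.
Context (R : realType) (alpha : R) (alpha_gt : -1 < alpha) (N : nat).
Local Notation I n := (@weyl_interior R n).
Variable (K : 'rV[R]_N.+1 -> probability 'rV[R]_N R).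
Hypothesis hK : laguerre_link alpha K.
Variables (f : 'rV[R]_N -> R) (M : R).
Hypothesis cf : {within weyl N, continuous f}.
Hypothesis fM : forall y, weyl N y -> `|f y| <= M.
Local Notation Kf := (kernel_op (weyl N) K f).

Let mf : measurable_fun (weyl N) f.
Proof. exact: weyl_continuous_measurable. Qed.

Lemma link_interiorE x : I N.+1 x -> Kf x = \int[K x]_(y in I N) f y.
Proof. by move=> Ix; have [_ H] := link_determinantal alpha_gt hK Ix; exact: (H f M). Qed.

Lemma link_bound x : `|Kf x| <= `|M|.
Proof.
apply: (prob_Rintegral_le (K x) (@weyl_measurable R N) mf (normr_ge0 M)).
by move=> y Wy; exact: le_trans (fM Wy) (ler_norm M).
Qed.

Lemma link_cvg_interior (v : nat -> 'rV[R]_N.+1) x : (forall n, I N.+1 (v n)) ->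
  weyl N.+1 x -> v n @[n --> \oo] --> x -> Kf (v n) @[n --> \oo] --> Kf x.
Proof.
move=> Iv Wx vx; have [Ix|Ix] := pselect (I N.+1 x).
  rewrite link_interiorE//; under eq_fun do rewrite link_interiorE//.
  apply: (link_interior_cvg alpha_gt hK (M := M)) => //.
    exact: measurable_funS (@weyl_measurable R N) (@weyl_interior_sub R N) mf.
  by move=> y Iy; exact/fM/weyl_interior_sub.
apply: (laguerre_link_weak_limit hK Wx Ix Iv vx) => //.
by exists M.
Qed.

Lemma weyl_interior_perturb n (x : 'rV[R]_n) (e : R) : weyl n x -> 0 < e ->
  I n (\row_i (x ord0 i + e * i.+1%:R)).
Proof.
move=> [x0 xW] e0; split => [i|i j ij]; rewrite !mxE.
  by rewrite ltr_wpDl// mulr_gt0// ltr0n.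
by rewrite ler_ltD ?xW// ltr_pM2l// ltr_nat.
Qed.

Lemma cvg_perturb n (x : 'rV[R]_n) :
  \row_i (x ord0 i + j.+1%:R^-1 * i.+1%:R) @[j --> \oo] --> x.
Proof.
apply: cvg_row => i; under eq_fun do rewrite mxE.
have : x ord0 i + j.+1%:R^-1 * i.+1%:R @[j --> \oo] --> x ord0 i + 0 * i.+1%:R.
  by apply: cvgD; [exact: cvg_cst|apply: cvgMl; exact: cvg_harmonic].
by rewrite mul0r addr0.
Qed.

(** Points of the boundary are replaced by interior points at which the value
    is almost the same. *)
Lemma link_continuous : {within weyl N.+1, continuous Kf}.
Proof.
apply: seq_within_continuous => u y Wy Wu uy.
have near_interior k : exists z, [/\ I N.+1 z, ball (u k) k.+1%:R^-1 z &
    `|Kf (u k) - Kf z| < k.+1%:R^-1].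
  have k0 : 0 < k.+1%:R^-1 :> R by rewrite invr_gt0.
  pose z j : 'rV[R]_N.+1 := \row_i (u k ord0 i + j.+1%:R^-1 * i.+1%:R).
  have Iz j : I N.+1 (z j) by apply: weyl_interior_perturb; rewrite ?invr_gt0.
  have zu : z j @[j --> \oo] --> u k by exact: cvg_perturb.
  have /cvg_ballP/(_ _ k0) H1 := zu.
  have /cvgrPdist_lt/(_ _ k0) H2 := link_cvg_interior Iz (Wu k) zu.
  have [j [h1 h2]] : exists j, ball (u k) k.+1%:R^-1 (z j) /\ `|Kf (u k) - Kf (z j)| < k.+1%:R^-1.
    have [j _ Hj] : \forall j \near \oo, ball (u k) k.+1%:R^-1 (z j) /\
        `|Kf (u k) - Kf (z j)| < k.+1%:R^-1 by apply: filterS2 H1 H2.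
    by exists j; exact: (Hj j (leqnn j)).
  by exists (z j).
have [v Hv] := choice near_interior.
have small (e : R) : 0 < e -> \forall n \near \oo, n.+1%:R^-1 < e.
  by move=> e0; exact: (near_infty_natSinv_lt (PosNum e0)).
have vy : v k @[k --> \oo] --> y.
  apply/cvg_ballP => e e0; have e20 : 0 < e / 2 by rewrite divr_gt0.
  have /cvg_ballP/(_ _ e20) := uy; apply: filterS2 (small _ e20) => k ke yu.
  apply: ball_split yu _; have [_ + _] := Hv k; apply: le_ball; exact: ltW.
have Iv k : I N.+1 (v k) by have [] := Hv k.
have Kv := link_cvg_interior Iv Wy vy.
apply/cvgrPdist_lt => e e0; have e20 : 0 < e / 2 by rewrite divr_gt0.
have /cvgrPdist_lt/(_ _ e20) := Kv; apply: filterS2 (small _ e20) => k ke yv.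
have [_ _ uv] := Hv k.
have gen (a b c h : R) : h < e / 2 -> `|b - c| < h -> `|a - c| < e / 2 -> `|a - b| < e.
  by rewrite !ltr_norml => ? /andP[? ?] /andP[? ?]; apply/andP; split; lra.
exact: gen ke uv yv.
Qed.

End link_continuity.

(** * Feller kernels on bounded continuous functions *)

Section chamber_feller.
Context (R : realType) (n : nat).
Local Notation W := (@weyl R n).
Variable (P : R -> 'rV[R]_n -> probability 'rV[R]_n R).
Hypothesis hF : feller_dynkin W (fun t => kernel_op W (P t)).
Hypothesis hC : forall (t : R) x, 0 <= t -> W x -> P t x W = 1%E.

(** These functions vanish at infinity on the chamber and increase to $1$. *)
Let cutoff (m : nat) (y : 'rV[R]_n) : R := (1 + (\sum_i y ord0 i) / m.+1%:R)^-1.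

Let cutoff_arg m y : W y -> 1 <= 1 + (\sum_i y ord0 i) / m.+1%:R.
Proof. by move=> [y0 _]; rewrite lerDl divr_ge0// sumr_ge0. Qed.

Let cutoff01 m y : W y -> 0 <= cutoff m y <= 1.
Proof.
move=> Wy; have H := cutoff_arg m Wy; have p0 := lt_le_trans ltr01 H.
by rewrite /cutoff invr_ge0 (ltW p0)/= invf_le1.
Qed.

Let cutoff_cvg y : W y -> cutoff m y @[m --> \oo] --> (1 : R).
Proof.
move=> Wy; rewrite -[X in _ --> X]invr1; apply: cvgV; first exact: oner_neq0.
rewrite -[X in _ --> X]addr0 -[X in _ --> _ + X](mulr0 (\sum_i y ord0 i)).
by apply: cvgD; [exact: cvg_cst|apply: cvgMr; exact: cvg_harmonic].
Qed.

Let cutoff_seq m (u : nat -> 'rV[R]_n) y : W y -> u k @[k --> \oo] --> y ->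
  cutoff m (u k) @[k --> \oo] --> cutoff m y.
Proof.
move=> Wy uy; apply: cvgV.
  by rewrite gt_eqF// (lt_le_trans ltr01 (cutoff_arg m Wy)).
apply: cvgD; first exact: cvg_cst.
apply: cvgMl; apply: cvg_big => [|i _]; first exact: add_continuous.
exact: cvg_row_coord.
Qed.

Variables (g : 'rV[R]_n -> R) (M : R).
Hypothesis cg : {within W, continuous g}.
Hypothesis gM : forall y, W y -> `|g y| <= M.

Let cut_C_infty m (h : 'rV[R]_n -> R) (B : R) : {within W, continuous h} ->
  (forall y, W y -> `|h y| <= B) -> C_infty W (fun y => h y * cutoff m y).
Proof.
move=> ch hB; split.
  apply: seq_within_continuous => u y Wy Wu uy; apply: cvgM; last exact: cutoff_seq.
  by apply: within_cvg_seq uy => //; apply: nearW.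
move=> e e0; have B0 : 0 <= `|B| by [].
pose L := m.+1%:R * ((`|B| + 1) / e).
exists [set y : 'rV[R]_n | forall i, `[0, L]%classic (y ord0 i)].
  by apply: (@rV_compact R n (fun=> `[0, L]%classic)) => i; exact: segment_compact.
move=> y Wy yL; have [i Li] : exists i, L < y ord0 i.
  apply: contrapT => H; apply: yL => i; rewrite /= in_itv/=; have [-> _] := Wy.
  by rewrite leNgt; apply/negP => h'; apply: H; exists i.
have [y0 _] := Wy; have p0 := lt_le_trans ltr01 (cutoff_arg m Wy).
rewrite normrM /cutoff normfV (gtr0_norm p0) ltr_pdivrMr//.
have S : L <= \sum_i y ord0 i.
  by rewrite (bigD1 i)//= (le_trans (ltW Li))// lerDl sumr_ge0.
apply: (le_lt_trans (hB y Wy)); apply: (le_lt_trans (ler_norm B)).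
apply: (@lt_le_trans _ _ (`|B| + 1)); first by rewrite ltrDl.
rewrite mulrDr mulr1 (@le_trans _ _ (e * ((\sum_i y ord0 i) / m.+1%:R)))//; last first.
  by rewrite lerDr ltW.
rewrite -ler_pdivrMl// ler_pdivlMr//.
by move: S; rewrite /L mulrC (mulrC _ e^-1).
Qed.

Let mg : measurable_fun W g.
Proof. exact: weyl_continuous_measurable. Qed.

Let mW : measurable W.
Proof. exact: weyl_measurable. Qed.

Let continuous1 : {within W, continuous (fun=> 1 : R)}.
Proof. by apply: seq_within_continuous => u y _ _ _; exact: cvg_cst. Qed.

Let cutoff_C_infty m : C_infty W (cutoff m).
Proof.
have := @cut_C_infty m (fun=> 1) 1 continuous1 (fun y _ => eq_ind_r (fun z => z <= 1) (lexx 1) (@normr1 R)).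
by under eq_fun do rewrite mul1r.
Qed.

Let T t := kernel_op W (P t).

Let Tcut_dist t m x : 0 <= t -> W x ->
  `|T t g x - T t (fun y => g y * cutoff m y) x| <= `|M| * (1 - T t (cutoff m) x).
Proof.
move=> t0 Wx.
have mcut : measurable_fun W (cutoff m).
  by have [c _] := cutoff_C_infty m; exact: weyl_continuous_measurable.
have cut1 y : W y -> `|cutoff m y| <= 1.
  by move=> Wy; have /andP[? ?] := cutoff01 m Wy; rewrite ger0_norm.
have i1 := bounded_integrable (P t x) mW mg gM.
have ic := bounded_integrable (P t x) mW mcut cut1.
have mgc : measurable_fun W (fun y => g y * cutoff m y) by exact: measurable_funM.
have i2 : (P t x).-integrable W (EFin \o (fun y => g y * cutoff m y)).
  exact: (integrable_mulr_bounded mW ic mg gM).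
have ione : (P t x).-integrable W (EFin \o (fun=> (1 : R))).
  by apply: (bounded_integrable (P t x) mW (M := 1)) => // y _; rewrite normr1.
rewrite /T /kernel_op -RintegralB//.
have -> : 1 - \int[P t x]_(y in W) cutoff m y = \int[P t x]_(y in W) (1 - cutoff m y).
  by rewrite RintegralB// (prob_Rintegral_cst _ _ (hC t0 Wx)).
have idiff : (P t x).-integrable W (EFin \o (fun y => g y - g y * cutoff m y)).
  exact: (integrableB mW i1 i2).
have idc : (P t x).-integrable W (EFin \o (fun y => 1 - cutoff m y)).
  exact: (integrableB mW ione ic).
rewrite (le_trans (le_normr_Rintegral _ idiff))// -RintegralZl//.
apply: le_Rintegral => //.
- exact: integrable_normr.
- exact: integrableZl_real.
move=> y Wy; rewrite -{1}[g y]mulr1 -mulrBr normrM.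
have /andP[c0 c1] := cutoff01 m Wy.
rewrite [X in _ * X]ger0_norm ?subr_ge0// ler_wpM2r ?subr_ge0//.
exact: le_trans (gM Wy) (ler_norm M).
Qed.

Let Tcut_cvg t x (h : 'rV[R]_n -> R) (B : R) : 0 <= t -> W x -> measurable_fun W h ->
  (forall y, W y -> `|h y| <= B) ->
  T t (fun y => h y * cutoff m y) x @[m --> \oo] --> T t h x.
Proof.
move=> t0 Wx mh hB.
have mcut m : measurable_fun W (cutoff m).
  by have [c _] := cutoff_C_infty m; exact: weyl_continuous_measurable.
have iB : (P t x).-integrable W (EFin \o (fun=> `|B|)).
  by apply: (bounded_integrable (P t x) mW (M := `|B|)) => // y _; rewrite normr_id.
have [||_ _ H] := @dominated_convergence_real _ _ _ (P t x) W
  (fun m y => h y * cutoff m y) h (fun=> `|B|) mW (fun m => measurable_funM mh (mcut m)) _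
  iB _; last exact: H.
- move=> y Wy; rewrite -[X in _ --> X]mulr1; apply: cvgMr; exact: cutoff_cvg.
- move=> m y Wy; have /andP[c0 c1] := cutoff01 m Wy.
  rewrite normrM (ger0_norm c0) (le_trans (ler_piMr _ c1))//.
  exact: le_trans (hB y Wy) (ler_norm B).
Qed.

(** Conservativity makes the mass lost by cutting off small, locally uniformly
    in the starting point. *)
Lemma feller_bounded_cvg t (u : nat -> 'rV[R]_n) x : 0 <= t -> W x ->
  (forall k, W (u k)) -> u k @[k --> \oo] --> x ->
  kernel_op W (P t) g (u k) @[k --> \oo] --> kernel_op W (P t) g x.
Proof.
move=> t0 Wx Wu ux; rewrite -/(T t).
have cont (h : 'rV[R]_n -> R) : C_infty W h -> T t h (u k) @[k --> \oo] --> T t h x.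
  move=> Ch; have [c _] := feller_C_infty hF t0 Ch.
  by apply: (within_cvg_seq c Wx _ ux); exact: nearW.
apply/cvgrPdist_lt => e e0; have e30 : 0 < e / 4 by rewrite divr_gt0.
have mass : `|M| * (1 - T t (cutoff m) x) @[m --> \oo] --> (0 : R).
  rewrite -[X in _ --> X](mulr0 `|M|); apply: cvgMr.
  rewrite -[X in _ --> X](subrr 1); apply: cvgB; first exact: cvg_cst.
  have := Tcut_cvg t0 Wx (measurable_cst (1 : R)) (fun y _ => eq_ind_r (fun z => z <= 1) (lexx 1) (@normr1 R)).
  under eq_fun => m do under [X in T t X]eq_fun do rewrite mul1r.
  by rewrite /T /kernel_op (prob_Rintegral_cst _ _ (hC t0 Wx)).
have /cvgrPdist_lt/(_ _ e30)[m _ /(_ m (leqnn m))] := mass.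
rewrite distrC subr0 => /(le_lt_trans (ler_norm _)) hm.
have c1 : `|M| * (1 - T t (cutoff m) (u k)) @[k --> \oo] --> `|M| * (1 - T t (cutoff m) x).
  by apply: cvgMr; apply: cvgB; [exact: cvg_cst|exact: cont].
have c2 := cont _ (cut_C_infty m cg gM).
have /cvgrPdist_lt/(_ _ e30) h1 := c1; have /cvgrPdist_lt/(_ _ e30) h2 := c2.
apply: filterS2 h1 h2 => k h1 h2.
have d1 := Tcut_dist m t0 Wx; have d2 := Tcut_dist m t0 (Wu k).
have gen (a b a' b' A B : R) : A < e / 4 -> `|A - B| < e / 4 -> `|a' - b'| < e / 4 ->
    `|a - a'| <= A -> `|b - b'| <= B -> `|a - b| < e.
  rewrite !ltr_norml !ler_norml => ? /andP[? ?] /andP[? ?] /andP[? ?] /andP[? ?].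
  by apply/andP; split; lra.
exact: gen hm h1 h2 d1 d2.
Qed.

Lemma feller_bounded_id x : W x -> kernel_op W (P 0) g x = g x.
Proof.
move=> Wx; have c1 := Tcut_cvg (lexx 0) Wx mg gM.
have c2 : g x * cutoff m x @[m --> \oo] --> g x.
  by rewrite -[X in _ --> X]mulr1; apply: cvgMr; exact: cutoff_cvg.
move: c1; under eq_fun => m do rewrite /T (feller_id hF (cut_C_infty m cg gM) Wx).
by move=> c1; exact: (cvg_unique _ c1 c2).
Qed.

End chamber_feller.

(** * The intertwining relation *)

Section intertwining_interior.
Context (R : realType) (alpha : R) (alpha_gt : -1 < alpha).
Variables (p : R -> R -> R -> R) (N : nat).
Hypothesis hp : laguerre_transition_density alpha p.
Variable (P : R -> 'rV[R]_N -> probability 'rV[R]_N R).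
Hypothesis hP : laguerre_weyl_semigroup p P.
Variable (P1 : R -> 'rV[R]_N.+1 -> probability 'rV[R]_N.+1 R).
Hypothesis hP1 : laguerre_weyl_semigroup p P1.
Variable (K : 'rV[R]_N.+1 -> probability 'rV[R]_N R).
Hypothesis hK : laguerre_link alpha K.

Lemma weyl_closed n : closed (weyl n : set 'rV[R]_n).
Proof.
rewrite (_ : weyl n = \bigcap_(i in [set: 'I_n]) ([set y : 'rV[R]_n | 0 <= y ord0 i] `&`
    \bigcap_(j in [set j : 'I_n | (i < j)%N]) [set y : 'rV[R]_n | 0 <= y ord0 j - y ord0 i])); last first.
  apply/seteqP; split => [y [y0 Hy] i _ /=|y Hy].
    by split => // j ij; rewrite /= subr_ge0; exact: Hy.
  split => [i|i j ij]; first by have [] := Hy i I.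
  by have [_ /(_ j ij)/=] := Hy i I; rewrite subr_ge0.
apply: closed_bigI => i _; apply: closedI.
  apply: (closed_comp (f := fun y : 'rV[R]_n => y ord0 i) _ (@closed_ge R 0)) => y _.
  exact: coord_continuous.
apply: closed_bigI => j _.
apply: (closed_comp (f := fun y : 'rV[R]_n => y ord0 j - y ord0 i) _ (@closed_ge R 0)) => y _.
by apply: continuousB; exact: coord_continuous.
Qed.

(** The laws at interior points charge only the open chamber, where the function
    is approximated by combinations of boxes. *)
Lemma intertwining_interior (f : 'rV[R]_N -> R) t x : C_infty (weyl N) f ->
  0 < t -> weyl_interior N.+1 x ->
  kernel_op (weyl N.+1) (P1 t) (kernel_op (weyl N) K f) x =
  kernel_op (weyl N) K (kernel_op (weyl N) (P t) f) x.
Proof.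
move=> Cf t0 Ix; have [Q hQ hpQ] := hp.
have [M _ fM] := C_infty_bounded (@weyl_closed N) Cf; have [cf _] := Cf.
have box c d : (forall i, 0 < c i) -> (forall i, c i <= d i) ->
    (forall i j : 'I_N, (i < j)%N -> d i < c j) ->
    exists M, intertwined P P1 K t M (det_quotient (fun i => \1_(`]c i, d i]%classic) : R -> R)).
  by move=> c0 cd sep; eexists; exact: (box_intertwined alpha_gt hQ hpQ hP hP1 hK t0 c0 cd sep).
have [M' If] := continuous_intertwined box cf fM.
have mf := weyl_continuous_measurable cf.
have cKf := link_continuous alpha_gt hK cf fM.
have [_ E1] := weyl_semigroup_determinantal hpQ hP1 t0 Ix.
have CPf := feller_C_infty (laguerre_weyl_feller hP) (ltW t0) Cf.
have [M1 _ PfM] := C_infty_bounded (@weyl_closed N) CPf; have [cPf _] := CPf.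
rewrite (link_interiorE alpha_gt hK cPf PfM Ix).
rewrite {1}/kernel_op (E1 _ `|M| (weyl_continuous_measurable cKf)); last first.
  by move=> y _; exact: (link_bound K cf fM).
transitivity (\int[P1 t x]_(x' in weyl_interior N.+1) \int[K x']_(y in weyl_interior N) f y).
  by apply: eq_Rintegral => x' /set_mem Ix'; exact: (link_interiorE alpha_gt hK cf fM Ix').
rewrite (intertwined_eq If Ix); apply: eq_Rintegral => y /set_mem Iy.
have [_ E2] := weyl_semigroup_determinantal hpQ hP t0 Iy.
by rewrite /kernel_op (E2 f M).
Qed.

End intertwining_interior.

Theorem theorem1p1 (R : realType) (alpha : R) (halpha : -1 < alpha)
    (p : R -> R -> R -> R) (hp : laguerre_transition_density alpha p)
    (N : nat) (hN : (0 < N)%N)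
    (P : R -> 'rV[R]_N -> probability 'rV[R]_N R)
    (hP : laguerre_weyl_semigroup p P)
    (P1 : R -> 'rV[R]_N.+1 -> probability 'rV[R]_N.+1 R)
    (hP1 : laguerre_weyl_semigroup p P1)
    (K : 'rV[R]_N.+1 -> probability 'rV[R]_N R)
    (hK : laguerre_link alpha K)
    (f : 'rV[R]_N -> R) (hf : C_infty (weyl N) f)
    (t : R) (ht : 0 <= t) (x : 'rV[R]_N.+1) (hx : weyl N.+1 x) :
  kernel_op (weyl N.+1) (P1 t) (kernel_op (weyl N) K f) x =
  kernel_op (weyl N) K (kernel_op (weyl N) (P t) f) x.
Proof.
have [M _ fM] := C_infty_bounded (@weyl_closed R N) hf; have [cf _] := hf.
have cKf := link_continuous halpha hK cf fM.
have KfM y : weyl N.+1 y -> `|kernel_op (weyl N) K f y| <= `|M|.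
  by move=> _; exact: (link_bound K cf fM).
have hF1 := laguerre_weyl_feller hP1; have hC1 := laguerre_weyl_conservative hP1.
have CPf := feller_C_infty (laguerre_weyl_feller hP) ht hf.
have [M1 _ PfM] := C_infty_bounded (@weyl_closed R N) CPf; have [cPf _] := CPf.
move: ht; rewrite le_eqVlt => /predU1P[t0|t0].
  rewrite -{t}t0 in CPf M1 PfM cPf *.
  rewrite (feller_bounded_id hF1 cKf KfM hx).
  apply: eq_Rintegral => y /set_mem Wy.
  by rewrite (feller_id (laguerre_weyl_feller hP) hf Wy).
pose u k : 'rV[R]_N.+1 := \row_i (x ord0 i + k.+1%:R^-1 * i.+1%:R).
have Iu k : weyl_interior N.+1 (u k) by apply: weyl_interior_perturb; rewrite ?invr_gt0.
have ux : u k @[k --> \oo] --> x by exact: cvg_perturb.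
have c1 := feller_bounded_cvg hF1 hC1 cKf KfM (ltW t0) hx
  (fun k => weyl_interior_sub (Iu k)) ux.
have c2 := link_cvg_interior halpha hK cPf PfM Iu hx ux.
move: c1; under eq_fun do rewrite (intertwining_interior halpha hp hP hP1 hK hf t0 (Iu _)).
by move=> c1; exact: (cvg_unique _ c1 c2).
Qed.
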